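(* Let $m\ge2$, let $h=(h_1,\dots,h_l)\colon\mathbb{R}^{m+l}\to\mathbb{R}^l$ be a smooth map such that $h^{-1}(0)\ne\emptyset$ and $\operatorname{rank}dh(x)=l$ for all $x\in h^{-1}(0)$, and let $f\colon\mathbb{R}^{m+l}\to\mathbb{R}^{2m-1}$ be a smooth map. Take $p\in h^{-1}(0)$ such that $\operatorname{rank}d(f|h^{-1}(0))(p)=m-1$ (this occurs if and only if $\operatorname{rank}d(h,f)(p)=m-1+l$). Then $p$ is a cross-cap of $f|h^{-1}(0)$ if and only if $p$ is a regular zero of the mapping $\mu|h^{-1}(0)$, where $\mu\colon\mathbb{R}^{m+l}\to\mathbb{R}^s$ is given at each point by all the $(m+l)\times(m+l)$ minors of the Jacobian matrix $d(h,f)$ at that point.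
   Context: $h^{-1}(0)$ is a smooth $m$-dimensional manifold. $d(h,f)(x)$ is the $(2m-1+l)\times(m+l)$ Jacobian matrix of $(h,f)\colon\mathbb{R}^{m+l}\to\mathbb{R}^l\times\mathbb{R}^{2m-1}$ at $x$; $s$ is the number of its $(m+l)\times(m+l)$ minors. $p$ is a regular zero of $\mu|h^{-1}(0)$ means that $\mu(p)=0$ and $\operatorname{rank}d(\mu|h^{-1}(0))(p)=m$. A point $p$ of an $m$-dimensional manifold is a cross-cap of a smooth map to $\mathbb{R}^{2m-1}$ if, in suitable coordinate systems centred at $p$ and at its image, the map has near $p$ the form $(x_1,\dots,x_m)\mapsto(x_1^2,x_2,\dots,x_m,x_1x_2,\dots,x_1x_m)$. *)

(* Defs.v *)
From HB Require Import structures.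
From mathcomp Require Import all_boot all_order all_algebra.
From mathcomp Require Import all_classical all_reals all_analysis.
Set Implicit Arguments.
Unset Strict Implicit.
Unset Printing Implicit Defensive.
Import Order.TTheory GRing.Theory Num.Theory.
Import numFieldNormedType.Exports.
Local Open Scope classical_set_scope.
Local Open Scope ring_scope.

(* C^k on the open set U *)
Fixpoint Ck_on (R : realType) (n d : nat) (k : nat) (U : set 'rV[R]_n)
    (f : 'rV[R]_n -> 'rV[R]_d) : Prop :=
  if k is k'.+1 then
    (forall x, U x -> differentiable f x) /\
    (forall i : 'I_n, Ck_on k' U ('D_(delta_mx 0 i) f))
  else forall x, U x -> {for x, continuous f}.

Definition smooth_on (R : realType) (n d : nat) (U : set 'rV[R]_n)
    (f : 'rV[R]_n -> 'rV[R]_d) : Prop := forall k, Ck_on k U f.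

Definition smooth (R : realType) (n d : nat) (f : 'rV[R]_n -> 'rV[R]_d) : Prop :=
  smooth_on setT f.

(* The library's jacobian acts on row vectors; its transpose is the usual
   d x n Jacobian matrix. *)
Definition Jac (R : realType) (n d : nat) (f : 'rV[R]_n -> 'rV[R]_d)
    (x : 'rV[R]_n) : 'M[R]_(d, n) := ('J f x)^T.

(* A coordinate system centred at p on a submanifold M of R^n, given by its
   inverse phi : U -> M. The coordinates themselves are the restriction to the
   open subset phi @` U = M `&` W of M of the smooth map psi. *)
Definition coord_system (R : realType) (m n : nat) (M : set 'rV[R]_n)
    (p : 'rV[R]_n) (U : set 'rV[R]_m) (phi : 'rV[R]_m -> 'rV[R]_n) : Prop :=
  [/\ open U, U 0, phi 0 = p, smooth_on U phi &
      exists (W : set 'rV[R]_n) (psi : 'rV[R]_n -> 'rV[R]_m),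
        [/\ open W, smooth_on W psi, phi @` U = M `&` W &
            forall u, U u -> psi (phi u) = u]].

(* rank d(g|M)(p) = r, where M is an m-dimensional submanifold: the rank is that
   of the Jacobian of g|M in a coordinate system of M centred at p (it does not
   depend on the coordinate system). *)
Definition restr_rank (R : realType) (m n d : nat) (M : set 'rV[R]_n)
    (g : 'rV[R]_n -> 'rV[R]_d) (p : 'rV[R]_n) (r : nat) : Prop :=
  exists (U : set 'rV[R]_m) (phi : 'rV[R]_m -> 'rV[R]_n),
    coord_system M p U phi /\ \rank (Jac (g \o phi) 0) = r.

Definition regular_zero (R : realType) (m n d : nat) (M : set 'rV[R]_n)
    (g : 'rV[R]_n -> 'rV[R]_d) (p : 'rV[R]_n) : Prop :=
  g p = 0 /\ restr_rank m M g p m.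

(* x_(i+1), and 0 when i is out of range *)
Definition entry (R : realType) (m : nat) (x : 'rV[R]_m) (i : nat) : R :=
  if insub i is Some j then x 0 j else 0.

Definition cross_cap_form (R : realType) (m : nat) (x : 'rV[R]_m) :
    'rV[R]_(2 * m - 1) :=
  \row_(j < 2 * m - 1)
    if j == 0%N :> nat then entry x 0%N ^+ 2
    else if (j < m)%N then entry x j
    else entry x 0%N * entry x (j - m).+1%N.

Definition cross_cap (R : realType) (m n : nat) (M : set 'rV[R]_n)
    (f : 'rV[R]_n -> 'rV[R]_(2 * m - 1)) (p : 'rV[R]_n) : Prop :=
  exists (U : set 'rV[R]_m) (phi : 'rV[R]_m -> 'rV[R]_n)
         (V : set 'rV[R]_(2 * m - 1))
         (eta : 'rV[R]_(2 * m - 1) -> 'rV[R]_(2 * m - 1)),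
    [/\ coord_system M p U phi, coord_system setT (f p) V eta &
        \forall u \near (0 : 'rV[R]_m), f (phi u) = eta (cross_cap_form u)].

(* the choices of n rows among N, as increasing tuples *)
Definition row_choices (N n : nat) : {set n.-tuple 'I_N} :=
  [set t : n.-tuple 'I_N | sorted ltn [seq val i | i <- t]]%SET.

Lemma card_row_choices (N n : nat) : #|row_choices N n| = 'C(N, n).
Proof. exact: card_ltn_sorted_tuples. Qed.

(* all the n x n minors of the Jacobian matrix of F *)
Definition max_minors (R : realType) (n N : nat) (F : 'rV[R]_n -> 'rV[R]_N)
    (x : 'rV[R]_n) : 'rV[R]_#|row_choices N n| :=
  \row_k \det (rowsub (tnth (enum_val k)) (Jac F x)).

Definition pair_map (R : realType) (n a b : nat) (h : 'rV[R]_n -> 'rV[R]_a)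
    (f : 'rV[R]_n -> 'rV[R]_b) (x : 'rV[R]_n) : 'rV[R]_(a + b) :=
  row_mx (h x) (f x).

(* Main.v *)
From HB Require Import structures.
Require Import Defs.
From mathcomp Require Import all_boot all_order all_algebra.
From mathcomp Require Import all_classical all_reals all_analysis.
From mathcomp Require Import ring lra zify.
Set Implicit Arguments.
Unset Strict Implicit.
Unset Printing Implicit Defensive.
Import Order.TTheory GRing.Theory Num.Theory.
Import numFieldNormedType.Exports.
Local Open Scope classical_set_scope.
Local Open Scope ring_scope.

(** Matrices act on row vectors from the right, so that the kernel of a
    differential is a left kernel. Let F = (h, f) and let phi parametrize
    Z = h^-1(0) near p. The bridge between the two properties of p is Whitney's
    second-order condition ([whitney]) for g = f o phi at the origin: if k spans the
    kernel of dg(0), then for every v <> 0 the second derivative of g in the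
    directions k and v is not in the image of dg(0).

    This condition does not depend on coordinates: the chain rule for second
    derivatives ([djac_comp]) has two terms, and the unwanted one is either killed by k
    or contained in the image ([whitney_target], [whitney_source]). The same
    argument translates it into a condition on F at p in which v is restricted to the
    tangent space of Z ([whitney_chart]).

    The minors. They vanish at p, where the rank of F is m - 1 + l. Let k span the
    kernel of dF(p) and k_i <> 0. The product of k_i by a minor can be computed by
    replacing its row i by the combination k of all rows, which vanishes at p; so its
    derivative at p in the direction w is the same minor of the matrix obtained from
    dF(p) by replacing the row i by the second derivative of F in the directions k
    and w ([det_derive], [max_minors_derive]). All these derivatives vanish exactly
    when that second derivative lies in the image of dF(p). Hence p is a regular zero of
    the restriction of the minors to Z if and only if Whitney's condition holds
    ([minors_whitney], [regular_zero_whitney]).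

    The normal form. A cross-cap satisfies the condition by direct computation
    ([ccap_whitney]). Conversely ([whitney_cross_cap]), a germ of corank one is, up to
    coordinates, of the form (z_0, y) |-> (a, y, c), where the condition, applied to
    k = v, makes the second derivative of a with respect to z_0 nonzero
    ([flat_reduction]). Morse's lemma with parameters turns a into z_0^2 + d(y)
    ([morse]). Splitting c into its even and odd parts in z_0 gives
    c = A(z_0^2, y) + z_0 B(z_0^2, y) with A and B smooth ([parity_split]). The condition
    now says that (z_0, y) |-> (z_0, B) is a local diffeomorphism ([fold_jac_unit]), and
    taking B(z_0^2, y) as new coordinates y gives the cross-cap ([fold_cross_cap]).

    The analytic ingredients are the inverse function theorem ([local_inverse]),
    Hadamard's lemma ([hadamard_germ]) and Whitney's theorem that a smooth even
    function is a smooth function of the square ([even_germ]). The last one requires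
    the extension of a smooth function across the boundary of a half-space, done with
    Seeley's reflection: the coefficients a_k with sum a_k (-2^k)^j = 1 for all j come
    from the entire function with simple zeros at the powers of 2. *)

(** * Partial derivatives and differentiability *)

Lemma is_diff_of_estimate (R : realType) (V W : normedModType R) (f : V -> W)
    (L : {linear V -> W}) (x : V) : continuous L ->
  (forall e, 0 < e -> \forall v \near 0, `|f (v + x) - f x - L v| <= e * `|v|) ->
  is_diff x f L.
Proof.
move=> cL est.
have H : f \o shift x = cst (f x) + L +o_ 0 id.
  apply/eqaddoP => e e0; apply: filterS (est e e0) => v.
  by rewrite !fctE /= opprD addrA.
split; last exact: (diff_unique cL H).
by apply/diff_locallyP; rewrite (diff_unique cL H).
Qed.

Section RowVectors.
Variables (R : realType) (n : nat).
Implicit Types (x v : 'rV[R]_n) (a b : 'rV[R]_n -> R) (U : set 'rV[R]_n).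

Lemma rV_norm_coord x i : `|x 0 i| <= `|x|.
Proof.
rewrite [leRHS]/Num.Def.normr/= mx_normrE.
exact: (le_bigmax _ (fun ij : 'I_1 * 'I_n => `|x ij.1 ij.2|) (0, i)).
Qed.

Lemma rV_norm_le x c : 0 <= c -> (forall i, `|x 0 i| <= c) -> `|x| <= c.
Proof.
move=> c0 xc; rewrite /Num.Def.normr/= mx_normrE; apply: bigmax_le => //= -[i j] _ /=.
by rewrite (ord1 i); exact: xc.
Qed.

Lemma rV_norm_lt x c : 0 < c -> (forall i, `|x 0 i| < c) -> `|x| < c.
Proof.
move=> c0 xc; rewrite /Num.Def.normr/= mx_normrE; apply: bigmax_lt => //= -[i j] _ /=.
by rewrite (ord1 i); exact: xc.
Qed.

End RowVectors.

Section GenericTopology.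
Variables (R : realType) (T : topologicalType).
Implicit Types (f g : T -> R) (x : T).

Lemma near_all (P : T -> Prop) x : (forall z, P z) -> \forall z \near x, P z.
Proof. by move=> H; exact: nearW. Qed.

Lemma near_forall (I : finType) (P : I -> T -> Prop) x :
  (forall i, \forall z \near x, P i z) -> \forall z \near x, forall i, P i z.
Proof. by move=> H; apply: filter_forall. Qed.

Lemma continuous_at_dist (V : normedModType R) (f : T -> V) x :
  {for x, continuous f} <-> forall e, 0 < e -> \forall z \near x, `|f x - f z| < e.
Proof. by split => [/cvgrPdist_lt//|H]; apply/cvgrPdist_lt. Qed.

Lemma continuous_at_add f g x : {for x, continuous f} -> {for x, continuous g} ->
  {for x, continuous (fun z => f z + g z)}.
Proof. by move=> cf cg; apply: cvgD. Qed.

Lemma continuous_at_mul f g x : {for x, continuous f} -> {for x, continuous g} ->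
  {for x, continuous (fun z => f z * g z)}.
Proof. by move=> cf cg; apply: cvgM. Qed.

Lemma continuous_at_inv f x : f x != 0 -> {for x, continuous f} ->
  {for x, continuous (fun z => (f z)^-1)}.
Proof. by move=> f0 cf; apply: cvgV. Qed.

Lemma continuous_at_norm f x : {for x, continuous f} -> {for x, continuous (fun z => `|f z|)}.
Proof. by move=> cf; apply: cvg_norm. Qed.

Lemma continuous_at_ext f g x : (\near x, f x = g x) -> {for x, continuous f} ->
  {for x, continuous g}.
Proof.
move=> fg /continuous_at_dist cf; apply/continuous_at_dist => e e0.
have fgx : f x = g x by exact: (nbhs_singleton fg).
by apply: filterS2 fg (cf e e0) => z <-; rewrite -fgx.
Qed.

Lemma continuous_at_rV n (F : T -> 'rV[R]_n) x :
  (forall j, {for x, continuous (fun z => F z 0 j)}) -> {for x, continuous F}.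
Proof.
move=> cF; apply/continuous_at_dist => e e0.
have : \forall z \near x, forall j, `|F x 0 j - F z 0 j| < e.
  by apply: near_forall => j; have /continuous_at_dist := cF j; exact.
by apply: filterS => z H; apply: rV_norm_lt => // j; rewrite !mxE.
Qed.

Lemma nbhs_distP (V : normedModType R) (x : V) (P : set V) :
  nbhs x P <-> exists2 r : R, 0 < r & forall z, `|z - x| < r -> P z.
Proof.
split=> [/nbhs_ballP[r r0 rP]|[r r0 rP]]; last apply/nbhs_ballP; exists r => // z.
  by move=> zr; apply: rP; rewrite -ball_normE /ball_ /= distrC.
by rewrite -ball_normE /ball_ /= distrC; exact: rP.
Qed.

Lemma open_dist_lt (V : normedModType R) (a : V) (r : R) : open [set x | `|x - a| < r].
Proof.
rewrite openE => x /= xr; apply/nbhs_distP; exists (r - `|x - a|); first by rewrite subr_gt0.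
move=> z zx; rewrite /= -(subrKA x); apply: le_lt_trans (ler_normD _ _) _.
by lra.
Qed.

End GenericTopology.

Section MeanValue.
Variable R : realType.

Lemma mvt_between (F dF : R -> R) (a b : R) :
  (forall t : R, Num.min a b < t < Num.max a b -> is_derive t (1 : R) F (dF t)) ->
  (forall t : R, Num.min a b <= t <= Num.max a b -> {for t, continuous F}) ->
  exists2 c, Num.min a b <= c <= Num.max a b & F b - F a = dF c * (b - a).
Proof.
have wl (a' b' : R) : a' < b' -> (forall t : R, a' < t < b' -> is_derive t (1 : R) F (dF t)) ->
    (forall t : R, a' <= t <= b' -> {for t, continuous F}) ->
    exists2 c, a' <= c <= b' & F b' - F a' = dF c * (b' - a').
  move=> ab d k; have [|c] := @MVT R F dF a' b' ab.
    by apply: continuous_in_subspaceT => t; rewrite inE /= in_itv; exact: k.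
  by rewrite in_itv /= => /andP[? ?] E; exists c; rewrite ?ltW.
have [ab|ba|<-] := ltgtP a b => d k; [exact: wl| |].
  by have [c cI E] := wl b a ba d k; exists c => //; rewrite -opprB E -mulrN opprB.
by exists a; rewrite ?lexx // !subrr mulr0.
Qed.

End MeanValue.

Section PartialDerivatives.
Variables (R : realType) (n : nat).
Implicit Types (x v : 'rV[R]_n) (a b : 'rV[R]_n -> R) (U : set 'rV[R]_n).

Lemma between0 (c t : R) : Num.min 0 c <= t <= Num.max 0 c -> `|t| <= `|c|.
Proof.
have [c0|c0] := leP 0 c => /andP[t0 t1]; first by rewrite !ger0_norm.
by rewrite !ler0_norm ?lerN2 // ltW.
Qed.

Lemma line_derive a x v (t : R) : derivable a (t *: v + x) v ->
  is_derive t 1 (fun h => a (h *: v + x)) ('D_v a (t *: v + x)).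
Proof.
move=> da.
have E : (fun h : R => h^-1 *: (((fun h => a (h *: v + x)) \o shift t) (h *: 1) - a (t *: v + x)))
  = (fun h => h^-1 *: ((a \o shift (t *: v + x)) (h *: v) - a (t *: v + x))).
  by apply/funext => h /=; rewrite [h *: 1]mulr1 scalerDl addrA.
by split; [rewrite /derivable E | rewrite /derive E].
Qed.

Lemma line_derivable a x v :
  derivable (fun h : R => a (h *: v + x)) 0 1 -> derivable a x v.
Proof. by move=> ?; apply/derivable1P. Qed.

Lemma coord_mvt a (i : 'I_n) x (c : R) :
  (forall t, `|t| <= `|c| -> derivable a (t *: delta_mx 0 i + x) (delta_mx 0 i)) ->
  exists2 t, `|t| <= `|c| &
    a (c *: delta_mx 0 i + x) - a x = 'D_(delta_mx 0 i) a (t *: delta_mx 0 i + x) * c.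
Proof.
set e := delta_mx 0 i => da.
pose f h := a (h *: e + x); pose df t := 'D_e a (t *: e + x).
have dP (t : R) : `|t| <= `|c| -> is_derive t (1 : R) f (df t) by move=> tc; apply/line_derive/da.
have [||t tI E] := @mvt_between R f df 0 c.
- by move=> t /andP[t1 t2]; apply/dP/between0; rewrite !ltW.
- by move=> t /between0 tc; apply/differentiable_continuous/derivable1_diffP; case: (dP t tc).
exists t; first exact: between0.
by move: E; rewrite /f scale0r add0r subr0.
Qed.

Definition pd (i : 'I_n) a : 'rV[R]_n -> R := 'D_(delta_mx 0 i) a.

Definition grad_form a x (v : 'rV[R]_n) : R := \sum_i v 0 i * pd i a x.

Lemma grad_form_linear a x : linear (grad_form a x).
Proof.
move=> k u v; rewrite /grad_form scaler_sumr -big_split/=; apply: eq_bigr => i _.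
by rewrite !mxE mulrDl -mulrA.
Qed.

Lemma grad_form_continuous a x : continuous (grad_form a x).
Proof.
rewrite /grad_form; apply: continuous_big => [|i _]; first exact: add_continuous.
move=> v; apply: (@continuous_at_mul _ _ (fun w : 'rV[R]_n => w 0 i)); last exact: cst_continuous.
exact: coord_continuous.
Qed.

(** The increment is split along the broken line that changes one coordinate at a
    time; each piece is controlled by a one-variable mean value theorem. *)
Lemma coord_path_estimate a x (r e : R) (v : 'rV[R]_n) : 0 <= e ->
  (forall z i, `|z - x| < r -> derivable a z (delta_mx 0 i)) ->
  (forall z i, `|z - x| < r -> `|pd i a z - pd i a x| <= e) ->
  `|v| < r -> `|a (v + x) - a x - grad_form a x v| <= n%:R * (e * `|v|).
Proof.
move=> e0 da ca vr.
pose w k : 'rV[R]_n := \row_i if (i < k)%N then v 0 i else 0.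
have H k : (k <= n)%N ->
  `|a (w k + x) - a x - \sum_(i < n | (i < k)%N) v 0 i * pd i a x|
    <= k%:R * (e * `|v|).
  elim: k => [_|k IH kn].
    rewrite big_pred0 // (_ : w 0%N = 0) ?add0r ?subrr ?subr0 ?normr0 ?mul0r //.
    by apply/rowP => i; rewrite !mxE.
  (* [w k] agrees with [v] on the first [k] coordinates *)
  pose i0 : 'I_n := Ordinal kn.
  have wS : w k.+1 = v 0 i0 *: delta_mx 0 i0 + w k.
    apply/rowP => i; rewrite !mxE eqxx/= ltnS leq_eqVlt -(inj_eq val_inj)/=.
    by case: ltngtP => //= ik; rewrite ?mulr0 ?add0r ?addr0 ?mulr1 //; congr (v _ _); exact: val_inj.
  have near t : `|t| <= `|v 0 i0| -> `|t *: delta_mx 0 i0 + (w k + x) - x| < r.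
    move=> tv; rewrite addrA addrK; apply: le_lt_trans vr.
    apply: rV_norm_le => // i; rewrite !mxE eqxx/=.
    have [->|ne] := eqVneq i i0.
      by rewrite ltnn mulr1 addr0 (le_trans tv) ?rV_norm_coord.
    by rewrite mulr0 add0r; case: ifP; rewrite ?normr0 ?rV_norm_coord.
  have [t tv E] := @coord_mvt a i0 (w k + x) (v 0 i0) (fun t tv => da _ _ (near t tv)).
  have {E} E : a (w k.+1 + x) = a (w k + x) + pd i0 a (t *: delta_mx 0 i0 + (w k + x)) * v 0 i0.
    by rewrite wS -addrA [RHS]addrC -E subrK.
  rewrite E (bigD1 i0) ?ltnSn //=.
  rewrite (eq_bigl (fun i : 'I_n => (i < k)%N)); last first.
    move=> i; rewrite ltnS ltn_neqAle andbC; congr andb.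
  set S := \sum_(i < _ | _) _ in IH *; set p := pd _ _ _.
  rewrite (_ : _ - _ = (a (w k + x) - a x - S) + (p - pd i0 a x) * v 0 i0); last by ring.
  apply: le_trans (ler_normD _ _) _; rewrite -natr1 (mulrDl _ 1) mul1r.
  apply: lerD; first exact/IH/ltnW.
  by rewrite normrM ler_pM // ?rV_norm_coord //; apply/ca/near.
have := H n (leqnn n); rewrite (_ : w n = v); last first.
  by apply/rowP => i; rewrite mxE ltn_ord.
by rewrite /grad_form (eq_bigl xpredT) // => i; rewrite ltn_ord.
Qed.

Lemma grad_form_axis a x i (c : R) : grad_form a x (c *: delta_mx 0 i) = c * pd i a x.
Proof.
rewrite /grad_form (bigD1 i) //= big1 => [|k ki].
  by rewrite !mxE !eqxx mulr1 addr0.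
by rewrite !mxE eqxx (negPf ki) mulr0 mul0r.
Qed.

Lemma C1_is_diff a x U : open U -> U x ->
  (forall z i, U z -> derivable a z (delta_mx 0 i)) ->
  (forall i, {for x, continuous (pd i a)}) ->
  is_diff x a (grad_form a x).
Proof.
move=> oU Ux da ca.
pose lin := GRing.isLinear.Build _ _ _ _ _ (grad_form_linear a x).
pose L : {linear 'rV[R]_n -> R} := HB.pack (grad_form a x) lin.
have cL : continuous L by exact: grad_form_continuous.
apply: (@is_diff_of_estimate _ _ _ a L x cL) => e e0.
pose e' := e / n.+1%:R.
have e'0 : 0 < e' by rewrite divr_gt0.
have nU : \forall z \near x, U z by exact: open_nbhs_nbhs.
have nc : \forall z \near x, forall i, `|pd i a z - pd i a x| <= e'.
  apply: near_forall => i; have /continuous_at_dist /(_ _ e'0) := ca i.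
  by apply: filterS => z; rewrite distrC => /ltW.
have /nbhs_distP[r r0 rP] : \forall z \near x, U z /\ forall i, `|pd i a z - pd i a x| <= e'.
  by apply: filterS2 nU nc.
apply/nbhs_distP; exists r => // v; rewrite subr0 => vr.
apply: le_trans (coord_path_estimate (ltW e'0) _ _ vr) _.
- by move=> z i /rP[Uz _]; exact: da.
- by move=> z i /rP[_]; exact.
rewrite mulrA ler_wpM2r // /e' mulrCA -[leRHS]mulr1; apply: ler_wpM2l; first exact: ltW.
by rewrite ler_pdivrMr ?ltr0n // mul1r ler_nat.
Qed.

End PartialDerivatives.

(** * Chain rules and smooth functions *)

Section ChainRules.
Variables (R : realType) (n : nat).
Implicit Types (x v : 'rV[R]_n) (a b : 'rV[R]_n -> R).

Lemma derive_line a x v : derivable a x v ->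
  is_derive (0 : R) (1 : R) (fun h => a (h *: v + x)) ('D_v a x).
Proof.
move=> da; have E : 0 *: v + x = x by rewrite scale0r add0r.
by rewrite -{2}E; apply: line_derive; rewrite E.
Qed.

Lemma is_derive_line a x v (d : R) :
  is_derive (0 : R) (1 : R) (fun h => a (h *: v + x)) d -> is_derive x v a d.
Proof.
move=> [da E]; have da' : derivable a x v by exact: line_derivable.
by split => //; rewrite -E; have [_ <-] := derive_line da'.
Qed.

Lemma is_derive_scalar_comp (phi : R -> R) a x v (d da : R) :
  is_derive (a x) (1 : R) phi d -> is_derive x v a da ->
  is_derive x v (fun z => phi (a z)) (d * da).
Proof.
move=> dphi [ada aE]; apply: is_derive_line.
have E : 0 *: v + x = x by rewrite scale0r add0r.
apply: (@is_derive1_comp _ phi (fun h => a (h *: v + x))); first by rewrite E.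
by rewrite -aE; exact: derive_line.
Qed.

Lemma is_derive_mul a b x v (da db : R) : is_derive x v a da -> is_derive x v b db ->
  is_derive x v (fun z => a z * b z) (a x * db + b x * da).
Proof. by move=> ? ?; apply: (@is_deriveM _ _ a b). Qed.

Lemma is_derive_add a b x v (da db : R) : is_derive x v a da -> is_derive x v b db ->
  is_derive x v (fun z => a z + b z) (da + db).
Proof. by move=> ? ?; apply: (@is_deriveD _ _ _ a b). Qed.

Lemma is_derive_bigsum (I : finType) (F : I -> 'rV[R]_n -> R) (d : I -> R) x v :
  (forall k, is_derive x v (F k) (d k)) ->
  is_derive x v (fun z => \sum_k F k z) (\sum_k d k).
Proof.
move=> dF.
have H (s : seq I) : is_derive x v (fun z => \sum_(k <- s) F k z) (\sum_(k <- s) d k).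
  elim: s => [|k s IH].
    rewrite big_nil; apply: near_eq_is_derive (is_derive_cst 0 x v).
    by apply: near_all => z; rewrite big_nil.
  rewrite big_cons; apply: near_eq_is_derive (is_derive_add (dF k) IH).
  by apply: near_all => z; rewrite big_cons.
exact: H.
Qed.

Lemma is_derive_opp a x v (da : R) : is_derive x v a da ->
  is_derive x v (fun z => - a z) (- da).
Proof. by move=> ?; apply: (@is_deriveN _ _ _ a). Qed.

Lemma is_derive_inv a x v (da : R) : a x != 0 -> is_derive x v a da ->
  is_derive x v (fun z => (a z)^-1) (- (a x)^-1 ^+ 2 * da).
Proof.
move=> ax [ada aE]; split; first exact: derivableV.
by rewrite deriveV // aE exprVn.
Qed.

Lemma is_derive_coord x v i : is_derive x v (fun z : 'rV[R]_n => z 0 i) (v 0 i).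
Proof.
have d : differentiable (fun z : 'rV[R]_n => z 0 i) x by exact: differentiable_coord.
apply: is_derive_line.
rewrite (_ : (fun h => _) = fun h : R => h * v 0 i + x 0 i); last first.
  by apply/funext => h; rewrite !mxE.
apply: is_derive_eq.
by rewrite addr0 scale0r add0r; exact: mulr1.
Qed.

Lemma chain_rule d (f : 'rV[R]_n -> 'rV[R]_d) (b : 'rV[R]_d -> R) x v (df : 'I_d -> R) :
  (forall j, is_derive x v (fun z => f z 0 j) (df j)) ->
  is_diff (f x) b (grad_form b (f x)) ->
  is_derive x v (fun z => b (f z)) (\sum_j df j * pd j b (f x)).
Proof.
move=> dfP [db bE]; apply: is_derive_line.
pose c (h : R) := f (h *: v + x).
have c0 : c 0 = f x by rewrite /c scale0r add0r.
have dcj j : is_derive (0 : R) (1 : R) (fun h => c h 0 j) (df j).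
  by case: (dfP j) => dj <-; apply: (@derive_line (fun z => f z 0 j)).
have dc : derivable c 0 1.
  by apply/derivable_mxP => i j; rewrite (ord1 i); case: (dcj j).
have diffc : differentiable c 0 by apply/derivable1_diffP.
have diffb : differentiable b (c 0) by rewrite c0.
have dbc : differentiable (b \o c) 0 by exact: differentiable_comp.
split; first by apply/derivable1_diffP.
rewrite -[LHS]/('D_1 (b \o c) 0) deriveE // diff_comp //= c0 bE.
rewrite -deriveE // derive_mx // /grad_form; apply: eq_bigr => j _.
by rewrite mxE; case: (dcj j) => _ ->.
Qed.

End ChainRules.

Section Smoothness.
Variables (R : realType).

(** Class C^k on an open set, stated with iterated partial derivatives; [smf]
    below is smoothness. *)
Fixpoint ckd n (k : nat) (U : set 'rV[R]_n) (a : 'rV[R]_n -> R) : Prop :=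
  (forall x, U x -> {for x, continuous a}) /\
  if k is k'.+1 then
    forall i, (forall x, U x -> derivable a x (delta_mx 0 i)) /\ ckd k' U (pd i a)
  else True.

Definition smf n (U : set 'rV[R]_n) (a : 'rV[R]_n -> R) := forall k, ckd k U a.

Section Fixed.
Variables (n : nat) (U : set 'rV[R]_n).
Hypothesis oU : open U.
Implicit Types (a b : 'rV[R]_n -> R) (x : 'rV[R]_n).

Lemma ckd_continuous k a x : ckd k U a -> U x -> {for x, continuous a}.
Proof. by case: k => [|k] [+ _]; exact. Qed.

Lemma eq_near_open a b x : (forall x, U x -> a x = b x) -> U x -> \near x, a x = b x.
Proof. by move=> ab Ux; apply: filterS ab _; exact: open_nbhs_nbhs. Qed.

Lemma ckd_ext k a b : (forall x, U x -> a x = b x) -> ckd k U a -> ckd k U b.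
Proof.
have C a' b' : (forall x, U x -> a' x = b' x) -> (forall x, U x -> {for x, continuous a'}) ->
    forall x, U x -> {for x, continuous b'}.
  by move=> ab ca x Ux; apply: continuous_at_ext (ca x Ux); exact: eq_near_open.
elim: k a b => [|k IH] a b ab [ca da]; split => //; try exact: C ca.
move=> i; have [dai ckai] := da i; split.
  by move=> x Ux; apply: near_eq_derivable (dai x Ux); exact: eq_near_open.
apply: IH ckai => x Ux; apply: near_eq_derive; exact: eq_near_open.
Qed.

Lemma ckdS_intro k a : (forall x, U x -> {for x, continuous a}) ->
  (forall i, exists g, (forall x, U x -> is_derive x (delta_mx 0 i) a (g x)) /\ ckd k U g) ->
  ckd k.+1 U a.
Proof.
move=> ca da; split => // i; have [g [dg cg]] := da i; split => [x Ux|].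
  by case: (dg x Ux).
by apply: ckd_ext cg => x Ux; case: (dg x Ux).
Qed.

Lemma ckdS_derive k a i x : ckd k.+1 U a -> U x ->
  is_derive x (delta_mx 0 i) a (pd i a x).
Proof. by move=> [_ /(_ i)[da _]] Ux; split => //; exact: da. Qed.

Lemma ckdS_pd k a i : ckd k.+1 U a -> ckd k U (pd i a).
Proof. by move=> [_ /(_ i)[]]. Qed.

Lemma ckdW k a : ckd k.+1 U a -> ckd k U a.
Proof.
elim: k a => [|k IH] a; first by case.
move=> [ca da]; split => // i; have [dai /IH] := da i; by split.
Qed.

Lemma ckd_is_diff k a x : ckd k.+1 U a -> U x -> is_diff x a (grad_form a x).
Proof.
move=> ca Ux; apply: (C1_is_diff oU Ux) => [z i Uz|i]; first by case: (ckdS_derive i ca Uz).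
exact: (ckd_continuous (ckdS_pd i ca)).
Qed.

Lemma ckd_cst k (c : R) : ckd k U (fun=> c).
Proof.
elim: k c => [|k IH] c; first by split=> // x _; exact: cst_continuous.
apply: ckdS_intro => [x _|i]; first exact: cst_continuous.
by exists (fun=> 0); split => // x _; exact: is_derive_cst.
Qed.

Lemma ckd_coord k i : ckd k U (fun x => x 0 i).
Proof.
case: k => [|k]; first by split=> // x _; exact: coord_continuous.
apply: ckdS_intro => [x _|j]; first exact: coord_continuous.
by exists (fun=> (delta_mx 0 j : 'rV[R]_n) 0 i); split => [x _|]; [exact: is_derive_coord | exact: ckd_cst].
Qed.

Lemma ckdD k a b : ckd k U a -> ckd k U b -> ckd k U (fun x => a x + b x).
Proof.
elim: k a b => [|k IH] a b ca cb.
  by split => // x Ux; apply: continuous_at_add; [exact: ckd_continuous ca Ux | exact: ckd_continuous cb Ux].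
apply: ckdS_intro => [x Ux|i].
  by apply: continuous_at_add; [exact: ckd_continuous ca Ux | exact: ckd_continuous cb Ux].
exists (fun x => pd i a x + pd i b x); split.
  by move=> x Ux; apply: is_derive_add; [exact: ckdS_derive ca Ux | exact: ckdS_derive cb Ux].
by apply: IH; apply: ckdS_pd.
Qed.

Lemma ckdM k a b : ckd k U a -> ckd k U b -> ckd k U (fun x => a x * b x).
Proof.
elim: k a b => [|k IH] a b ca cb.
  by split => // x Ux; apply: continuous_at_mul; [exact: ckd_continuous ca Ux | exact: ckd_continuous cb Ux].
apply: ckdS_intro => [x Ux|i].
  by apply: continuous_at_mul; [exact: ckd_continuous ca Ux | exact: ckd_continuous cb Ux].
exists (fun x => a x * pd i b x + b x * pd i a x); split.
  by move=> x Ux; apply: is_derive_mul; [exact: ckdS_derive ca Ux | exact: ckdS_derive cb Ux].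
by apply: ckdD; apply: IH; (try exact: ckdW); exact: ckdS_pd.
Qed.

Lemma ckdN k a : ckd k U a -> ckd k U (fun x => - a x).
Proof.
move=> ca; apply: (@ckd_ext _ (fun x => -1 * a x)) => [x _|]; first by rewrite mulN1r.
by apply: ckdM => //; exact: ckd_cst.
Qed.

Lemma ckd_sum k I (r : seq I) (P : pred I) (F : I -> 'rV[R]_n -> R) :
  (forall i, ckd k U (F i)) -> ckd k U (fun x => \sum_(i <- r | P i) F i x).
Proof.
move=> cF; elim: r => [|i r IH].
  by apply: (@ckd_ext _ (fun=> 0)) => [x _|]; [rewrite big_nil | exact: ckd_cst].
have [Pi|Pi] := boolP (P i); last first.
  by apply: ckd_ext IH => x _; rewrite big_cons (negbTE Pi).
apply: (@ckd_ext _ (fun x => F i x + \sum_(i <- r | P i) F i x)) => [x _|].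
  by rewrite big_cons Pi.
exact: ckdD.
Qed.

Lemma ckd_prod k I (r : seq I) (P : pred I) (F : I -> 'rV[R]_n -> R) :
  (forall i, ckd k U (F i)) -> ckd k U (fun x => \prod_(i <- r | P i) F i x).
Proof.
move=> cF; elim: r => [|i r IH].
  by apply: (@ckd_ext _ (fun=> 1)) => [x _|]; [rewrite big_nil | exact: ckd_cst].
have [Pi|Pi] := boolP (P i); last first.
  by apply: ckd_ext IH => x _; rewrite big_cons (negbTE Pi).
apply: (@ckd_ext _ (fun x => F i x * \prod_(i <- r | P i) F i x)) => [x _|].
  by rewrite big_cons Pi.
exact: ckdM.
Qed.

Lemma ckdV k a : (forall x, U x -> a x != 0) -> ckd k U a -> ckd k U (fun x => (a x)^-1).
Proof.
move=> a0; elim: k a a0 => [|k IH] a a0 ca.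
  by split => // x Ux; apply: continuous_at_inv; [exact: a0 | exact: ckd_continuous ca Ux].
apply: ckdS_intro => [x Ux|i].
  by apply: continuous_at_inv; [exact: a0 | exact: ckd_continuous ca Ux].
exists (fun x => - ((a x)^-1 * (a x)^-1) * pd i a x); split.
  by move=> x Ux; rewrite -expr2; apply: is_derive_inv; [exact: a0 | exact: ckdS_derive ca Ux].
apply: ckdM; last exact: ckdS_pd.
by apply: ckdN; apply: ckdM; apply: IH => //; exact: ckdW.
Qed.

Lemma ckd_det k d (M : 'rV[R]_n -> 'M[R]_d) :
  (forall i j, ckd k U (fun x => M x i j)) -> ckd k U (fun x => \det (M x)).
Proof.
move=> cM; apply: ckd_sum => s; apply: ckdM; first exact: ckd_cst.
by apply: ckd_prod => i; exact: cM.
Qed.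

End Fixed.

Lemma ckd_comp n d k (U : set 'rV[R]_n) (W : set 'rV[R]_d)
    (f : 'rV[R]_n -> 'rV[R]_d) (b : 'rV[R]_d -> R) :
  open U -> open W -> (forall x, U x -> W (f x)) ->
  (forall j, ckd k U (fun x => f x 0 j)) -> ckd k W b -> ckd k U (fun x => b (f x)).
Proof.
move=> oU oW fW.
have fcont k' x : (forall j, ckd k' U (fun x => f x 0 j)) -> U x -> {for x, continuous f}.
  by move=> cf Ux; apply: continuous_at_rV => j; exact: ckd_continuous (cf j) Ux.
have C k' b' : (forall j, ckd k' U (fun x => f x 0 j)) -> ckd k' W b' ->
    forall x, U x -> {for x, continuous (fun x => b' (f x))}.
  move=> cf cb x Ux; apply: (@continuous_comp _ _ _ f b'); first exact: fcont cf Ux.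
  exact: ckd_continuous cb (fW _ Ux).
elim: k b => [|k IH] b cf cb; first by split => //; exact: C cf cb.
apply: ckdS_intro => // [|i]; first exact: C cf cb.
exists (fun x => \sum_j pd i (fun x => f x 0 j) x * pd j b (f x)); split.
  move=> x Ux; apply: chain_rule => [j|]; first exact: ckdS_derive (cf j) Ux.
  exact: (ckd_is_diff oW cb (fW _ Ux)).
apply: ckd_sum => // j; apply: ckdM => //; first exact: ckdS_pd (cf j).
by apply: IH => [j'|]; [exact/ckdW/cf | exact: ckdS_pd cb].
Qed.

(** Smoothness by coinduction. No formula for higher derivatives is needed: local
    inverses, parameter integrals and Seeley extensions are smooth because, in
    each case, the functions of the same shape are closed under differentiation. *)
Lemma smf_coind n (U : set 'rV[R]_n) (C : ('rV[R]_n -> R) -> Prop) : open U ->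
  (forall a, C a -> forall x, U x -> {for x, continuous a}) ->
  (forall a, C a -> forall i, exists2 g, C g &
     forall x, U x -> is_derive x (delta_mx 0 i) a (g x)) ->
  forall a, C a -> smf U a.
Proof.
move=> oU cC dC a Ca k; elim: k a Ca => [|k IH] a Ca; first by split => //; exact: cC.
apply: ckdS_intro => // [|i]; first exact: cC.
by have [g Cg dg] := dC a Ca i; exists g; split => //; exact: IH.
Qed.

End Smoothness.

(** * Smooth maps and their Jacobians *)

Section SmoothFunctions.
Variables (R : realType) (n : nat) (U : set 'rV[R]_n).
Hypothesis oU : open U.
Implicit Types (a b : 'rV[R]_n -> R) (x : 'rV[R]_n).

Lemma smf_continuous a x : smf U a -> U x -> {for x, continuous a}.
Proof. by move=> ca Ux; exact: (ckd_continuous (ca 0%N)). Qed.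

Lemma smf_ext a b : (forall x, U x -> a x = b x) -> smf U a -> smf U b.
Proof. by move=> ab ca k; exact: ckd_ext (ca k). Qed.

Lemma smf_derive a i x : smf U a -> U x -> is_derive x (delta_mx 0 i) a (pd i a x).
Proof. by move=> ca Ux; exact: (ckdS_derive i (ca 1%N)). Qed.

Lemma smf_pd a i : smf U a -> smf U (pd i a).
Proof. by move=> ca k; exact: ckdS_pd (ca k.+1). Qed.

Lemma smf_is_diff a x : smf U a -> U x -> is_diff x a (grad_form a x).
Proof. by move=> /(_ 1%N) ca; exact: (ckd_is_diff oU ca). Qed.

Lemma smf_cst (c : R) : smf U (fun=> c).
Proof. by move=> k; exact: ckd_cst. Qed.

Lemma smf_coord i : smf U (fun x => x 0 i).
Proof. by move=> k; exact: ckd_coord. Qed.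

Lemma smf_add a b : smf U a -> smf U b -> smf U (fun x => a x + b x).
Proof. by move=> ca cb k; exact: ckdD. Qed.

Lemma smf_mul a b : smf U a -> smf U b -> smf U (fun x => a x * b x).
Proof. by move=> ca cb k; exact: ckdM. Qed.

Lemma smf_opp a : smf U a -> smf U (fun x => - a x).
Proof. by move=> ca k; exact: ckdN. Qed.

Lemma smf_sum I (r : seq I) (P : pred I) (F : I -> 'rV[R]_n -> R) :
  (forall i, smf U (F i)) -> smf U (fun x => \sum_(i <- r | P i) F i x).
Proof. by move=> cF k; apply: ckd_sum => // i; exact: cF. Qed.

Lemma smf_inv a : (forall x, U x -> a x != 0) -> smf U a -> smf U (fun x => (a x)^-1).
Proof. by move=> a0 ca k; exact: ckdV. Qed.

Lemma smf_det d (M : 'rV[R]_n -> 'M[R]_d) :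
  (forall i j, smf U (fun x => M x i j)) -> smf U (fun x => \det (M x)).
Proof. by move=> cM k; apply: ckd_det => // i j; exact: cM. Qed.

Lemma smf_invmx d (M : 'rV[R]_n -> 'M[R]_d) : (forall x, U x -> M x \in unitmx) ->
  (forall i j, smf U (fun x => M x i j)) ->
  forall i j, smf U (fun x => invmx (M x) i j).
Proof.
move=> uM cM i j.
apply: (@smf_ext (fun x => (\det (M x))^-1 * cofactor (M x) j i)) => [x Ux|].
  by rewrite /invmx uM // !mxE.
apply: smf_mul; first apply: smf_inv => [x Ux|].
- by have := uM x Ux; rewrite unitmxE unitfE.
- exact: smf_det.
rewrite /cofactor; apply: smf_mul; first exact: smf_cst.
apply: smf_det => i' j'; rewrite (_ : (fun x => _) = fun x => M x (lift j i') (lift i j')); first exact: cM.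
by apply/funext => x; rewrite !mxE.
Qed.

End SmoothFunctions.

Section SmoothMaps.
Variable R : realType.

Definition smv n d (U : set 'rV[R]_n) (f : 'rV[R]_n -> 'rV[R]_d) :=
  forall j, smf U (fun x => f x 0 j).

(** The transpose of the usual Jacobian matrix: differentials act on row
    vectors from the right. *)
Definition jac n d (f : 'rV[R]_n -> 'rV[R]_d) (x : 'rV[R]_n) : 'M[R]_(n, d) :=
  \matrix_(i, j) pd i (fun z => f z 0 j) x.

Lemma smv_continuous n d U (f : 'rV[R]_n -> 'rV[R]_d) x :
  smv U f -> U x -> {for x, continuous f}.
Proof. by move=> cf Ux; apply: continuous_at_rV => j; exact: (smf_continuous (cf j)). Qed.

Lemma smf_comp n d (U : set 'rV[R]_n) (W : set 'rV[R]_d)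
    (f : 'rV[R]_n -> 'rV[R]_d) (b : 'rV[R]_d -> R) :
  open U -> open W -> (forall x, U x -> W (f x)) ->
  smv U f -> smf W b -> smf U (fun x => b (f x)).
Proof. by move=> oU oW fW cf cb k; apply: (ckd_comp oU oW) => // j; exact: cf. Qed.

Lemma mulmx_bounded n d (A : 'M[R]_(n, d)) :
  exists2 k, 0 < k & forall v : 'rV[R]_n, `|v *m A| <= k * `|v|.
Proof.
exists (1 + \sum_i \sum_j `|A i j|) => [|v].
  by rewrite ltr_pwDl // sumr_ge0 // => i _; apply: sumr_ge0.
have k0 : 0 <= 1 + \sum_i \sum_j `|A i j|.
  by rewrite addr_ge0 // sumr_ge0 // => i _; apply: sumr_ge0.
apply: rV_norm_le => [|j]; first by rewrite mulr_ge0.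
rewrite mxE (le_trans (ler_norm_sum _ _ _)) // mulrDl mul1r.
apply: (@le_trans _ _ (\sum_i (\sum_j `|A i j|) * `|v|)); last first.
  by rewrite -mulr_suml lerDr.
apply: ler_sum => i _; rewrite normrM mulrC ler_pM ?rV_norm_coord //.
by rewrite (bigD1 j) //= lerDl sumr_ge0.
Qed.

Lemma mulmxr_continuous n d (A : 'M[R]_(n, d)) : continuous (mulmxr A : 'rV[R]_n -> 'rV[R]_d).
Proof.
move=> v; apply/continuous_at_dist => e e0; have [k k0 kP] := mulmx_bounded A.
apply/nbhs_distP; exists (e / k); first by rewrite divr_gt0.
move=> z; rewrite ltr_pdivlMr // mulrC => H; rewrite /= -mulmxBl.
by apply: le_lt_trans (kP _) _; rewrite distrC.
Qed.

Lemma is_diff_estimate (V W : normedModType R) (f df : V -> W) (x : V) : is_diff x f df ->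
  forall e, 0 < e -> \forall v \near 0, `|f (v + x) - f x - df v| <= e * `|v|.
Proof.
move=> [dfx <-] e e0; have /eqaddoP/(_ e e0) := diff_locally dfx.
by apply: filterS => v; rewrite !fctE /= opprD addrA.
Qed.

Lemma grad_form_jac n d (f : 'rV[R]_n -> 'rV[R]_d) x v j :
  grad_form (fun z => f z 0 j) x v = (v *m jac f x) 0 j.
Proof. by rewrite mxE; apply: eq_bigr => i _; rewrite mxE. Qed.

Lemma smv_estimate n d U (f : 'rV[R]_n -> 'rV[R]_d) x : open U -> smv U f -> U x ->
  forall e, 0 < e ->
  \forall v \near (0 : 'rV[R]_n), `|f (v + x) - f x - v *m jac f x| <= e * `|v|.
Proof.
move=> oU cf Ux e e0.
have : \forall v \near (0 : 'rV[R]_n), forall j,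
    `|f (v + x) 0 j - f x 0 j - grad_form (fun z => f z 0 j) x v| <= e * `|v|.
  by apply: near_forall => j; apply: (is_diff_estimate (smf_is_diff oU (cf j) Ux)).
apply: filterS => v H; apply: rV_norm_le => [|j]; first by rewrite mulr_ge0 // ltW.
by have := H j; rewrite grad_form_jac !mxE.
Qed.

(** The partial derivatives are integrated along a broken line joining the two
    points; it may leave the ball of radius [r / 3] that contains them, but not
    the ball of radius [r]. *)
Lemma small_pd_lipschitz n d (G : 'rV[R]_n -> 'rV[R]_d) (a : 'rV[R]_n) (r e : R) :
  0 <= e ->
  (forall z i j, `|z - a| < r -> derivable (fun z => G z 0 j) z (delta_mx 0 i)) ->
  (forall z i j, `|z - a| < r -> `|pd i (fun z => G z 0 j) z| <= e) ->
  forall x y, `|x - a| < r / 3 -> `|y - a| < r / 3 ->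
  `|G x - G y| <= 3 * n%:R * e * `|x - y|.
Proof.
move=> e0 dG sG x y xr yr.
have inr z : `|z - y| < 2 * (r / 3) -> `|z - a| < r.
  move=> zy; rewrite -(subrKA y); apply: le_lt_trans (ler_normD _ _) _.
  by have := ltrD zy yr; lra.
have xy : `|x - y| < 2 * (r / 3).
  rewrite -(subrKA a); apply: le_lt_trans (ler_normD _ _) _.
  by rewrite (distrC a); have := ltrD xr yr; lra.
have ya : `|y - a| < r by apply: inr; rewrite subrr normr0; apply: le_lt_trans xy.
apply: rV_norm_le => [|j]; first by rewrite !mulr_ge0.
rewrite !mxE; pose g z := G z 0 j; rewrite -!/(g _).
have H : `|g (x - y + y) - g y - grad_form g y (x - y)| <= n%:R * (2 * e * `|x - y|).
  apply: (@coord_path_estimate _ _ g y (2 * (r / 3)) (2 * e)) => //.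
  - by rewrite mulr_ge0.
  - by move=> z i /inr; exact: dG.
  - move=> z i /inr za; apply: le_trans (ler_normB _ _) _.
    by have := lerD (sG z i j za) (sG y i j ya); rewrite -/g; lra.
rewrite subrK in H.
have H2 : `|grad_form g y (x - y)| <= n%:R * (e * `|x - y|).
  apply: le_trans (ler_norm_sum _ _ _) _.
  rewrite (_ : n%:R * _ = \sum_(i < n) e * `|x - y|); last first.
    by rewrite sumr_const card_ord mulr_natl.
  apply: ler_sum => i _; rewrite normrM mulrC ler_pM ?rV_norm_coord //.
  exact: sG.
have -> : g x - g y = (g x - g y - grad_form g y (x - y)) + grad_form g y (x - y).
  by rewrite subrK.
apply: le_trans (ler_normD _ _) _; apply: le_trans (lerD H H2) _.
by lra.
Qed.

End SmoothMaps.

(** * Inverse function theorem *)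

Section InverseFunction.
Variables (R : realType) (n : nat) (U : set 'rV[R]_n) (f : 'rV[R]_n -> 'rV[R]_n).
Hypotheses (oU : open U) (sf : smv U f).

(** Newton's map for the frozen differential [J] contracts near [a], because its
    own differential vanishes at [a]. *)
Lemma newton_lipschitz a (J := jac f a) : U a -> J \in unitmx ->
  exists2 r, 0 < r & forall x y, `|x - a| < r -> `|y - a| < r ->
   [/\ U x, U y & `|(x - f x *m invmx J) - (y - f y *m invmx J)| <= 2^-1 * `|x - y|].
Proof.
move=> Ua uJ; pose G x := x - f x *m invmx J.
have GE j x : G x 0 j = x 0 j - \sum_i f x 0 i * invmx J i j by rewrite !mxE.
have sG : smv U G.
  move=> j; apply: (@smf_ext _ _ _ oU (fun x => x 0 j + - \sum_i f x 0 i * invmx J i j)) => [x _|].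
    by rewrite GE.
  apply: smf_add => //; first exact: smf_coord.
  apply: smf_opp => //; apply: smf_sum => // i; apply: smf_mul => //; exact: smf_cst.
have dG0 i j : pd i (fun z => G z 0 j) a = 0.
  have -> : (fun z => G z 0 j) = fun z => z 0 j + - \sum_k f z 0 k * invmx J k j.
    by apply/funext => z; rewrite GE.
  have H : is_derive a (delta_mx 0 i) (fun z => z 0 j + - \sum_k f z 0 k * invmx J k j)
      ((delta_mx 0 i : 'rV[R]_n) 0 j + - (\sum_k pd i (fun z => f z 0 k) a * invmx J k j)).
    apply: is_derive_add; first exact: is_derive_coord.
    apply: is_derive_opp.
    apply: is_derive_bigsum => k.
    have := is_derive_mul (smf_derive i (sf k) Ua) (is_derive_cst (invmx J k j) a (delta_mx 0 i)).
    by rewrite mulr0 add0r mulrC.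
  rewrite /pd; have [_ ->] := H.
  rewrite (_ : \sum_k _ = (J *m invmx J) i j); last first.
    by rewrite mxE; apply: eq_bigr => k _; rewrite !mxE.
  by rewrite mulmxV // !mxE eqxx /= eq_sym subrr.
(* chosen so that the Lipschitz constant 3 n e is at most 1/2 *)
pose e := (6 * n.+1%:R)^-1 : R.
have e0 : 0 < e by rewrite invr_gt0 mulr_gt0.
have [r r0 rP] : exists2 r, 0 < r & forall z, `|z - a| < r ->
   U z /\ forall i j, `|pd i (fun z => G z 0 j) z| <= e.
  apply/nbhs_distP.
  have H1 : \forall z \near a, U z by exact: open_nbhs_nbhs.
  have H2 : \forall z \near a, forall i j, `|pd i (fun z => G z 0 j) z| <= e.
    apply: near_forall => i; apply: near_forall => j.
    have /continuous_at_dist/(_ e e0) := smf_continuous (smf_pd i (sG j)) Ua.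
    by apply: filterS => z; rewrite dG0 sub0r normrN => /ltW.
  by apply: filterS2 H1 H2.
exists (r / 3); first by rewrite divr_gt0.
move=> x y xr yr.
have r3 : r / 3 < r by rewrite ltr_pdivrMr // ltr_pMr // ltr1n.
split; [exact: (rP x (lt_trans xr r3)).1 | exact: (rP y (lt_trans yr r3)).1|].
have L := @small_pd_lipschitz _ n n G a r e (ltW e0).
apply: le_trans (L _ _ x y xr yr) _.
- by move=> z i j /rP[Uz _]; case: (smf_derive i (sG j) Uz).
- by move=> z i j /rP[_]; exact.
apply: ler_wpM2r => //; rewrite /e invfM mulrA.
rewrite (_ : 3 * n%:R * 6^-1 / n.+1%:R = 2^-1 * (n%:R / n.+1%:R)); last by field.
rewrite -[leRHS]mulr1; apply: ler_wpM2l; first by rewrite invr_ge0.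
by rewrite ler_pdivrMr ?ltr0n // mul1r ler_nat.
Qed.

End InverseFunction.

Section InverseFunctionGerm.
Variables (R : realType) (n : nat).

Lemma minimum_on_box (F : 'rV[R]_n -> R) (a : 'rV[R]_n) (r : R) : 0 <= r ->
  (forall x, `|x - a| <= r -> {for x, continuous F}) ->
  exists2 c, `|c - a| <= r & forall x, `|x - a| <= r -> F c <= F x.
Proof.
move=> r0 cF.
pose A : set 'rV[R]_n := [set v | forall i, [set` `[a 0 i - r, a 0 i + r]] (v ord0 i)].
have AP x : A x <-> `|x - a| <= r.
  split=> [Ax|xr i].
    apply: rV_norm_le => // i; have := Ax i; rewrite /= in_itv /= => /andP[? ?].
    by rewrite !mxE ler_norml; apply/andP; split; lra.
  have := le_trans (rV_norm_coord (x - a) i) xr.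
  by rewrite !mxE ler_norml /= in_itv /= => /andP[? ?]; apply/andP; split; lra.
have cA : compact A.
  by apply: (@rV_compact _ _ (fun i => [set` `[a 0 i - r, a 0 i + r]])) => i; exact: segment_compact.
have A0 : A !=set0 by exists a; apply/AP; rewrite subrr normr0.
have [|c cA' cmin] := @EVT_min_rV R n F A A0 cA.
  by apply: continuous_in_subspaceT => x; rewrite inE => /AP; exact: cF.
exists c; first by apply/AP; rewrite inE in cA'.
by move=> x /AP Ax; apply: cmin; rewrite inE.
Qed.

(** To solve [f x = y], minimize the norm of [(f x - y) *m A] over a closed box: a
    Newton step from a minimizer would halve this value, so the minimum is 0.
    The inverse [g] is Lipschitz, hence differentiable, and it is smooth by
    coinduction on the functions [b \o g] with [b] smooth. *)
Theorem local_inverse (U : set 'rV[R]_n) (f : 'rV[R]_n -> 'rV[R]_n) a :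
  open U -> smv U f -> U a -> jac f a \in unitmx ->
  exists (N : set 'rV[R]_n) (g : 'rV[R]_n -> 'rV[R]_n),
  [/\ open N, N (f a), smv N g, (forall y, N y -> f (g y) = y) &
      \forall x \near a, g (f x) = x].
Proof.
move=> oU sf Ua uJ; pose A := invmx (jac f a).
have [r0' r0'0 lipP] := newton_lipschitz oU sf Ua uJ.
have smdet : smf U (fun x => \det (jac f x)).
  apply: smf_det => // i j.
  rewrite (_ : (fun x => _) = pd i (fun z => f z 0 j)); first exact: smf_pd.
  by apply/funext => z; rewrite mxE.
have [r1 r10 r1P] : exists2 r, 0 < r & forall z, `|z - a| < r -> jac f z \in unitmx.
  apply/nbhs_distP.
  have d0 : 0 < `|\det (jac f a)| by move: uJ; rewrite normr_gt0 unitmxE unitfE.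
  have /continuous_at_dist/(_ _ d0) := smf_continuous smdet Ua.
  apply: filterS => z; rewrite unitmxE unitfE => H.
  by apply: contraTneq H => ->; rewrite subr0 ltxx.
pose r := Num.min r0' r1; have r_gt0 : 0 < r by rewrite lt_min r0'0.
have {r1P}uP z : `|z - a| < r -> jac f z \in unitmx.
  by move=> zr; apply: r1P; apply: lt_le_trans zr _; rewrite ge_min lexx orbT.
have {}lipP x y : `|x - a| < r -> `|y - a| < r ->
   [/\ U x, U y & `|(x - f x *m A) - (y - f y *m A)| <= 2^-1 * `|x - y|].
  by move=> xr yr; apply: lipP; [apply: lt_le_trans xr _|apply: lt_le_trans yr _];
    rewrite ge_min lexx.
have Ur x : `|x - a| < r -> U x by move=> xr; case: (lipP x x xr xr).
have expand x y : `|x - a| < r -> `|y - a| < r -> `|x - y| <= 2 * `|(f x - f y) *m A|.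
  move=> xr yr; have [_ _ L] := lipP x y xr yr.
  have E : x - y = ((x - f x *m A) - (y - f y *m A)) + (f x - f y) *m A.
    rewrite mulmxBl; move: (f x *m A) (f y *m A) => u v.
    by apply/rowP => i; rewrite !mxE; ring.
  have := ler_normD ((x - f x *m A) - (y - f y *m A)) ((f x - f y) *m A).
  by rewrite -E; lra.
have uA : A \in unitmx by rewrite unitmx_inv.
have inj0 (v : 'rV[R]_n) : v *m A = 0 -> v = 0 by move=> /(canRL (mulmxK uA)); rewrite mul0mx.
have [k k0 kP] := mulmx_bounded A.
pose N : set 'rV[R]_n := [set y | `|(y - f a) *m A| < r / 4].
have oN : open N.
  rewrite openE => y /= Ny; rewrite /interior; apply/nbhs_distP.
  exists ((r / 4 - `|(y - f a) *m A|) / k); first by rewrite divr_gt0 // subr_gt0.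
  move=> z; rewrite ltr_pdivlMr // mulrC => zy; rewrite /N /=.
  rewrite -(subrKA y) mulmxDl; apply: le_lt_trans (ler_normD _ _) _.
  by have := kP (z - y); lra.
have Nfa : N (f a) by rewrite /N /= subrr mul0mx normr0 divr_gt0.
have aa : `|a - a| < r by rewrite subrr normr0.
have solve y : N y -> exists x, `|x - a| <= r / 2 /\ f x = y.
  move=> Ny; pose F x := `|(f x - y) *m A|.
  have r20 : 0 <= r / 2 by rewrite ltW // divr_gt0.
  have half x : `|x - a| <= r / 2 -> `|x - a| < r.
    by move=> xr; apply: le_lt_trans xr _; rewrite ltr_pdivrMr // ltr_pMr // ltr1n.
  have [|c cr cmin] := @minimum_on_box F a (r / 2) r20.
    move=> x /half xr; have /continuous_at_dist cf := smv_continuous sf (Ur x xr).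
    apply/continuous_at_dist => e e0.
    apply: filterS (cf (e / k) (divr_gt0 e0 k0)) => z.
    rewrite ltr_pdivlMr // mulrC => zx.
    apply: le_lt_trans (ler_dist_dist _ _) _; rewrite -mulmxBl opprB addrA subrK.
    by apply: le_lt_trans (kP _) _.
  exists c; split => //.
  pose c' := c - (f c - y) *m A.
  have c'a : `|c' - a| <= r / 2.
    have [_ _ L] := lipP c a (half _ cr) aa.
    have -> : c' - a = ((c - f c *m A) - (a - f a *m A)) + (y - f a) *m A.
      rewrite /c' !mulmxBl; move: (f c *m A) (f a *m A) (y *m A) => u v w.
      by apply/rowP => i; rewrite !mxE; ring.
    apply: le_trans (ler_normD _ _) _; move: Ny; rewrite /N /=; lra.
  have Fc' : F c' <= 2^-1 * F c.
    have [_ _ L] := lipP c c' (half _ cr) (half _ c'a).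
    have E1 : (f c' - y) *m A = (c - f c *m A) - (c' - f c' *m A).
      rewrite {2}/c' !mulmxBl; move: (f c *m A) (f c' *m A) (y *m A) => u v w.
      by apply/rowP => i; rewrite !mxE; ring.
    rewrite /F E1; apply: le_trans L _; rewrite /c' opprB addrCA subrr addr0.
    by [].
  have Fc0 : F c = 0.
    have := cmin _ c'a; have : 0 <= F c by exact: normr_ge0.
    by lra.
  by apply/eqP; rewrite -subr_eq0; apply/eqP/inj0/normr0_eq0.
have /choice[g gP] : forall y, exists x, N y -> `|x - a| <= r / 2 /\ f x = y.
  move=> y; have [Ny|nNy] := pselect (N y); last by exists 0.
  by have [x xP] := solve y Ny; exists x.
have gr y : N y -> `|g y - a| < r.
  move=> /gP[xr _]; apply: le_lt_trans xr _; rewrite ltr_pdivrMr // ltr_pMr // ltr1n //.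
have fg y : N y -> f (g y) = y by move=> /gP[].
have gL y z : N y -> N z -> `|g y - g z| <= 2 * k * `|y - z|.
  move=> Ny Nz; apply: le_trans (expand _ _ (gr _ Ny) (gr _ Nz)) _.
  by rewrite !fg // -mulrA ler_wpM2l.
have gcont y : N y -> {for y, continuous g}.
  move=> Ny; apply/continuous_at_dist => e e0.
  have nN : \forall z \near y, N z by exact: open_nbhs_nbhs.
  have nd : \forall z \near y, `|z - y| < e / (2 * k).
    by apply/nbhs_distP; exists (e / (2 * k)) => //; rewrite divr_gt0 // mulr_gt0.
  apply: filterS2 nN nd => z Nz; rewrite ltr_pdivlMr ?mulr_gt0 // => zy.
  by apply: le_lt_trans (gL _ _ Ny Nz) _; rewrite distrC mulrC.
have gdiff y : N y -> is_diff y g (mulmxr (invmx (jac f (g y)))).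
  move=> Ny; set B := invmx _.
  apply: is_diff_of_estimate; first exact: mulmxr_continuous.
  move=> e e0; have [kB kB0 kBP] := mulmx_bounded B.
  have ub : B \in unitmx by rewrite unitmx_inv uP // gr.
  pose e' := e / (kB * (2 * k)).
  have e'0 : 0 < e' by rewrite divr_gt0 // !mulr_gt0.
  have /nbhs_distP[s s0 sP] := smv_estimate oU sf (Ur _ (gr _ Ny)) e'0.
  have nN : \forall v \near (0 : 'rV[R]_n), N (v + y).
    have /nbhs_distP[t t0 tP] : \forall z \near y, N z by exact: open_nbhs_nbhs.
    by apply/nbhs_distP; exists t => // v vt; apply: tP; rewrite addrK -[v]subr0.
  have nd : \forall v \near (0 : 'rV[R]_n), `|v| < s / (2 * k).
    apply/nbhs_distP; exists (s / (2 * k)); first by rewrite divr_gt0 // mulr_gt0.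
    by move=> v; rewrite subr0.
  apply: filterS2 nN nd => v Nv; rewrite ltr_pdivlMr ?mulr_gt0 // => vs.
  have Lw : `|g (v + y) - g y| <= 2 * k * `|v|.
    by apply: le_trans (gL _ _ Nv Ny) _; rewrite addrK.
  have ws : `|g (v + y) - g y - 0| < s by rewrite subr0 (le_lt_trans Lw) // mulrC.
  have := sP _ ws; rewrite subrK !fg // addrK.
  set w := _ - g y in Lw ws * => est.
  have -> : w - mulmxr B v = - ((v - w *m jac f (g y)) *m B).
    by rewrite /= mulmxBl mulmxK ?uP ?gr // opprB.
  rewrite normrN; apply: le_trans (kBP _) _.
  apply: (@le_trans _ _ (kB * (e' * (2 * k * `|v|)))).
    rewrite ler_pM2l //; apply: le_trans est _; rewrite ler_pM2l //.
  rewrite /e' le_eqVlt; apply/orP; left; apply/eqP; field.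
  by rewrite !gt_eqF.
pose U' : set 'rV[R]_n := [set x | `|x - a| < r].
have oU' : open U' by exact: open_dist_lt.
have sU' c : smf U c -> smf U' c.
  move=> sc; apply: (@smf_comp _ _ _ U' U id c) => //.
  by move=> j; exact: smf_coord.
have sg : forall c, (exists2 b, smf U' b & c = b \o g) -> smf N c.
  apply: smf_coind => // [_ [b sb ->] y Ny|_ [b sb ->] i].
    apply: (@continuous_comp _ _ _ g b); first exact: gcont.
    exact: (smf_continuous sb (gr _ Ny)).
  pose b' x := \sum_j invmx (jac f x) i j * pd j b x.
  exists (b' \o g).
    exists b' => //; apply: smf_sum => // j; apply: smf_mul => //; last exact: smf_pd.
    apply: smf_invmx => // i' j'; apply: sU'.
    rewrite (_ : (fun x => _) = pd i' (fun z => f z 0 j')); first exact: smf_pd.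
    by apply/funext => z; rewrite mxE.
  move=> y Ny; apply: chain_rule; last exact: (smf_is_diff oU' sb (gr _ Ny)).
  move=> j; have dg := gdiff y Ny.
  have [dd dE] := dg; have dv : derivable g y (delta_mx 0 i) by exact: diff_derivable.
  split; first by move/derivable_mxP: dv; exact.
  have := @deriveE _ _ _ g y (delta_mx 0 i) dd; rewrite dE /= -rowE derive_mx //.
  by move=> /matrixP/(_ 0 j); rewrite !mxE.
exists N, g; split => //.
  by move=> j; apply: sg; exists (fun x => x 0 j) => //; exact: smf_coord.
have nN : \forall x \near a, N (f x).
  have /continuous_at_dist/(_ (r / 4 / k)) := smv_continuous sf Ua.
  move=> /(_ (divr_gt0 (divr_gt0 r_gt0 _) k0)) H.
  have /H : (0 : R) < 4 by [].
  apply: filterS => z; rewrite ltr_pdivlMr // mulrC distrC => zx.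
  by rewrite /N /=; apply: le_lt_trans (kP _) _.
have nr : \forall x \near a, `|x - a| < r by apply/nbhs_distP; exists r.
apply: filterS2 nN nr => x Nx xr.
have := expand _ _ (gr _ Nx) xr; rewrite fg // subrr mul0mx normr0 mulr0.
by rewrite normr_le0 subr_eq0 => /eqP.
Qed.

End InverseFunctionGerm.

(** * Germs of smooth functions *)

Section Germs.
Variable R : realType.

(** Smoothness near a point; the neighbourhood is hidden so that germs can be
    combined and composed freely. *)
Definition sma n (x : 'rV[R]_n) (a : 'rV[R]_n -> R) :=
  exists U, [/\ open U, U x & smf U a].

Definition smva n d (x : 'rV[R]_n) (f : 'rV[R]_n -> 'rV[R]_d) :=
  forall j, sma x (fun z => f z 0 j).

Lemma smf_sub n (U V : set 'rV[R]_n) a : V `<=` U -> smf U a -> smf V a.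
Proof.
move=> VU sa k; elim: k a {sa}(sa k) => [|k IH] a [ca da].
  by split=> // x /VU; exact: ca.
split=> [x /VU|i]; first exact: ca.
by have [dai /IH] := da i; split => // x /VU; exact: dai.
Qed.

Lemma nbhs_open_sub (T : topologicalType) (x : T) (P : set T) : nbhs x P ->
  exists U, [/\ open U, U x & U `<=` P].
Proof.
by move=> nP; exists P^°; split; [exact: open_interior | | exact: interior_subset].
Qed.

Lemma open_near (T : topologicalType) (x : T) (U : set T) : open U -> U x -> \forall z \near x, U z.
Proof. by move=> oU Ux; exact: open_nbhs_nbhs. Qed.

Lemma open_setI_preim (S T : topologicalType) (A : set S) (B : set T) (h : S -> T) :
  open A -> open B -> (forall x, A x -> {for x, continuous h}) -> open (A `&` h @^-1` B).
Proof.
move=> oA oB ch; rewrite openE => x [Ax Bhx]; apply: filterI; first exact: open_near.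
by apply: (ch x Ax); exact: open_near.
Qed.

Lemma sma_family n (x : 'rV[R]_n) (I : finType) (F : I -> 'rV[R]_n -> R) :
  (forall i, sma x (F i)) -> exists U, [/\ open U, U x & forall i, smf U (F i)].
Proof.
move=> sF; have [W WP] := choice sF.
have [U [oU Ux UW]] : exists U, [/\ open U, U x & U `<=` [set z | forall i, W i z]].
  apply: nbhs_open_sub; apply: (@near_forall _ _ W) => i.
  by have [? ? _] := WP i; exact: open_near.
exists U; split => // i; have [_ _ s] := WP i.
by apply: smf_sub s => z /UW; exact.
Qed.

Lemma smvaP n d (x : 'rV[R]_n) (f : 'rV[R]_n -> 'rV[R]_d) :
  smva x f <-> exists U, [/\ open U, U x & smv U f].
Proof.
split=> [|[U [oU Ux sf]] j]; last by exists U.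
exact: sma_family.
Qed.

Section ScalarGerms.
Variables (n : nat) (x : 'rV[R]_n).
Implicit Types a b : 'rV[R]_n -> R.

Lemma sma2 a b : sma x a -> sma x b -> exists U, [/\ open U, U x, smf U a & smf U b].
Proof.
move=> [U [oU Ux sa]] [V [oV Vx sb]]; exists (U `&` V); split => //.
- exact: openI.
- by apply: smf_sub sa; exact: subIsetl.
- by apply: smf_sub sb; exact: subIsetr.
Qed.

Lemma sma_near a : sma x a -> \forall z \near x, sma z a.
Proof. by move=> [U [oU Ux sa]]; apply: filterS (open_near oU Ux) => z Uz; exists U. Qed.

Lemma sma_ext a b : (\near x, a x = b x) -> sma x a -> sma x b.
Proof.
move=> ab [U [oU Ux sa]].
have [V [oV Vx VP]] := nbhs_open_sub (filterI (open_near oU Ux) ab).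
exists V; split => //; apply: (@smf_ext _ _ _ oV a) => [z /VP[]//|].
by apply: smf_sub sa => z /VP[].
Qed.

Lemma sma_continuous a : sma x a -> {for x, continuous a}.
Proof. by move=> [U [oU Ux sa]]; exact: smf_continuous sa Ux. Qed.

Lemma sma_is_diff a : sma x a -> is_diff x a (grad_form a x).
Proof. by move=> [U [oU Ux sa]]; exact: (smf_is_diff oU sa Ux). Qed.

Lemma sma_derive a i : sma x a -> is_derive x (delta_mx 0 i) a (pd i a x).
Proof. by move=> [U [oU Ux sa]]; exact: smf_derive sa Ux. Qed.

Lemma sma_derive_dir a v : sma x a -> is_derive x v a (grad_form a x v).
Proof.
move=> /sma_is_diff[da dE]; split; first exact: diff_derivable.
by rewrite deriveE // dE.
Qed.

Lemma sma_pd a i : sma x a -> sma x (pd i a).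
Proof. by move=> [U [oU Ux sa]]; exists U; split => //; exact: smf_pd. Qed.

Lemma sma_cst (c : R) : sma x (fun=> c).
Proof. by exists setT; split => //; [exact: openT | exact: smf_cst openT c]. Qed.

Lemma sma_coord i : sma x (fun z => z 0 i).
Proof. by exists setT; split => //; [exact: openT | exact: smf_coord openT i]. Qed.

Lemma sma_add a b : sma x a -> sma x b -> sma x (fun z => a z + b z).
Proof. by move=> sa /(sma2 sa)[U [? ? ? ?]]; exists U; split => //; exact: smf_add. Qed.

Lemma sma_mul a b : sma x a -> sma x b -> sma x (fun z => a z * b z).
Proof. by move=> sa /(sma2 sa)[U [? ? ? ?]]; exists U; split => //; exact: smf_mul. Qed.

Lemma sma_opp a : sma x a -> sma x (fun z => - a z).
Proof. by move=> [U [? ? ?]]; exists U; split => //; exact: smf_opp. Qed.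

Lemma sma_sub a b : sma x a -> sma x b -> sma x (fun z => a z - b z).
Proof. by move=> sa /sma_opp; exact: sma_add. Qed.

Lemma sma_sum I (r : seq I) (P : pred I) (F : I -> 'rV[R]_n -> R) :
  (forall i, sma x (F i)) -> sma x (fun z => \sum_(i <- r | P i) F i z).
Proof.
move=> sF; elim: r => [|i r IH].
  by apply: sma_ext (sma_cst 0); apply: near_all => z; rewrite big_nil.
case Pi : (P i); last by apply: sma_ext IH; apply: near_all => z; rewrite big_cons Pi.
by apply: sma_ext (sma_add (sF i) IH); apply: near_all => z; rewrite big_cons Pi.
Qed.

Lemma sma_det d (M : 'rV[R]_n -> 'M[R]_d) :
  (forall i j, sma x (fun z => M z i j)) -> sma x (fun z => \det (M z)).
Proof.
move=> sM; have [U [oU Ux sU]] := sma_family (fun ij : 'I_d * 'I_d => sM ij.1 ij.2).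
by exists U; split => //; apply: smf_det => // i j; exact: (sU (i, j)).
Qed.

Lemma open_set_near a (P : R -> bool) U : open U -> U x -> smf U a ->
  (\forall z \near x, P (a z)) ->
  exists V, [/\ open V, V x, V `<=` U & forall z, V z -> P (a z)].
Proof.
move=> oU Ux sa nP; have [V [oV Vx VP]] := nbhs_open_sub (filterI (open_near oU Ux) nP).
by exists V; split => // z /VP[].
Qed.

Lemma sma_inv a : a x != 0 -> sma x a -> sma x (fun z => (a z)^-1).
Proof.
move=> a0 [U [oU Ux sa]].
have nP : \forall z \near x, a z != 0.
  have d0 : 0 < `|a x| by rewrite normr_gt0.
  have /continuous_at_dist/(_ _ d0) := smf_continuous sa Ux.
  by apply: filterS => z; apply: contraTneq => ->; rewrite subr0 ltxx.
have [V [oV Vx VU VP]] := open_set_near (P := fun t => t != 0) oU Ux sa nP.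
by exists V; split => //; apply: smf_inv => //; exact: smf_sub sa.
Qed.

Lemma sma_gt0_near a : 0 < a x -> sma x a -> \forall z \near x, 0 < a z.
Proof.
move=> a0 /sma_continuous /continuous_at_dist/(_ _ a0).
by apply: filterS => z /ltr_normlP[_]; lra.
Qed.

Lemma smf_sqrt a (U : set 'rV[R]_n) : open U -> (forall z, U z -> 0 < a z) -> smf U a ->
  smf U (fun z => Num.sqrt (a z)).
Proof.
move=> oU a0 sa.
have ca z : U z -> {for z, continuous (fun z => Num.sqrt (a z))}.
  move=> Uz; apply: (@continuous_comp _ _ _ a (fun t => Num.sqrt t)).
    exact: (smf_continuous sa).
  exact: sqrt_continuous.
have s0 z : U z -> 2 * Num.sqrt (a z) != 0.
  by move=> Uz; rewrite mulf_neq0 // gt_eqF // sqrtr_gt0 a0.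
elim=> [|k IH]; first by split.
apply: ckdS_intro => // i.
exists (fun z => (2 * Num.sqrt (a z))^-1 * pd i a z); split.
  move=> z Uz; apply: is_derive_scalar_comp; last exact: smf_derive sa Uz.
  exact/is_derive1_sqrt/a0.
apply: (ckdM oU); last by apply: ckdS_pd; exact: sa.
by apply: ckdV => //; apply: ckdM => //; exact: ckd_cst.
Qed.

Lemma sma_sqrt a : 0 < a x -> sma x a -> sma x (fun z => Num.sqrt (a z)).
Proof.
move=> a0 sa; have [U [oU Ux sU]] := sa.
have [V [oV Vx VU VP]] := open_set_near (P := fun t => 0 < t) oU Ux sU (sma_gt0_near a0 sa).
by exists V; split => //; apply: smf_sqrt => //; exact: smf_sub sU.
Qed.

Lemma smva_continuous d (f : 'rV[R]_n -> 'rV[R]_d) : smva x f -> {for x, continuous f}.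
Proof. by move=> sf; apply: continuous_at_rV => j; exact/sma_continuous/sf. Qed.

Lemma smva_near d (f : 'rV[R]_n -> 'rV[R]_d) : smva x f -> \forall z \near x, smva z f.
Proof. by move=> sf; apply: near_forall => j; exact/sma_near/sf. Qed.

Lemma smva_preim d (f : 'rV[R]_n -> 'rV[R]_d) P : smva x f ->
  (\forall y \near f x, P y) -> \forall z \near x, P (f z).
Proof. by move=> /smva_continuous cf nP; exact: cf. Qed.

Lemma sma_comp d (f : 'rV[R]_n -> 'rV[R]_d) (b : 'rV[R]_d -> R) : smva x f -> sma (f x) b ->
  sma x (fun z => b (f z)).
Proof.
move=> sf [W [oW Wx sb]].
have /smvaP[U [oU Ux sU]] := sf.
have nW : \forall z \near x, W (f z) by apply: smva_preim => //; exact: open_near.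
have [V [oV Vx VP]] := nbhs_open_sub (filterI (open_near oU Ux) nW).
exists V; split => //; apply: (smf_comp oV oW) sb => [z /VP[]//|j].
by apply: smf_sub (sU j) => z /VP[].
Qed.

Lemma smva_comp d e (f : 'rV[R]_n -> 'rV[R]_d) (g : 'rV[R]_d -> 'rV[R]_e) :
  smva x f -> smva (f x) g -> smva x (fun z => g (f z)).
Proof. by move=> sf sg j; exact: (sma_comp sf (sg j)). Qed.

Lemma smva_derive_dir d (f : 'rV[R]_n -> 'rV[R]_d) v j : smva x f ->
  is_derive x v (fun z => f z 0 j) ((v *m jac f x) 0 j).
Proof. by move=> sf; rewrite -grad_form_jac; exact/sma_derive_dir/sf. Qed.

Lemma pd_near a b i : (\near x, a x = b x) -> pd i a x = pd i b x.
Proof. exact: near_eq_derive. Qed.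

Lemma jac_near d (f g : 'rV[R]_n -> 'rV[R]_d) : (\near x, f x = g x) -> jac f x = jac g x.
Proof.
move=> fg; apply/matrixP => i j; rewrite !mxE; apply: pd_near.
by apply: filterS fg => z ->.
Qed.

Lemma jac_id : jac (@id 'rV[R]_n) x = 1%:M.
Proof.
apply/matrixP => i j; rewrite mxE.
transitivity ((delta_mx 0 i : 'rV[R]_n) 0 j).
  by case: (is_derive_coord x (delta_mx 0 i) j).
by rewrite !mxE eqxx eq_sym.
Qed.

End ScalarGerms.

Lemma pd_comp n d x (f : 'rV[R]_n -> 'rV[R]_d) (b : 'rV[R]_d -> R) i : smva x f -> sma (f x) b ->
  pd i (fun z => b (f z)) x = \sum_j jac f x i j * pd j b (f x).
Proof.
move=> sf sb.
have [_] := chain_rule (fun j => sma_derive i (sf j)) (sma_is_diff sb).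
by rewrite /pd => ->; apply: eq_bigr => j _; rewrite mxE.
Qed.

Lemma jac_comp n d e x (f : 'rV[R]_n -> 'rV[R]_d) (g : 'rV[R]_d -> 'rV[R]_e) :
  smva x f -> smva (f x) g -> jac (fun z => g (f z)) x = jac f x *m jac g (f x).
Proof.
move=> sf sg; apply/matrixP => i j; rewrite !mxE (pd_comp i sf (sg j)).
by apply: eq_bigr => k _; rewrite !mxE.
Qed.

Theorem inverse_germ n (f : 'rV[R]_n -> 'rV[R]_n) a : smva a f -> jac f a \in unitmx ->
  exists g, [/\ smva (f a) g, g (f a) = a, \forall x \near a, g (f x) = x &
                \forall y \near f a, f (g y) = y].
Proof.
move=> /smvaP[U [oU Ua sf]] uJ.
have [N [g [oN Nfa sg fg gf]]] := local_inverse oU sf Ua uJ.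
exists g; split => //.
- by apply/smvaP; exists N.
- exact: (nbhs_singleton gf).
- by apply: filterS (open_near oN Nfa); exact: fg.
Qed.

(** Restricts mutually inverse germs to open sets that they exchange exactly, the
    form in which coordinate systems are given. *)
Lemma inverse_germs_open n d (f : 'rV[R]_n -> 'rV[R]_d) g a :
  smva a f -> smva (f a) g -> g (f a) = a ->
  (\forall x \near a, g (f x) = x) -> (\forall y \near f a, f (g y) = y) ->
  exists U W, [/\ open U, U a, open W & [/\ smv U f, smv W g, f @` U = W &
    forall u, U u -> g (f u) = u]].
Proof.
move=> sf sg ga gf fg.
have /smvaP[U0 [oU0 U0a sU0]] := sf; have /smvaP[W0 [oW0 W0a sW0]] := sg.
have [U1 [oU1 U1a U1P]] := nbhs_open_sub (filterI (open_near oU0 U0a) gf).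
have [W1 [oW1 W1a W1P]] := nbhs_open_sub (filterI (open_near oW0 W0a) fg).
pose U := U1 `&` f @^-1` W1; pose W := W1 `&` g @^-1` U1.
exists U, W; split; first by apply: open_setI_preim => // x /U1P[? _]; exact: (smv_continuous sU0).
- by split.
- by apply: open_setI_preim => // x /W1P[? _]; exact: (smv_continuous sW0).
split.
- by move=> j; apply: smf_sub (sU0 j) => x [/U1P[]].
- by move=> j; apply: smf_sub (sW0 j) => x [/W1P[]].
- apply/seteqP; split=> [_ [x [Ux Wfx] <-]|y [Wy Ugy]].
    by split => //; rewrite /preimage /= (U1P _ Ux).2.
  by exists (g y); [split => //; rewrite /preimage /= (W1P _ Wy).2 | exact: (W1P _ Wy).2].
- by move=> u [/U1P[]].
Qed.

(** * Comparison with iterated directional derivatives of vector-valued maps *)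

Lemma smv_differentiable n d (U : set 'rV[R]_n) (f : 'rV[R]_n -> 'rV[R]_d) x :
  open U -> smv U f -> U x -> is_diff x f (mulmxr (jac f x)).
Proof.
by move=> oU sf Ux; apply: is_diff_of_estimate; [exact: mulmxr_continuous | exact: (smv_estimate oU sf Ux)].
Qed.

Lemma derive_coord n d (f : 'rV[R]_n -> 'rV[R]_d) x v j : derivable f x v ->
  ('D_v f x) 0 j = 'D_v (fun z => f z 0 j) x.
Proof. by move=> df; rewrite derive_mx // mxE. Qed.

(** Iterated directional derivatives of a vector-valued map are computed entry by
    entry; the existence of a differential follows from continuous partials. *)
Lemma smooth_onP n d (U : set 'rV[R]_n) (f : 'rV[R]_n -> 'rV[R]_d) : open U ->
  smooth_on U f <-> smv U f.
Proof.
move=> oU; split=> [sf j k|sf k].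
  elim: k f {sf}(sf k) => [|k IH] f /=.
    move=> cf; split => // x Ux; apply: (@continuous_comp _ _ _ f (fun y : 'rV[R]_d => y 0 j)).
      exact: cf.
    exact: coord_continuous.
  move=> [df cf].
  have dfi i x : U x -> derivable f x (delta_mx 0 i) by move=> /df; exact: diff_derivable.
  apply: ckdS_intro => // [x Ux|i].
    apply: (@continuous_comp _ _ _ f (fun y : 'rV[R]_d => y 0 j)).
      exact/differentiable_continuous/df.
    exact: coord_continuous.
  exists (fun x => ('D_(delta_mx 0 i) f x) 0 j); split; last exact: IH.
  move=> x Ux; rewrite derive_coord; last exact: dfi.
  by apply: derivableP; have /derivable_mxP := dfi i x Ux; exact.
elim: k f sf => [|k IH] f sf /=; first by move=> x Ux; exact: (smv_continuous sf).
have df x : U x -> differentiable f x by move=> Ux; case: (smv_differentiable oU sf Ux).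
split => // i; apply: IH => j.
apply: (smf_ext oU _ (smf_pd i (sf j))) => x Ux.
by rewrite derive_coord //; exact/diff_derivable/df.
Qed.

Lemma smva_smooth n d (f : 'rV[R]_n -> 'rV[R]_d) x : smooth f -> smva x f.
Proof.
move=> /(smooth_onP _ openT) sf; apply/smvaP.
by exists setT; split => //; exact: openT.
Qed.

Lemma smva_smooth_on n d (U : set 'rV[R]_n) (f : 'rV[R]_n -> 'rV[R]_d) x :
  open U -> smooth_on U f -> U x -> smva x f.
Proof. by move=> oU /(smooth_onP _ oU) sf Ux; apply/smvaP; exists U. Qed.

Lemma Jac_jac n d (f : 'rV[R]_n -> 'rV[R]_d) x : smva x f -> Jac f x = (jac f x)^T.
Proof.
move=> /smvaP[U [oU Ux sf]]; congr trmx.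
have [_ dE] := smv_differentiable oU sf Ux.
by apply/row_matrixP => i; rewrite !rowE /jacobian mul_rV_lin1 dE.
Qed.

End Germs.

(** * One-variable calculus and series *)

Section OneVariable.
Variable R : realType.

Lemma is_derive0_cvg (F : R -> R) (d : R) :
  h^-1 *: (F (h + 0) - F 0) @[h --> 0^'] --> d -> is_derive (0 : R) (1 : R) F d.
Proof.
have E : (fun h => h^-1 *: (F (h + 0) - F 0)) = (fun h : R => h^-1 *: ((F \o shift 0) (h *: 1) - F 0)).
  by apply/funext => h /=; rewrite [h *: 1]mulr1.
by move=> H; split; rewrite /derivable /derive -E; [apply/cvg_ex; exists d | apply/cvg_lim].
Qed.

Lemma is_derive_quadratic (F : R -> R) (d C r : R) : 0 < r ->
  (forall h, `|h| < r -> `|F h - F 0 - h * d| <= C * h ^+ 2) ->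
  is_derive (0 : R) (1 : R) F d.
Proof.
move=> r0 est.
apply: is_derive0_cvg; apply/cvgrPdist_le => e e0.
near=> h.
have h0 : h != 0 by near: h; exact: nbhs_dnbhs_neq.
have hr : `|h| < r by near: h; exact: dnbhs0_lt.
have hC : `|h| < e / (`|C| + 1) by near: h; apply: dnbhs0_lt; rewrite divr_gt0 // ltr_wpDl.
rewrite addr0 -(@ler_pM2l _ `|h|) ?normr_gt0 // -normrM mulrBr.
rewrite (_ : h * (h^-1 *: _) = F h - F 0); last by rewrite mulrA mulfV // mul1r.
rewrite distrC; apply: le_trans (est h hr) _.
move: hC; rewrite ltr_pdivlMr ?ltr_wpDl // => hC.
rewrite -(real_normK (num_real h)) expr2 mulrCA ler_pM2l ?normr_gt0 //.
apply: le_trans (ltW hC); rewrite mulrC ler_wpM2l //.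
by have := ler_norm C; lra.
Unshelve. all: by end_near. Qed.

(** By the mean value theorem, the difference quotients of [F] at 0 are values of
    [G] at points close to 0. *)
Lemma is_derive_extend (F G : R -> R) (r : R) : 0 < r ->
  (forall t, `|t| < r -> {for t, continuous F}) -> {for 0, continuous G} ->
  (forall t, `|t| < r -> t != 0 -> is_derive t (1 : R) F (G t)) ->
  is_derive (0 : R) (1 : R) F (G 0).
Proof.
move=> r0 cF cG dF.
have mv h : `|h| < r -> h != 0 -> exists2 c, `|c| <= `|h| & F h - F 0 = G c * h.
  move=> hr h0.
  have [||c cI E] := @mvt_between R F G 0 h.
  - move=> t /andP[t1 t2]; apply: dF.
      by apply: le_lt_trans hr; apply: between0; rewrite !ltW.
    by move: t1 t2; case: (ltP 0 h) => _; [move=> t0 _; rewrite gt_eqF | move=> _ t0; rewrite lt_eqF].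
  - by move=> t /between0 th; apply: cF; exact: le_lt_trans hr.
  by exists c; [exact: between0 | rewrite E subr0].
apply: is_derive0_cvg; apply/cvgrPdist_le => e e0.
have /continuous_at_dist/(_ e e0)/nbhs_distP[s s0 sP] := cG.
near=> h.
have h0 : h != 0 by near: h; exact: nbhs_dnbhs_neq.
have hr : `|h| < r by near: h; exact: dnbhs0_lt.
have hs : `|h| < s by near: h; exact: dnbhs0_lt.
have [c ch E] := mv h hr h0.
rewrite addr0 E [_ *: _]mulrC mulfK // ltW // sP // subr0.
exact: le_lt_trans ch hs.
Unshelve. all: by end_near. Qed.

Definition intg (u : R -> R) : R := Rintegral (@lebesgue_measure R) `[0, 1] u.

Definition cont01 (u : R -> R) := forall t, 0 <= t <= 1 -> {for t, continuous u}.

Lemma cont01_within u : cont01 u -> {within `[0, 1], continuous u}.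
Proof.
move=> cu; apply: continuous_in_subspaceT => t; rewrite inE /= in_itv /=; exact: cu.
Qed.

Lemma cont01_integrable u : cont01 u ->
  (@lebesgue_measure R).-integrable `[0, 1] (EFin \o u).
Proof.
by move=> /cont01_within cu; apply: continuous_compact_integrable => //; exact: segment_compact.
Qed.

Lemma cont01_sub u v : cont01 u -> cont01 v -> cont01 (fun t => u t - v t).
Proof. by move=> cu cv t t01; apply: cvgB; [exact: cu | exact: cv]. Qed.

Lemma cont01_scale c u : cont01 u -> cont01 (fun t => c * u t).
Proof. by move=> cu t t01; apply: cvgM; [exact: cvg_cst | exact: cu]. Qed.

Lemma intg_sub u v : cont01 u -> cont01 v ->
  intg (fun t => u t - v t) = intg u - intg v.
Proof. by move=> cu cv; apply: RintegralB => //; exact: cont01_integrable. Qed.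

Lemma intg_scale c u : cont01 u -> intg (fun t => c * u t) = c * intg u.
Proof. by move=> cu; apply: RintegralZl => //; exact: cont01_integrable. Qed.

Lemma intg_cst c : intg (fun=> c) = c.
Proof.
have E : @lebesgue_measure R `[0, 1]%classic = 1%:E.
  by rewrite lebesgue_measure_itv /= lte_fin ltr01 oppr0 adde0.
rewrite /intg Rintegral_cst // (_ : fine _ = 1) ?mulr1 //.
exact: (congr1 fine E).
Qed.

Lemma intg_ext u v : (forall t, 0 <= t <= 1 -> u t = v t) -> intg u = intg v.
Proof. by move=> uv; apply: eq_Rintegral => t; rewrite inE /= in_itv /=; exact: uv. Qed.

Lemma intg_bound c u : cont01 u -> (forall t, 0 <= t <= 1 -> `|u t| <= c) -> `|intg u| <= c.
Proof.
move=> cu uc; rewrite /intg; apply: le_trans (le_normr_Rintegral _ (cont01_integrable cu)) _ => //.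
rewrite -[leRHS](intg_cst c); apply: le_Rintegral => //.
- by apply: (@cont01_integrable (fun t => `|u t|)) => t t01; apply: cvg_norm; exact: cu.
- by apply: (@cont01_integrable (fun=> c)) => t _; exact: cst_continuous.
Qed.

Lemma intg_FTC (F f : R -> R) : (forall t : R, 0 <= t <= 1 -> is_derive t (1 : R) F (f t)) -> cont01 f ->
  intg f = F 1 - F 0.
Proof.
move=> dF cf; rewrite /intg /Rintegral (@continuous_FTC2 _ f F) //.
- exact: cont01_within.
- have cF t : 0 <= t <= 1 -> {for t, continuous F}.
    by move=> /dF[dFt _]; apply/differentiable_continuous/derivable1_diffP.
  split.
  + by move=> t; rewrite in_itv /= => /andP[t0 t1]; case: (dF t) => //; rewrite !ltW.
  + by apply: cvg_at_right_filter; apply: cF; rewrite lexx ler01.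
  + by apply: cvg_at_left_filter; apply: cF; rewrite lexx ler01.
- move=> t; rewrite in_itv /= => /andP[t0 t1]; rewrite derive1E.
  by case: (dF t) => //; rewrite !ltW.
Qed.

Definition summable (M : nat -> R) := (forall k, 0 <= M k) /\ cvgn (series M).

Definition ssum (u : nat -> R) : R := limn (series u).

Lemma summable_cvg M (u : nat -> R) : summable M -> (forall k, `|u k| <= M k) -> cvgn (series u).
Proof.
move=> [M0 cM] uM; apply: normed_cvg; apply: series_le_cvg cM => // k.
exact: normr_ge0.
Qed.

Lemma ssum_bound M (u : nat -> R) : summable M -> (forall k, `|u k| <= M k) -> `|ssum u| <= ssum M.
Proof.
move=> sM uM; have [M0 cM] := sM.
have cu : cvgn [normed series u].
  by apply: series_le_cvg cM => // k; exact: normr_ge0.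
apply: le_trans (lim_series_norm cu) _.
by apply: lim_series_le.
Qed.

Lemma series_scale (c : R) (u : nat -> R) :
  series (fun k => c * u k) = (fun n => c * series u n).
Proof. by apply/funext => n; rewrite /series /= mulr_sumr. Qed.

Lemma summableZ M c : 0 <= c -> summable M -> summable (fun k => c * M k).
Proof.
move=> c0 [M0 cM]; split=> [k|]; first by rewrite mulr_ge0.
by rewrite series_scale; apply: is_cvgM => //; exact: is_cvg_cst.
Qed.

Lemma ssumB (u v : nat -> R) : cvgn (series u) -> cvgn (series v) ->
  ssum (fun k => u k - v k) = ssum u - ssum v.
Proof. by move=> cu cv; rewrite /ssum -(lim_seriesB cu cv). Qed.

Lemma ssumZ c (u : nat -> R) : cvgn (series u) -> ssum (fun k => c * u k) = c * ssum u.
Proof.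
move=> cu; rewrite /ssum series_scale; apply/cvg_lim => //.
by apply: cvgM; [exact: cvg_cst | exact: cu].
Qed.

(** The same [N] serves every series dominated by [M], as uniform convergence
    requires. *)
Lemma series_tail M (e : R) : summable M -> 0 < e ->
  exists N, forall v : nat -> R, (forall k, `|v k| <= M k) -> `|ssum v - series v N| <= e.
Proof.
move=> sM e0; have [M0 cM] := sM.
have /cvgrPdist_le/(_ e e0)[N _ NP] : series M n @[n --> \oo] --> ssum M by exact: cM.
exists N => v vM.
have := NP N (leqnn N) => /= H.
pose w k := if (k < N)%N then 0 else v k.
pose W k := if (k < N)%N then 0 else M k.
have sW : summable W.
  split; first by move=> k; rewrite /W; case: ifP.
  by apply: series_le_cvg cM => // k; rewrite /W; case: ifP.
have wW k : `|w k| <= W k by rewrite /w /W; case: ifP => // _; rewrite normr0.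
have split_sum (z : nat -> R) : cvgn (series z) ->
    ssum (fun k => if (k < N)%N then 0 else z k) = ssum z - series z N.
  move=> cz; apply/cvg_lim => //.
  have : series z n - series z N @[n --> \oo] --> ssum z - series z N.
    by apply: cvgB; [exact: cz | exact: cvg_cst].
  apply: cvg_trans; apply: near_eq_cvg; exists N => // n /= Nn.
  rewrite sub_series_geq // /series /= [in RHS](@big_cat_nat _ _ _ N) //=.
  rewrite [X in _ = X + _]big1_seq ?add0r => [|k /andP[_]]; last by rewrite mem_index_iota /= => ->.
  by apply: eq_big_nat => k /andP[Nk _]; rewrite ltnNge Nk.
rewrite -split_sum; last exact: summable_cvg vM.
apply: le_trans (ssum_bound sW wW) _.
by rewrite /W split_sum //; apply: le_trans (ler_norm _) H.
Qed.

Lemma ssum_continuous (T : topologicalType) (f : nat -> T -> R) (M : nat -> R) (x : T) :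
  summable M -> (\forall z \near x, forall k, `|f k z| <= M k) ->
  (forall k, {for x, continuous (f k)}) ->
  {for x, continuous (fun z => ssum (f ^~ z))}.
Proof.
move=> sM nM cf; apply/continuous_at_dist => e e0.
have e4 : 0 < e / 4 by rewrite divr_gt0.
have [N NP] := series_tail sM e4.
have cS : {for x, continuous (fun z => series (f ^~ z) N)}.
  rewrite /series /=; elim: N {NP} => [|N IH].
    apply: (@continuous_at_ext _ _ (fun=> 0)); last exact: cst_continuous.
    by apply: nearW => z; rewrite big_nil.
  apply: (@continuous_at_ext _ _ (fun z => \sum_(0 <= k < N) f k z + f N z)).
    by apply: nearW => z; rewrite big_nat_recr.
  by apply: continuous_at_add => //; exact: cf.
have /continuous_at_dist/(_ _ e4) cS' := cS.
have xM := nbhs_singleton nM.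
apply: filterS2 nM cS' => z zM.
have := NP _ xM; have := NP _ zM.
set s1 := ssum _; set s2 := ssum _; set t1 := series _ _; set t2 := series _ _.
move=> /ler_normlP[? ?] /ler_normlP[? ?] /ltr_normlP[? ?].
by apply/ltr_normlP; split; lra.
Qed.

End OneVariable.

(** * Seeley's reflection coefficients *)

Section SeeleyCoefficients.
Variable R : realType.

(** The Taylor coefficients of the entire function prod_(i >= 0) (1 - x / 2^i),
    which vanishes at every power of 2. *)
Fixpoint zcoef (k : nat) : R :=
  if k is k'.+1 then - (2 * zcoef k' / (2 ^+ k - 1)) else 1.

Lemma pow2_gt1 k : 1 < 2 ^+ k.+1 :> R.
Proof. by rewrite exprn_egt1 // ltr1n. Qed.

Lemma zcoefS k : zcoef k.+1 * (2 ^+ k.+1 - 1) = - (2 * zcoef k).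
Proof. by rewrite /= mulNr divfK // gt_eqF // subr_gt0 pow2_gt1. Qed.

(** The coefficients decrease roughly like 2^(- k^2 / 2), faster than any geometric
    progression grows. *)
Lemma zcoef_summable j : summable (fun k => `|zcoef k| * 2 ^+ (k * j)).
Proof.
split=> [k|]; first by rewrite mulr_ge0 // exprn_ge0.
pose u k : R := `|zcoef k| * 2 ^+ (k * j.+1).
have u0 k : 0 <= u k by rewrite mulr_ge0 // exprn_ge0.
have uS k : (j.+2 <= k)%N -> u k.+1 <= u k.
  move=> jk; rewrite /u /= normrN !normrM normfV.
  have d0 : 0 < 2 ^+ k.+1 - 1 :> R by rewrite subr_gt0 pow2_gt1.
  rewrite (gtr0_norm d0) (_ : `|2| = 2 :> R); last by rewrite ger0_norm.
  rewrite mulSn exprD -!mulrA mulrCA ler_wpM2l //.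
  rewrite !mulrA -[leRHS]mul1r ler_wpM2r ?exprn_ge0 //.
  rewrite mulrAC ler_pdivrMr // mul1r -exprS.
  have : 2 ^+ j.+2 <= 2 ^+ k :> R by rewrite ler_weXn2l // ler1n.
  have : 1 <= 2 ^+ k :> R by rewrite exprn_ege1 // ler1n.
  by rewrite (exprS _ k); lra.
pose C := \sum_(0 <= i < j.+3) u i.
have uC k : u k <= C.
  elim: k => [|k IH].
    by rewrite /C big_nat_recl //= lerDl sumr_ge0.
  have [jk|kj] := leqP j.+2 k; first exact: le_trans (uS k jk) IH.
  rewrite /C (big_cat_nat (n := k.+2)) //= (big_nat_recr k.+1) //= addrAC.
  by rewrite lerDr addr_ge0 // sumr_ge0.
have cg : cvgn (series (geometric C (2^-1))).
  by apply: is_cvg_geometric_series; rewrite ger0_norm ?invr_ge0 // invf_lt1 // ltr1n.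
apply: series_le_cvg cg => k; first by rewrite mulr_ge0 // exprn_ge0.
- by apply: mulr_ge0; [exact: le_trans (u0 0%N) (uC 0%N) | rewrite exprn_ge0 // invr_ge0].
- rewrite /geometric /= exprVn ler_pdivlMr ?exprn_gt0 // -mulrA -exprD.
  by have := uC k; rewrite /u mulnS addnC.
Qed.

Lemma zcoef_cvg (x : R) j : 0 <= x -> x <= 2 ^+ j -> cvgn (series (fun k => zcoef k * x ^+ k)).
Proof.
move=> x0 xj; apply: summable_cvg (zcoef_summable j) _ => k.
rewrite normrM (ger0_norm (exprn_ge0 _ x0)) ler_wpM2l // mulnC exprM.
by rewrite lerXn2r // nnegrE exprn_ge0.
Qed.

(** The functional equation P(2 y) = (1 - 2 y) P(y), read off the coefficients. *)
Lemma zcoef_double (y : R) j : 0 <= y -> y <= 2 ^+ j ->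
  ssum (fun k => zcoef k * (2 * y) ^+ k) = (1 - 2 * y) * ssum (fun k => zcoef k * y ^+ k).
Proof.
move=> y0 yj; have c := zcoef_cvg y0 yj.
have E n : series (fun k => zcoef k * (2 * y) ^+ k) n.+1 =
    series (fun k => zcoef k * y ^+ k) n.+1 - 2 * y * series (fun k => zcoef k * y ^+ k) n.
  rewrite /series /= !big_nat_recl //= !expr0 -addrA; congr (_ + _).
  rewrite mulr_sumr -sumrB; apply: eq_bigr => k _.
  have H := zcoefS k; rewrite -/(zcoef k.+1) exprMn (exprS y).
  rewrite (_ : zcoef k.+1 * (2 ^+ k.+1 * (y * y ^+ k)) =
     (zcoef k.+1 * (2 ^+ k.+1 - 1)) * (y * y ^+ k) + zcoef k.+1 * (y * y ^+ k)); last by ring.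
  by rewrite H; ring.
apply/cvg_lim => //; rewrite -cvg_shiftS.
rewrite (_ : (fun n => _) = fun n => series (fun k => zcoef k * y ^+ k) n.+1
    - 2 * y * series (fun k => zcoef k * y ^+ k) n); last exact/funext/E.
rewrite mulrBl mul1r; apply: cvgB; last by apply: cvgM; [exact: cvg_cst | exact: c].
by rewrite cvg_shiftS; exact: c.
Qed.

Lemma zcoef_moment j : ssum (fun k => zcoef k * (2 ^+ j) ^+ k) = 0.
Proof.
elim: j => [|j IH].
  have -> : 2 ^+ 0 = 2 * 2^-1 :> R by rewrite expr0 mulfV.
  rewrite (@zcoef_double _ 0) ?invr_ge0 //; last by rewrite invf_le1 // ler1n.
  by rewrite mulfV // subrr mul0r.
by rewrite exprS (@zcoef_double _ j) ?exprn_ge0 // IH mulr0.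
Qed.

(** Dividing by [2 ^+ k + 1] makes two consecutive moments add up to a moment of
    [zcoef], that is to 0: the moments alternate in sign. *)
Definition hcoef k : R := zcoef k / (2 ^+ k + 1).

Lemma hden_gt0 k : 0 < 2 ^+ k + 1 :> R.
Proof. by rewrite ltr_wpDl // exprn_ge0. Qed.

Lemma hcoef_le k : `|hcoef k| <= `|zcoef k|.
Proof.
rewrite /hcoef normrM normfV (gtr0_norm (hden_gt0 k)) ler_pdivrMr ?hden_gt0 //.
by rewrite ler_peMr // lerDr exprn_ge0.
Qed.

Lemma hcoef_summable j : summable (fun k => `|hcoef k| * 2 ^+ (k * j)).
Proof.
have [z0 cz] := zcoef_summable j.
split=> [k|]; first by rewrite mulr_ge0 // exprn_ge0.
apply: (series_le_cvg _ _ _ cz) => k; [by rewrite mulr_ge0 // exprn_ge0 | exact: z0 |].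
by rewrite ler_wpM2r ?exprn_ge0 // hcoef_le.
Qed.

Lemma hcoef_cvg j : cvgn (series (fun k => hcoef k * (2 ^+ j) ^+ k)).
Proof.
apply: summable_cvg (hcoef_summable j) _ => k.
by rewrite -exprM normrM (ger0_norm (exprn_ge0 _ _)) // mulnC.
Qed.

Lemma hcoef_moment j : ssum (fun k => hcoef k * (2 ^+ j) ^+ k) =
  (-1) ^+ j * ssum (fun k => hcoef k * (2 ^+ 0) ^+ k).
Proof.
elim: j => [|j IH]; first by rewrite !expr0 mul1r.
have H : ssum (fun k => hcoef k * (2 ^+ j.+1) ^+ k - - 1 * (hcoef k * (2 ^+ j) ^+ k)) = 0.
  rewrite -[RHS](zcoef_moment j); congr ssum; apply/funext => k.
  rewrite -[in RHS](divfK (lt0r_neq0 (hden_gt0 k)) (zcoef k)) -/(hcoef k).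
  by rewrite exprS exprMn; ring.
rewrite ssumB in H; first 1 last.
- exact: hcoef_cvg.
- rewrite series_scale; apply: is_cvgM; [exact: is_cvg_cst | exact: hcoef_cvg].
rewrite ssumZ in H; last exact: hcoef_cvg.
by move/subr0_eq: H => ->; rewrite IH exprS mulrA.
Qed.

(** The signs alternate; from the index 4 on, the terms are paired into nonnegative
    sums, so that the partial sum of order 4, which is 109 / 1890, is a lower bound. *)
Lemma hcoef_total_gt0 : 0 < ssum (fun k => hcoef k * (2 ^+ 0) ^+ k).
Proof.
rewrite (_ : (fun k => _) = hcoef); last first.
  by apply/funext => k; rewrite expr0 expr1n mulr1.
have c : cvgn (series hcoef).
  have := @hcoef_cvg 0; rewrite (_ : (fun k => _) = hcoef) //.
  by apply/funext => k; rewrite expr0 expr1n mulr1.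
have S4 : 0 < series hcoef 4%N.
  have -> : series hcoef 4%N = 109 / 1890.
    rewrite /series /= !big_nat_recr //= big_nil /hcoef /= !expr1 !expr0.
    have -> : 2 ^+ 2 = 4 :> R by ring.
    have -> : 2 ^+ 3 = 8 :> R by ring.
    by field.
  by apply: divr_gt0; rewrite ltr0n.
have pair k : 0 <= zcoef k -> (1 <= k)%N -> 0 <= hcoef k + hcoef k.+1.
  move=> z0 k1; rewrite /hcoef /=.
  set p := 2 ^+ k : R; have p2 : 2 <= p by rewrite /p -[leLHS]expr1 ler_weXn2l // ler1n.
  rewrite exprS -/p.
  rewrite (_ : _ + _ = zcoef k * ((p + 1)^-1 - 2 / ((2 * p - 1) * (2 * p + 1)))); last first.
    by field; apply/and3P; split; apply: lt0r_neq0; lra.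
  apply: mulr_ge0 => //; rewrite subr_ge0 ler_pdivrMr; last by apply: mulr_gt0; lra.
  by rewrite mulrC ler_pdivlMr; nra.
have z2 k : 0 <= zcoef k -> 0 <= zcoef k.+2.
  have d i : 0 <= (2 ^+ i.+1 - 1)^-1 :> R by rewrite invr_ge0 subr_ge0 ltW // pow2_gt1.
  by move=> z0; rewrite /= mulrN mulNr opprK !mulr_ge0 //; exact: d.
have H m : 0 <= zcoef (m.*2 + 4) /\ series hcoef 4%N <= series hcoef (m.*2 + 4)%N.
  elim: m => [|m [z0 IH]].
    by split; [apply: (z2 2%N); apply: (z2 0%N); exact: ler01 | exact: lexx].
  rewrite doubleS !addSn; move: (m.*2 + 4)%N (leq_addl m.*2 4) z0 IH => k k4 z0 IH.
  split; first exact: z2.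
  have -> : series hcoef k.+2 = series hcoef k + (hcoef k + hcoef k.+1).
    by rewrite 2!seriesSr addrA.
  rewrite (le_trans IH) // lerDl pair //.
  by apply: leq_trans k4.
apply: lt_le_trans S4 _; apply: limr_ge => //; exists 4%N => // n /= n4.
have -> : n = ((n - 4)./2.*2 + 4 + odd (n - 4))%N by have := odd_double_half (n - 4); lia.
have [z0 Hm] := H (n - 4)./2.
case: (odd _); last by rewrite addn0.
rewrite addn1 [leRHS]seriesSr (le_trans Hm) // lerDl.
by rewrite /hcoef mulr_ge0 // invr_ge0 ltW // hden_gt0.
Qed.

(** Weights reproducing at -1 every polynomial sampled at the powers of 2. *)
Definition seeley k : R := hcoef k / ssum (fun k => hcoef k * (2 ^+ 0) ^+ k).

Lemma seeley_summable j : summable (fun k => `|seeley k| * 2 ^+ (k * j)).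
Proof.
have H := @summableZ _ _ `|(ssum (fun k => hcoef k * (2 ^+ 0) ^+ k))^-1| (normr_ge0 _) (hcoef_summable j).
rewrite (_ : (fun k => _) = (fun k => `|(ssum (fun k => hcoef k * (2 ^+ 0) ^+ k))^-1|
   * (`|hcoef k| * 2 ^+ (k * j)))) //.
by apply/funext => k; rewrite /seeley normrM mulrA (mulrC `|hcoef k|).
Qed.

Lemma seeley_moment j : ssum (fun k => seeley k * (- 2 ^+ k) ^+ j) = 1.
Proof.
have H0 := hcoef_total_gt0; set L := ssum _ in H0.
have -> : (fun k => seeley k * (- 2 ^+ k) ^+ j) =
   fun k => (-1) ^+ j / L * (hcoef k * (2 ^+ j) ^+ k).
  apply/funext => k; rewrite /seeley -/L exprNn -!exprM (mulnC k).
  by ring.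
rewrite ssumZ; last exact: hcoef_cvg.
rewrite hcoef_moment -/L mulrACA mulVf ?gt_eqF // mulr1.
by rewrite -exprD addnn -mul2n exprM sqrrN !expr1n.
Qed.

End SeeleyCoefficients.

(** * Hadamard's lemma *)

Section BoundedPartials.
Variables (R : realType) (n : nat).
Implicit Types (a : 'rV[R]_n -> R) (x z : 'rV[R]_n).

Lemma pd_bounded_continuous a x (r M : R) : 0 < r ->
  (forall z i, `|z - x| < r -> derivable a z (delta_mx 0 i)) ->
  (forall z i, `|z - x| < r -> `|pd i a z| <= M) -> {for x, continuous a}.
Proof.
move=> r0 da Ma; apply/continuous_at_dist => e e0.
pose K := 3 * n%:R * `|M| + 1.
have K1 : 0 < K by rewrite ltr_wpDl // !mulr_ge0.
apply/nbhs_distP; exists (Num.min (r / 3) (e / K)); first by rewrite lt_min !divr_gt0.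
move=> z; rewrite lt_min => /andP[zr]; rewrite ltr_pdivlMr // => ze.
pose G y : 'rV[R]_1 := \row__ a y.
have GE : (fun y => G y 0 0) = a by apply/funext => y; rewrite mxE.
have := @small_pd_lipschitz R n 1 G x r `|M| (normr_ge0 _) _ _ x z _ zr.
rewrite subrr normr0 => H.
have {}H : `|G x - G z| <= 3 * n%:R * `|M| * `|x - z|.
  apply: H; last by rewrite divr_gt0.
  - by move=> y i j yr; rewrite ord1 GE; exact: da.
  - by move=> y i j yr; rewrite ord1 GE; apply: le_trans (Ma y i yr) (ler_norm _).
have := le_trans (rV_norm_coord (G x - G z) 0) H; rewrite !mxE => {}H.
apply: le_lt_trans H _; apply: le_lt_trans ze; rewrite distrC mulrC ler_wpM2l // /K.
by rewrite lerDl.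
Qed.

Lemma coord_taylor2 a (i : 'I_n) z (c M : R) :
  (forall t, `|t| <= `|c| -> derivable a (t *: delta_mx 0 i + z) (delta_mx 0 i)) ->
  (forall t, `|t| <= `|c| -> derivable (pd i a) (t *: delta_mx 0 i + z) (delta_mx 0 i)) ->
  (forall t, `|t| <= `|c| -> `|pd i (pd i a) (t *: delta_mx 0 i + z)| <= M) ->
  `|a (c *: delta_mx 0 i + z) - a z - c * pd i a z| <= M * c ^+ 2.
Proof.
move=> d1 d2 bM.
have [t tc E1] := coord_mvt d1.
have [|s st E2] := @coord_mvt _ _ (pd i a) i z t; first by move=> s st; apply: d2; exact: le_trans st tc.
rewrite E1 (_ : _ - _ = (pd i a (t *: delta_mx 0 i + z) - pd i a z) * c); last by rewrite /pd; ring.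
rewrite E2 !normrM -(real_normK (num_real c)) expr2 mulrA ler_wpM2r //.
apply: ler_pM => //; apply: bM; exact: le_trans st tc.
Qed.

Lemma bounded_on_box a x (r : R) : 0 <= r ->
  (forall z, `|z - x| <= r -> {for z, continuous a}) ->
  exists2 M, 0 <= M & forall z, `|z - x| <= r -> `|a z| <= M.
Proof.
move=> r0 ca; have [z zr|c cr cP] := @minimum_on_box R n (fun z => - `|a z|) x r r0.
  have /continuous_at_dist ca' := ca z zr.
  apply/continuous_at_dist => e e0; apply: filterS (ca' e e0) => w we.
  by rewrite opprK addrC; apply: le_lt_trans (ler_dist_dist _ _) _; rewrite distrC.
by exists `|a c| => // z /cP; rewrite lerN2.
Qed.

Definition cball (r : R) : set 'rV[R]_n := [set x | `|x| < r].

Lemma open_cball r : open (cball r).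
Proof.
rewrite (_ : cball r = [set x | `|x - 0| < r]); first exact: open_dist_lt.
by apply/seteqP; split=> x; rewrite /cball /= subr0.
Qed.

End BoundedPartials.

Section Hadamard.
Variables (R : realType) (n : nat) (i0 : 'I_n).
Implicit Types (x z : 'rV[R]_n) (a G K : 'rV[R]_n -> R) (s t : R).

(** Replacement of the coordinate [i0]: the projection to a hyperplane
    [x 0 i0 = s]. *)
Definition setc x s : 'rV[R]_n := \row_i if i == i0 then s else x 0 i.

Lemma setc_at x s : setc x s 0 i0 = s.
Proof. by rewrite mxE eqxx. Qed.

Lemma setc_id x : setc x (x 0 i0) = x.
Proof. by apply/rowP => i; rewrite mxE; case: eqP => [->|]. Qed.

Lemma setc_setc x s t : setc (setc x s) t = setc x t.
Proof. by apply/rowP => i; rewrite !mxE; case: eqP. Qed.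

Lemma setc_shift_at x h s : setc (h *: delta_mx 0 i0 + x) s = setc x s.
Proof.
apply/rowP => i; rewrite !mxE eqxx /=; case: eqVneq => //= _.
by rewrite mulr0 add0r.
Qed.

Lemma setc_shift i x h s : i != i0 ->
  setc (h *: delta_mx 0 i + x) s = h *: delta_mx 0 i + setc x s.
Proof.
move=> ii0; apply/rowP => j; rewrite !mxE; case: (eqVneq j i0) => [->|] //=.
by rewrite (eq_sym i0) (negbTE ii0) mulr0 add0r.
Qed.

Lemma shift_setc x h s : h *: delta_mx 0 i0 + setc x s = setc x (h + s).
Proof.
apply/rowP => i; rewrite !mxE eqxx /=; case: (eqVneq i i0) => _ /=.
  by rewrite mulr1.
by rewrite mulr0 add0r.
Qed.

Lemma setc_norm_lt x s r : 0 < r -> (forall i, i != i0 -> `|x 0 i| < r) -> `|s| < r ->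
  `|setc x s| < r.
Proof.
by move=> r0 xr sr; apply: rV_norm_lt => // i; rewrite mxE; case: eqVneq => // /xr.
Qed.

Lemma setc_scale_norm x t : 0 <= t <= 1 -> `|setc x (t * x 0 i0)| <= `|x|.
Proof.
move=> /andP[t0 t1]; apply: rV_norm_le => // i; rewrite mxE.
case: eqP => _; last exact: rV_norm_coord.
rewrite normrM ger0_norm //; apply: le_trans (rV_norm_coord x i0).
by rewrite ler_piMl.
Qed.

Lemma setc_continuous (T : topologicalType) (f : T -> 'rV[R]_n) (g : T -> R) (y : T) :
  {for y, continuous f} -> {for y, continuous g} ->
  {for y, continuous (fun w => setc (f w) (g w))}.
Proof.
move=> cf cg; apply: continuous_at_rV => j.
have [->|ji] := eqVneq j i0.
  by apply: continuous_at_ext cg; apply: near_all => w; rewrite setc_at.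
have cj : {for y, continuous (fun w => f w 0 j)}.
  apply: (@continuous_comp _ _ _ f (fun u : 'rV[R]_n => u 0 j)); first exact: cf.
  exact: coord_continuous.
by apply: continuous_at_ext cj; apply: near_all => w; rewrite mxE (negbTE ji).
Qed.

Variable r : R.
Let B := cball r : set 'rV[R]_n.

Let oB : open B. Proof. exact: open_cball. Qed.

(** An average of [K] along the segment that joins [x] to its projection on the
    hyperplane [x 0 i0 = 0]; the exponent [w] absorbs the factor [t] that appears
    when the average is differentiated in the direction [i0]. *)
Definition segment_mean (w : nat) K x := intg (fun t => t ^+ w * K (setc x (t * x 0 i0))).

Lemma setc_scale_B x t : B x -> 0 <= t <= 1 -> B (setc x (t * x 0 i0)).
Proof. by move=> Bx t01; apply: le_lt_trans (setc_scale_norm x t01) Bx. Qed.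

Lemma segment_cont01 w K x : (forall z, B z -> {for z, continuous K}) -> B x ->
  cont01 (fun t => t ^+ w * K (setc x (t * x 0 i0))).
Proof.
move=> cK Bx t t01; apply: continuous_at_mul; first exact: exprn_continuous.
apply: (@continuous_comp _ _ _ (fun t => setc x (t * x 0 i0)) K); last first.
  exact/cK/setc_scale_B.
apply: setc_continuous; first exact: cst_continuous.
by apply: continuous_at_mul; [exact: cvg_id | exact: cst_continuous].
Qed.

(** Differentiation under the integral sign: the remainders in Taylor's formula
    are quadratic, uniformly along the segment. *)
Lemma segment_mean_derive w K i x : smf B K -> B x ->
  is_derive x (delta_mx 0 i) (segment_mean w K)
    (segment_mean (if i == i0 then w.+1 else w) (pd i K) x).
Proof.
move=> sK Bx; apply: is_derive_line.
pose rho := (`|x| + r) / 2.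
have xr : `|x| < r by [].
have rr : rho < r by rewrite /rho; lra.
have rx : `|x| < rho by rewrite /rho; lra.
have sK1 : smf B (pd i K) by exact: smf_pd.
have sK2 : smf B (pd i (pd i K)) by exact: smf_pd.
have [||M M0 MP] := @bounded_on_box R n (pd i (pd i K)) 0 rho.
- by apply: le_trans (ltW rx).
- by move=> z; rewrite subr0 => zr; apply: (smf_continuous sK2); exact: le_lt_trans zr rr.
pose e : 'rV[R]_n := delta_mx 0 i.
have ne (h : R) : `|h *: e| <= `|h|.
  apply: rV_norm_le => // j; rewrite !mxE normrM ler_piMr //.
  by case: (_ && _); rewrite ?normr1 ?normr0.
apply: (@is_derive_quadratic _ _ _ M (rho - `|x|)); first by rewrite subr_gt0.
move=> h hr; rewrite scale0r add0r.
have Bh : B (h *: e + x).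
  rewrite /B /cball /=; apply: le_lt_trans (ler_normD _ _) _.
  by have := ne h; lra.
have cK z : B z -> {for z, continuous K} by exact: smf_continuous.
have cK1 z : B z -> {for z, continuous (pd i K)} by exact: smf_continuous.
rewrite /segment_mean -intg_sub; [|exact: segment_cont01..].
rewrite -intg_scale; last exact: segment_cont01.
rewrite -intg_sub; first last.
- by apply: cont01_scale; exact: segment_cont01.
- by apply: cont01_sub; exact: segment_cont01.
apply: intg_bound.
  apply: cont01_sub; last by apply: cont01_scale; exact: segment_cont01.
  by apply: cont01_sub; exact: segment_cont01.
move=> t t01; have /andP[t0 t1] := t01.
pose c := if i == i0 then t else 1.
have [c0 c1] : 0 <= c /\ c <= 1 by rewrite /c; case: ifP.
have -> : setc (h *: e + x) (t * (h *: e + x) 0 i0) = (c * h) *: e + setc x (t * x 0 i0).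
  apply/rowP => j; rewrite !mxE eqxx /= /c.
  case: (eqVneq i i0) => [->|ii0] /=; case: (eqVneq j i0) => ji /=.
  - by rewrite ?eqxx; ring.
  - by rewrite !mulr0.
  - by rewrite ji eq_sym (negbTE ii0) !mulr0 !add0r.
  - by rewrite mul1r.
set z := setc x _.
have zn : `|z| <= `|x| by exact: setc_scale_norm.
have zr s : `|s| <= `|c * h| -> `|s *: e + z - 0| <= rho.
  move=> sh; rewrite subr0; apply: le_trans (ler_normD _ _) _.
  have : `|c * h| <= `|h| by rewrite normrM (ger0_norm c0) ler_piMl.
  by have := ne s; lra.
have Bz s : `|s| <= `|c * h| -> B (s *: e + z).
  by move=> /zr; rewrite subr0 => zr'; exact: le_lt_trans zr' rr.
have H : `|K ((c * h) *: e + z) - K z - c * h * pd i K z| <= M * (c * h) ^+ 2.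
  apply: coord_taylor2 => s sh.
  - by case: (smf_derive i sK (Bz s sh)).
  - by case: (smf_derive i sK1 (Bz s sh)).
  - exact/MP/zr.
have -> : t ^+ w * K ((c * h) *: e + z) - t ^+ w * K z -
    h * (t ^+ (if i == i0 then w.+1 else w) * pd i K z) =
    t ^+ w * (K ((c * h) *: e + z) - K z - c * h * pd i K z).
  by rewrite /c; case: ifP => _; rewrite ?exprS; ring.
rewrite normrM ger0_norm ?exprn_ge0 //.
apply: le_trans (ler_wpM2l (exprn_ge0 w t0) H) _.
apply: (@le_trans _ _ (M * (c * h) ^+ 2)).
  by rewrite ler_piMl ?exprn_ile1 // mulr_ge0 // sqr_ge0.
rewrite ler_wpM2l // exprMn ler_piMl ?sqr_ge0 //.
by rewrite exprn_ile1.
Qed.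

Lemma segment_mean_smooth w K : smf B K -> smf B (segment_mean w K).
Proof.
move=> sK.
have H : forall a, (exists w' K', smf B K' /\ a = segment_mean w' K') -> smf B a.
  apply: smf_coind => // [_ [w' [K' [sK' ->]]] x Bx|_ [w' [K' [sK' ->]]] i].
    pose rho := (`|x| + r) / 2.
    have xr : `|x| < r by [].
    have rr : rho < r by rewrite /rho; lra.
    have rx : `|x| < rho by rewrite /rho; lra.
    have bnd i : exists2 M, 0 <= M & forall z, `|z - 0| <= rho -> `|pd i K' z| <= M.
      apply: bounded_on_box; first exact: le_trans (ltW rx).
      move=> z; rewrite subr0 => zr; apply: (smf_continuous (smf_pd i sK')).
      exact: le_lt_trans zr rr.
    have /choice[M MP] : forall i, exists M, 0 <= M /\ forall z, `|z - 0| <= rho -> `|pd i K' z| <= M.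
      by move=> i; have [M ? ?] := bnd i; exists M.
    have near_in z : `|z - x| < rho - `|x| -> `|z| < rho.
      by move=> zx; rewrite -(subrK x z); apply: le_lt_trans (ler_normD _ _) _; lra.
    have Bz z : `|z - x| < rho - `|x| -> B z by move=> /near_in zr; exact: lt_trans zr rr.
    apply: (@pd_bounded_continuous _ _ _ x (rho - `|x|) (\sum_i M i)).
    - by rewrite subr_gt0.
    - by move=> z i /Bz Bz'; case: (segment_mean_derive w' i sK' Bz').
    move=> z i zx; have [_ E] := segment_mean_derive w' i sK' (Bz z zx).
    rewrite /pd E; apply: (@le_trans _ _ (M i)); last first.
      rewrite (bigD1 i) //= lerDl sumr_ge0 // => j _; by case: (MP j).
    apply: intg_bound.
      by apply: segment_cont01 (Bz z zx) => z'; exact: (smf_continuous (smf_pd i sK')).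
    move=> t t01; rewrite normrM; have /andP[t0 t1] := t01.
    rewrite ger0_norm ?exprn_ge0 //; apply: (@le_trans _ _ (`|pd i K' (setc z (t * z 0 i0))|)).
      by rewrite ler_piMl // exprn_ile1.
    have [_] := MP i; apply; rewrite subr0; apply: le_trans (setc_scale_norm z t01) _.
    exact/ltW/near_in.
  exists (segment_mean (if i == i0 then w'.+1 else w') (pd i K')).
    by exists (if i == i0 then w'.+1 else w'), (pd i K'); split => //; exact: smf_pd.
  by move=> x Bx; exact: segment_mean_derive.
by apply: H; exists w, K.
Qed.

(** The fundamental theorem of calculus along the segment. *)
Lemma hadamard_identity G x : smf B G -> B x ->
  G x = G (setc x 0) + x 0 i0 * segment_mean 0 (pd i0 G) x.
Proof.
move=> sG Bx; pose F t := G (setc x (t * x 0 i0)).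
have sG1 : smf B (pd i0 G) by exact: smf_pd.
have cG1 z : B z -> {for z, continuous (pd i0 G)} by exact: (smf_continuous sG1).
have cf := segment_cont01 (w := 0) cG1 Bx.
have FE t : F t = G (t *: (x 0 i0 *: delta_mx 0 i0) + setc x 0).
  by rewrite scalerA shift_setc addr0.
have dF (t : R) : 0 <= t <= 1 ->
    is_derive t (1 : R) F (x 0 i0 * (t ^+ 0 * pd i0 G (setc x (t * x 0 i0)))).
  move=> t01; rewrite (funext FE).
  have Bz := setc_scale_B Bx t01.
  have zE : t *: (x 0 i0 *: delta_mx 0 i0) + setc x 0 = setc x (t * x 0 i0).
    by rewrite scalerA shift_setc addr0.
  have [dd dE] := smf_is_diff oB sG Bz.
  have := @line_derive R n G (setc x 0) (x 0 i0 *: delta_mx 0 i0) t.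
  rewrite zE deriveE // dE => H.
  rewrite expr0 mul1r.
  have <- : grad_form G (setc x (t * x 0 i0)) (x 0 i0 *: delta_mx 0 i0) =
     x 0 i0 * pd i0 G (setc x (t * x 0 i0)).
    exact: grad_form_axis.
  by apply: H; exact: diff_derivable.
have := intg_FTC dF (cont01_scale (c := x 0 i0) cf).
rewrite intg_scale // -/(segment_mean 0 (pd i0 G) x) => ->.
by rewrite /F mul1r mul0r setc_id addrC subrK.
Qed.

Lemma segment_mean_hyperplane K x : x 0 i0 = 0 -> segment_mean 0 K x = K x.
Proof.
move=> x0; rewrite -[RHS]intg_cst; apply: intg_ext => t _.
by rewrite x0 mulr0 -{1}x0 setc_id expr0 mul1r.
Qed.

Definition negc x := setc x (- x 0 i0).

Lemma negc_line i (h : R) x : negc (h *: delta_mx 0 i + x) =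
  h *: ((if i == i0 then -1 else 1) *: delta_mx 0 i) + negc x.
Proof.
apply/rowP => j; rewrite !mxE eqxx /=.
case: (eqVneq i i0) => [->|ii0] /=; case: (eqVneq j i0) => ji /=.
- by rewrite ?eqxx; ring.
- by rewrite !mulr0.
- by rewrite ji eq_sym (negbTE ii0) !mulr0 !add0r.
- by rewrite mul1r.
Qed.

Lemma negcB x : B x -> B (negc x).
Proof.
move=> Bx; apply: le_lt_trans Bx; apply: rV_norm_le => // i; rewrite mxE.
by case: eqP => _; rewrite ?normrN rV_norm_coord.
Qed.

Lemma parity_pd K (e : R) i : smf B K -> (forall x, B x -> K (negc x) = e * K x) ->
  forall x, B x ->
  pd i K (negc x) = (if i == i0 then - e else e) * pd i K x.
Proof.
move=> sK eK x Bx; set s : R := if i == i0 then -1 else 1.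
have H1 : is_derive x (delta_mx 0 i) (fun z => K (negc z)) (s * pd i K (negc x)).
  apply: is_derive_line.
  rewrite (_ : (fun h => _) = fun h => K (h *: (s *: delta_mx 0 i) + negc x)); last first.
    by apply/funext => h; rewrite negc_line.
  have [dd dE] := smf_is_diff oB sK (negcB Bx).
  have <- : 'D_(s *: delta_mx 0 i) K (negc x) = s * pd i K (negc x).
    by rewrite deriveE // dE grad_form_axis.
  by apply: derive_line; exact: diff_derivable.
have H2 : is_derive x (delta_mx 0 i) (fun z => K (negc z)) (e * pd i K x).
  have := is_derive_mul (is_derive_cst e x (delta_mx 0 i)) (smf_derive i sK Bx).
  rewrite mulr0 addr0; apply: near_eq_is_derive.
  by apply: filterS (open_near oB Bx) => z Bz; rewrite eK.
have [_ E1] := H1; have [_ E2] := H2; move: E1; rewrite E2 /s => E.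
by case: ifP E => _ E; lra.
Qed.

Lemma segment_mean_even w K : (forall x, B x -> K (negc x) = K x) ->
  forall x, B x -> segment_mean w K (negc x) = segment_mean w K x.
Proof.
move=> eK x Bx; apply: intg_ext => t t01; congr (_ * _).
rewrite -[RHS]eK; last exact: setc_scale_B.
by rewrite /negc setc_at !setc_setc setc_at mulrN.
Qed.

End Hadamard.

(** * Whitney's theorem on even functions *)

Section EvenExtension.
Variables (R : realType) (n : nat) (i0 : 'I_n) (r0 : R).
Hypothesis r0_gt0 : 0 < r0.
Implicit Types (x z : 'rV[R]_n) (f : 'rV[R]_n -> R) (s t : R).

Let r := 2 * r0.
Let B := cball r : set 'rV[R]_n.
Let oB : open B. Proof. exact: open_cball. Qed.

Definition even_smooth f := smf B f /\ forall x, B x -> f (negc i0 x) = f x.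

(** For [f] even, (1 / 2 x) df / dx: the derivative of [f] with respect to the
    square of the coordinate [i0]. It is smooth since df / dx vanishes at 0. *)
Definition half_quot f x := 2^-1 * segment_mean i0 0 (pd i0 (pd i0 f)) x.

Lemma half_quotP f x : even_smooth f -> B x -> pd i0 f x = 2 * x 0 i0 * half_quot f x.
Proof.
move=> [sf ef] Bx.
have sf1 : smf B (pd i0 f) by exact: smf_pd.
rewrite (hadamard_identity i0 sf1 Bx) /half_quot.
have Bx0 : B (setc i0 x 0).
  by have := @setc_scale_B _ _ i0 r x 0 Bx; rewrite mul0r; apply; rewrite lexx ler01.
have := @parity_pd _ _ i0 r f 1 i0 sf (fun x Bx => etrans (ef x Bx) (esym (mul1r _))) _ Bx0.
rewrite eqxx /negc setc_at oppr0 setc_setc mulN1r => E.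
have -> : pd i0 f (setc i0 x 0) = 0 by lra.
by field.
Qed.

Lemma half_quot_even f : even_smooth f -> even_smooth (half_quot f).
Proof.
move=> [sf ef]; have sf1 : smf B (pd i0 f) by exact: smf_pd.
have sf2 : smf B (pd i0 (pd i0 f)) by exact: smf_pd.
split.
  by apply: smf_mul => //; [exact: smf_cst | exact: segment_mean_smooth].
have e1 := @parity_pd _ _ i0 r f 1 i0 sf (fun x Bx => etrans (ef x Bx) (esym (mul1r _))).
rewrite eqxx in e1.
have e2 z : B z -> pd i0 (pd i0 f) (negc i0 z) = pd i0 (pd i0 f) z.
  move=> Bz; have := @parity_pd _ _ i0 r (pd i0 f) (-1) i0 sf1 e1 z Bz.
  by rewrite eqxx opprK mul1r.
move=> x Bx; have H := @segment_mean_even _ _ i0 r 0%N _ e2 x Bx.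
by rewrite /half_quot H.
Qed.

Lemma pd_even i f : i != i0 -> even_smooth f -> even_smooth (pd i f).
Proof.
move=> ii0 [sf ef]; split; first exact: smf_pd.
move=> x Bx.
have := @parity_pd _ _ i0 r f 1 i sf (fun x Bx => etrans (ef x Bx) (esym (mul1r _))) x Bx.
by rewrite (negbTE ii0) mul1r.
Qed.

(** [clamp] compresses [0, +oo[ into [0, r0 ^ 2[; the functions sampled below
    are then bounded although the dilations 2 ^ k are not. *)
Definition clamp s := r0 ^+ 2 * (s / (1 + s)).
Definition root_clamp s := Num.sqrt (clamp s).

Lemma clamp_ge0 s : 0 <= s -> 0 <= clamp s.
Proof. by move=> s0; rewrite mulr_ge0 ?sqr_ge0 // divr_ge0 // addr_ge0. Qed.

Lemma clamp_gt0 s : 0 < s -> 0 < clamp s.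
Proof. by move=> s0; rewrite mulr_gt0 ?exprn_gt0 // divr_gt0 // addr_gt0. Qed.

Lemma clamp_lt s : 0 <= s -> clamp s < r0 ^+ 2.
Proof.
move=> s0; rewrite /clamp gtr_pMr ?exprn_gt0 // ltr_pdivrMr ?mul1r ?ltrDr //.
by rewrite ltr_pwDl.
Qed.

Lemma root_clamp_norm s : 0 <= s -> `|root_clamp s| < r0.
Proof.
move=> s0; rewrite ger0_norm ?sqrtr_ge0 // -[ltRHS](ger0_norm (ltW r0_gt0)) -sqrtr_sqr.
by rewrite ltr_sqrt ?exprn_gt0 // clamp_lt.
Qed.

Lemma sqr_root_clamp s : 0 <= s -> root_clamp s ^+ 2 = clamp s.
Proof. by move=> s0; rewrite sqr_sqrtr // clamp_ge0. Qed.

Lemma clamp_derive s : 0 < s ->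
  is_derive s (1 : R) clamp ((r0 ^+ 2 - clamp s) ^+ 2 / r0 ^+ 2).
Proof.
move=> s0; have s1 : 1 + s != 0 by rewrite gt_eqF // addr_gt0.
have d1 : is_derive s (1 : R) (fun t : R => 1 + t) 1.
  have := @is_deriveD _ _ _ (cst 1 : R -> R) id s 1 0 1 (is_derive_cst _ _ _) (is_derive_id _ _).
  by rewrite add0r.
have d2 : is_derive s (1 : R) (fun t : R => (1 + t)^-1) (- (1 + s)^-1 ^+ 2).
  split; first by apply: derivableV => //; case: d1.
  have [dd1 E1] := d1; have := deriveV s1 dd1; rewrite E1 => ->.
  by rewrite exprVn; exact: mulr1.
have d3 : is_derive s (1 : R) (fun t : R => t * (1 + t)^-1) (s * - (1 + s)^-1 ^+ 2 + (1 + s)^-1 * 1).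
  exact: (@is_deriveM _ _ id (fun t : R => (1 + t)^-1)).
have d4 : is_derive s (1 : R) clamp (r0 ^+ 2 * (s * - (1 + s)^-1 ^+ 2 + (1 + s)^-1 * 1)).
  exact: (@is_deriveZ _ _ _ (fun t : R => t * (1 + t)^-1)).
apply: is_derive_eq d4 _; rewrite /clamp; field.
by rewrite s1 gt_eqF.
Qed.

Lemma root_clamp_derive s : 0 < s ->
  is_derive s (1 : R) root_clamp ((2 * root_clamp s)^-1 * ((r0 ^+ 2 - clamp s) ^+ 2 / r0 ^+ 2)).
Proof.
move=> s0; apply: is_derive1_comp; last exact: clamp_derive.
exact/is_derive1_sqrt/clamp_gt0.
Qed.

Lemma root_clamp_continuous (T : topologicalType) (g : T -> R) (y : T) :
  (forall w, 0 <= g w) -> {for y, continuous g} -> {for y, continuous (fun w => root_clamp (g w))}.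
Proof.
move=> g0 cg; apply: (@continuous_comp _ _ _ (fun w => clamp (g w)) (fun t => Num.sqrt t)).
  apply: continuous_at_mul; first exact: cst_continuous.
  apply: continuous_at_mul => //; apply: continuous_at_inv.
    by rewrite gt_eqF // ltr_pwDl.
  by apply: continuous_at_add => //; exact: cst_continuous.
exact: sqrt_continuous.
Qed.

(** The operator that d / d s induces through f |-> f (sqrt (clamp s), y). *)
Definition shift_op f x := half_quot f x * ((r0 ^+ 2 - x 0 i0 ^+ 2) ^+ 2 / r0 ^+ 2).

Lemma shift_op_even f : even_smooth f -> even_smooth (shift_op f).
Proof.
move=> /half_quot_even[sq eq]; split.
  apply: smf_mul => //.
  apply: (@smf_ext _ _ _ oB (fun x => (r0 ^+ 2 + - (x 0 i0 * x 0 i0)) * (r0 ^+ 2 + - (x 0 i0 * x 0 i0)) * (r0 ^+ 2)^-1)).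
    by move=> x _; rewrite !expr2.
  have sc := smf_coord oB i0.
  have sp : smf B (fun x => r0 ^+ 2 + - (x 0 i0 * x 0 i0)).
    apply: smf_add => //; first exact: smf_cst.
    by apply: smf_opp => //; exact: smf_mul.
  by apply: smf_mul => //; [exact: smf_mul | exact: smf_cst].
by move=> x Bx; rewrite /shift_op eq // /negc setc_at sqrrN.
Qed.

Definition strip : set 'rV[R]_n := [set x | forall i, i != i0 -> `|x 0 i| < r0].

Lemma open_strip : open strip.
Proof.
rewrite openE => x xs; rewrite /interior.
have : \forall z \near (x : 'rV[R]_n), forall i, i != i0 -> `|(z : 'rV[R]_n) 0 i| < r0.
  apply: near_forall => i; have [->|ii0] := eqVneq i i0.
    by apply: near_all => z.
  have d0 : 0 < r0 - `|x 0 i| by rewrite subr_gt0 xs.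
  apply/nbhs_distP; exists (r0 - `|x 0 i|) => // z zx _.
  have := le_lt_trans (rV_norm_coord (z - x) i) zx; rewrite !mxE => H.
  by have := ler_distD (x 0 i) (z 0 i) 0; rewrite !subr0; lra.
by [].
Qed.

Lemma sample_in x s : strip x -> 0 <= s -> `|setc i0 x (root_clamp s)| < r0.
Proof. by move=> xs s0; apply: setc_norm_lt => //; exact: root_clamp_norm. Qed.

Lemma small_B z : `|z| <= r0 -> B z.
Proof. by move=> zr; apply: le_lt_trans zr _; rewrite /r ltr_pMl // ltr1n. Qed.

Lemma sample_B x s : strip x -> 0 <= s -> B (setc i0 x (root_clamp s)).
Proof. by move=> xs s0; apply/small_B/ltW/sample_in. Qed.

Definition sample f x s := f (setc i0 x (root_clamp s)).

Lemma sample_derive f x s : even_smooth f -> strip x -> 0 < s ->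
  is_derive s (1 : R) (sample f x) (sample (shift_op f) x s).
Proof.
move=> ef xs s0; have [sf _] := ef.
have Bz := sample_B xs (ltW s0).
set c := root_clamp s; rewrite -/c in Bz.
have c0 : 0 < c by rewrite sqrtr_gt0 clamp_gt0.
have d1 : is_derive c (1 : R) (fun h => f (setc i0 x h)) (pd i0 f (setc i0 x c)).
  have E : (fun h => f (setc i0 x h)) = fun h => f (h *: delta_mx 0 i0 + setc i0 x 0).
    by apply/funext => h; rewrite shift_setc addr0.
  have zE : c *: delta_mx 0 i0 + setc i0 x 0 = setc i0 x c by rewrite shift_setc addr0.
  rewrite E -zE; apply: line_derive; rewrite zE.
  by case: (smf_derive i0 sf Bz).
apply: is_derive_eq (is_derive1_comp d1 (root_clamp_derive s0)) _.
rewrite (half_quotP ef Bz) setc_at -/c /sample /shift_op setc_at -/c.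
rewrite sqr_root_clamp ?ltW //; field.
by rewrite !gt_eqF.
Qed.

Lemma pos_mvt (phi dphi : R -> R) (a b : R) : 0 < a -> 0 < b ->
  (forall s : R, 0 < s -> is_derive s (1 : R) phi (dphi s)) ->
  exists c, [/\ 0 < c, `|c - a| <= `|b - a| & phi b - phi a = dphi c * (b - a)].
Proof.
move=> a0 b0 d; have pos t : Num.min a b <= t -> 0 < t by apply: lt_le_trans; rewrite lt_min a0.
have [||c cI E] := @mvt_between R phi dphi a b.
- by move=> t /andP[t1 _]; apply/d/pos/ltW.
- move=> t /andP[t1 _]; apply/differentiable_continuous/derivable1_diffP.
  by case: (d t (pos t t1)).
exists c; split => //; first by case/andP: cI => /pos.
move: cI; have [ab|/ltW ba] := leP a b => /andP[? ?].
  by rewrite !ger0_norm ?subr_ge0 // lerD2r.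
by rewrite !ler0_norm ?subr_le0 // lerN2 lerD2r.
Qed.

Lemma sample_bounded f : smf B f ->
  exists2 M, 0 <= M & forall x s, strip x -> 0 <= s -> `|sample f x s| <= M.
Proof.
move=> sf; have [z|M M0 MP] := @bounded_on_box R n f 0 r0 (ltW r0_gt0).
  by rewrite subr0 => zr; exact/(smf_continuous sf)/small_B.
exists M => // x s xs s0; apply: MP; rewrite subr0; exact/ltW/sample_in.
Qed.

Lemma sample_quadratic f : even_smooth f -> exists2 M, 0 <= M &
  forall x a b, strip x -> 0 < a -> 0 < b ->
  `|sample f x b - sample f x a - (b - a) * sample (shift_op f) x a| <= M * (b - a) ^+ 2.
Proof.
move=> ef; have ef1 := shift_op_even ef; have ef2 := shift_op_even ef1.
have [M M0 MP] := sample_bounded ef2.1; exists M => // x a b xs a0 b0.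
have d1 s (s0 : 0 < s) := sample_derive ef xs s0.
have d2 s (s0 : 0 < s) := sample_derive ef1 xs s0.
have [c [c0 ca E1]] := pos_mvt a0 b0 d1.
have [d [d0 da E2]] := pos_mvt a0 c0 d2.
rewrite E1 (mulrC (b - a)) -mulrBl E2.
have := MP x d xs (ltW d0); move: (sample _ x d) => S SM.
rewrite !normrM -(real_normK (num_real (b - a))) expr2 mulrA.
by rewrite ler_wpM2r // ler_pM.
Qed.

Lemma sample_continuous f (T : topologicalType) (F : T -> 'rV[R]_n) (g : T -> R) y : smf B f ->
  (forall w, 0 <= g w) -> strip (F y) -> {for y, continuous F} -> {for y, continuous g} ->
  {for y, continuous (fun w => sample f (F w) (g w))}.
Proof.
move=> sf g0 Fy cF cg.
apply: (@continuous_comp _ _ _ (fun w => setc i0 (F w) (root_clamp (g w))) f).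
  by apply: setc_continuous => //; exact: root_clamp_continuous.
by apply: (smf_continuous sf); exact: sample_B.
Qed.

(** For x_i0 >= 0 this is f with x_i0 replaced by sqrt (clamp x_i0); for
    x_i0 < 0 the weights are the j-th derivatives of those of Seeley's reflection. *)
Definition seeley_term j f x k :=
  seeley R k * (- 2 ^+ k) ^+ j * sample f x (2 ^+ k * `|x 0 i0|).

Definition extension j f x :=
  if 0 <= x 0 i0 then sample f x (x 0 i0) else ssum (seeley_term j f x).

Lemma weight_norm j k : `|seeley R k * (- 2 ^+ k) ^+ j| = `|seeley R k| * 2 ^+ (k * j).
Proof. by rewrite normrM normrX normrN (ger0_norm (exprn_ge0 _ _)) // -exprM. Qed.

Lemma seeley_term_bounded j f : smf B f -> exists2 M, 0 <= M & forall x k, strip x ->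
  `|seeley_term j f x k| <= M * (`|seeley R k| * 2 ^+ (k * j)).
Proof.
move=> sf; have [M M0 MP] := sample_bounded sf; exists M => // x k xs.
rewrite normrM weight_norm mulrC; apply: ler_wpM2r.
  by apply: mulr_ge0 => //; exact: exprn_ge0.
by apply: MP => //; rewrite mulr_ge0 // exprn_ge0.
Qed.

Lemma seeley_term_cvg j f x : smf B f -> strip x -> cvgn (series (seeley_term j f x)).
Proof.
move=> sf xs; have [M M0 MP] := seeley_term_bounded j sf.
by apply: summable_cvg (summableZ M0 (seeley_summable R j)) _ => k; exact: MP.
Qed.

(** The two formulas agree on the hyperplane because the relevant moment of the
    coefficients is 1. *)
Lemma extension_continuous j f x : even_smooth f -> strip x -> {for x, continuous (extension j f)}.
Proof.
move=> [sf ef] xs.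
pose P z := sample f z `|z 0 i0|; pose N z := ssum (seeley_term j f z).
have ci : {for x, continuous (fun z : 'rV[R]_n => `|z 0 i0|)}.
  by apply: continuous_at_norm; exact: coord_continuous.
have cP : {for x, continuous P}.
  by apply: sample_continuous => //; exact: cvg_id.
have cN : {for x, continuous N}.
  have [M M0 MP] := seeley_term_bounded j sf.
  apply: (ssum_continuous (summableZ M0 (seeley_summable R j))).
    by apply: filterS (open_near open_strip xs) => z zs k; exact: MP.
  move=> k; apply: continuous_at_mul; first exact: cst_continuous.
  apply: sample_continuous; [by []|by move=> z; rewrite mulr_ge0 // exprn_ge0|by []|exact: cvg_id|].
  by apply: continuous_at_mul => //; exact: cst_continuous.
have PN : x 0 i0 = 0 -> N x = P x.
  move=> x0; rewrite /N /P x0 normr0.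
  rewrite (_ : seeley_term j f x = fun k => sample f x 0 * (seeley R k * (- 2 ^+ k) ^+ j)).
    rewrite ssumZ ?seeley_moment ?mulr1 //.
    have := seeley_summable R j => sM; apply: summable_cvg sM _ => k.
    by rewrite weight_norm.
  by apply/funext => k; rewrite /seeley_term x0 normr0 mulr0 mulrC.
have EP z : 0 <= z 0 i0 -> extension j f z = P z.
  by move=> z0; rewrite /extension z0 /P ger0_norm.
have EN z : z 0 i0 < 0 -> extension j f z = N z by rewrite /extension leNgt => ->.
have cx : {for x, continuous (fun z : 'rV[R]_n => z 0 i0)} by exact: coord_continuous.
apply/continuous_at_dist => e e0.
have /continuous_at_dist/(_ e e0) nP := cP; have /continuous_at_dist/(_ e e0) nN := cN.
have [x0|x0|x0] := ltgtP (x 0 i0) 0.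
- have nx : \forall z \near x, (z : 'rV[R]_n) 0 i0 < 0.
    have /continuous_at_dist/(_ (- x 0 i0)) := cx; rewrite oppr_gt0 => /(_ x0).
    by apply: filterS => z /ltr_normlP[]; lra.
  by apply: filterS2 nx nN => z z0; rewrite !EN.
- have nx : \forall z \near x, 0 <= (z : 'rV[R]_n) 0 i0.
    have /continuous_at_dist/(_ (x 0 i0) x0) := cx.
    by apply: filterS => z /ltr_normlP[]; lra.
  by apply: filterS2 nx nP => z z0; rewrite !EP // ltW.
- apply: filterS2 nP nN => z zP zN.
  rewrite (EP x) ?x0 //; have [z0|z0] := leP 0 (z 0 i0); first by rewrite EP.
  by rewrite EN // -PN.
Qed.

(** Termwise differentiation at 0 of a series of functions with summable
    quadratic remainders. *)
Lemma ssum_is_derive (phi : nat -> R -> R) (dphi A : nat -> R) (d : R) : 0 < d ->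
  summable A -> (forall h, `|h| < d -> cvgn (series (phi ^~ h))) -> cvgn (series dphi) ->
  (forall k h, `|h| < d -> `|phi k h - phi k 0 - h * dphi k| <= A k * h ^+ 2) ->
  is_derive (0 : R) (1 : R) (fun h => ssum (phi ^~ h)) (ssum dphi).
Proof.
move=> d0 sA cphi cd est.
apply: (@is_derive_quadratic _ _ _ (ssum A) d d0) => h hd.
have c0 : cvgn (series (phi ^~ 0)) by apply: cphi; rewrite normr0.
have ch := cphi h hd.
have cB : cvgn (series (fun k => phi k h - phi k 0)) by exact: (is_cvg_seriesB ch c0).
have cZ : cvgn (series (fun k => h * dphi k)).
  by rewrite series_scale; apply: is_cvgM => //; exact: is_cvg_cst.
rewrite -ssumB // -ssumZ // -ssumB //.
have [A0 cA] := sA.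
have sA' : summable (fun k => h ^+ 2 * A k) by apply: summableZ => //; exact: sqr_ge0.
rewrite mulrC -ssumZ //; apply: ssum_bound => // k.
by rewrite (mulrC (h ^+ 2)); exact: est.
Qed.

Lemma extension_derive_other j f i x : i != i0 -> even_smooth f -> strip x ->
  is_derive x (delta_mx 0 i) (extension j f) (extension j (pd i f) x).
Proof.
move=> ii0 ef xs; have [sf _] := ef; have sf1 : smf B (pd i f) by exact: smf_pd.
have sf2 : smf B (pd i (pd i f)) by exact: smf_pd.
pose e : 'rV[R]_n := delta_mx 0 i.
have x0E (h : R) : (h *: e + x) 0 i0 = x 0 i0.
  by rewrite !mxE (eq_sym i0) (negbTE ii0) andbF mulr0 add0r.
have sampleE g (h s : R) : sample g (h *: e + x) s = g (h *: e + setc i0 x (root_clamp s)).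
  by rewrite /sample setc_shift.
apply: is_derive_line; rewrite /extension.
have [x0|x0] := leP 0 (x 0 i0).
  rewrite (_ : (fun h => _) = fun h : R => f (h *: e + setc i0 x (root_clamp (x 0 i0)))); last first.
    by apply/funext => h; rewrite x0E x0 sampleE.
  have Bz := sample_B xs x0; have [df _] := smf_derive i sf Bz.
  exact: derive_line.
rewrite (_ : (fun h => _) = fun h : R => ssum (seeley_term j f (h *: e + x))); last first.
  by apply/funext => h; rewrite x0E leNgt x0.
have [z|M M0 MP] := @bounded_on_box R n (pd i (pd i f)) 0 r0 (ltW r0_gt0).
  by rewrite subr0 => zr; exact/(smf_continuous sf2)/small_B.
have d0 : 0 < r0 - `|x 0 i| by rewrite subr_gt0 xs.
have strip_h (h : R) : `|h| < r0 - `|x 0 i| -> strip (h *: e + x).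
  move=> hd k ki0; rewrite !mxE eqxx /=; have [->|ki] := eqVneq k i.
    by rewrite mulr1; apply: le_lt_trans (ler_normD _ _) _; lra.
  by rewrite mulr0 add0r; exact: xs.
apply: (@ssum_is_derive (fun k h => seeley_term j f (h *: e + x) k) (seeley_term j (pd i f) x)
  (fun k => M * (`|seeley R k| * 2 ^+ (k * j))) (r0 - `|x 0 i|)) => //.
- by apply: summableZ => //; exact: seeley_summable.
- by move=> h hd; apply: seeley_term_cvg => //; exact: strip_h.
- exact: seeley_term_cvg.
move=> k h hd; rewrite /seeley_term !x0E scale0r add0r sampleE.
set s := 2 ^+ k * _; have s0 : 0 <= s by rewrite mulr_ge0 // exprn_ge0.
rewrite (_ : _ - _ = seeley R k * (- 2 ^+ k) ^+ j *
   (f (h *: e + setc i0 x (root_clamp s)) - sample f x s - h * sample (pd i f) x s)); last by ring.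
rewrite normrM weight_norm [leRHS]mulrAC [leRHS]mulrC; apply: ler_wpM2l.
  by apply: mulr_ge0 => //; exact: exprn_ge0.
have inb (t : R) : `|t| <= `|h| -> `|t *: e + setc i0 x (root_clamp s)| <= r0.
  move=> th; apply/ltW; rewrite -setc_shift //; apply: sample_in => //.
  by apply: strip_h; apply: le_lt_trans hd.
apply: coord_taylor2 => t th.
- by case: (smf_derive i sf (small_B (inb t th))).
- by case: (smf_derive i sf1 (small_B (inb t th))).
- by apply: MP; rewrite subr0; exact: inb.
Qed.

Lemma extension_derive_nonzero j f x : x 0 i0 != 0 -> even_smooth f -> strip x ->
  is_derive x (delta_mx 0 i0) (extension j f) (extension j.+1 (shift_op f) x).
Proof.
move=> xn0 ef xs; have [sf _] := ef; have ef1 := shift_op_even ef; have [sf1 _] := ef1.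
pose e : 'rV[R]_n := delta_mx 0 i0.
have x0E (h : R) : (h *: e + x) 0 i0 = h + x 0 i0 by rewrite !mxE !eqxx mulr1.
have sampleE g (h s : R) : sample g (h *: e + x) s = sample g x s.
  by rewrite /sample setc_shift_at.
apply: is_derive_line; rewrite {2}/extension.
have a0 : 0 < `|x 0 i0| by rewrite normr_gt0.
have nh : \forall h \near (0 : R), `|h| < `|x 0 i0|.
  by apply/nbhs_distP; exists `|x 0 i0| => // h; rewrite subr0.
have [x0|x0] := leP 0 (x 0 i0).
  have x0' : 0 < x 0 i0 by rewrite lt_neqAle eq_sym xn0.
  apply: (@near_eq_is_derive _ _ _ (fun h : R => sample f x (h + x 0 i0))).
    apply: filterS nh => h; rewrite (ger0_norm x0) => /ltr_normlP[h1 h2].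
    rewrite /extension x0E sampleE ifT //; lra.
  have := sample_derive ef xs x0'.
  have E : (fun h : R => h^-1 *: (((fun h => sample f x (h + x 0 i0)) \o shift 0) (h *: 1) - sample f x (0 + x 0 i0))) =
     (fun h : R => h^-1 *: ((sample f x \o shift (x 0 i0)) (h *: 1) - sample f x (x 0 i0))).
    by apply/funext => h /=; rewrite !addr0 add0r.
  by move=> [dd <-]; split; rewrite /derivable /derive E.
have [M M0 MP] := sample_quadratic ef.
apply: (@near_eq_is_derive _ _ _ (fun h : R => ssum (seeley_term j f (h *: e + x)))).
  apply: filterS nh => h; rewrite (ltr0_norm x0) => /ltr_normlP[h1 h2].
  by rewrite /extension x0E ifF //; apply/negbTE; rewrite -ltNge; lra.
have strip_h (h : R) : strip (h *: e + x).
  by move=> k ki0; rewrite !mxE (negbTE ki0) mulr0 add0r; exact: xs.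
apply: (@ssum_is_derive (fun k h => seeley_term j f (h *: e + x) k) (seeley_term j.+1 (shift_op f) x)
  (fun k => M * (`|seeley R k| * 2 ^+ (k * j.+2))) `|x 0 i0|) => //.
- by apply: summableZ => //; exact: seeley_summable.
- by move=> h hd; exact: seeley_term_cvg.
- exact: seeley_term_cvg.
move=> k h; rewrite (ltr0_norm x0) => /ltr_normlP[h1 h2].
rewrite /seeley_term !x0E add0r !sampleE.
have hx : h + x 0 i0 < 0 by lra.
rewrite (ltr0_norm x0) (ltr0_norm hx).
have p0 : 0 < 2 ^+ k :> R by exact: exprn_gt0.
have := @MP x (2 ^+ k * - x 0 i0) (2 ^+ k * - (h + x 0 i0)) xs.
rewrite !pmulr_rgt0 // !oppr_gt0 => /(_ x0 hx).
set s := 2 ^+ k * - x 0 i0; set s' := 2 ^+ k * - _.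
have -> : s' - s = - 2 ^+ k * h by rewrite /s /s'; ring.
move=> H.
rewrite (_ : _ - _ = seeley R k * (- 2 ^+ k) ^+ j *
   (sample f x s' - sample f x s - - 2 ^+ k * h * sample (shift_op f) x s)); last by rewrite exprS; ring.
rewrite normrM weight_norm.
apply: le_trans (ler_wpM2l _ H) _; first by apply: mulr_ge0 => //; exact: exprn_ge0.
rewrite exprMn sqrrN -exprM le_eqVlt; apply/orP; left; apply/eqP.
have -> : (k * j.+2 = k * j + k * 2)%N by rewrite -mulnDr addn2.
by rewrite exprD; ring.
Qed.

(** On the hyperplane the derivative is obtained as the limit of the derivatives
    at nearby points. *)
Lemma extension_derive_at j f x : even_smooth f -> strip x ->
  is_derive x (delta_mx 0 i0) (extension j f) (extension j.+1 (shift_op f) x).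
Proof.
move=> ef xs; have [x0|] := eqVneq (x 0 i0) 0; last by move=> ?; exact: extension_derive_nonzero.
pose e : 'rV[R]_n := delta_mx 0 i0.
have ef1 := shift_op_even ef.
have x0E (h : R) : (h *: e + x) 0 i0 = h by rewrite !mxE !eqxx mulr1 x0 addr0.
have strip_h (h : R) : strip (h *: e + x).
  by move=> k ki0; rewrite !mxE (negbTE ki0) mulr0 add0r; exact: xs.
have cl : continuous (fun h : R => h *: e + x).
  move=> h; apply: continuous_at_rV => k.
  apply: (@continuous_at_ext _ _ (fun h : R => h * e 0 k + x 0 k)).
    by apply: near_all => t; rewrite !mxE.
  apply: continuous_at_add; last exact: cst_continuous.
  by apply: continuous_at_mul; [exact: cvg_id | exact: cst_continuous].
have ce j' g (h : R) : even_smooth g -> {for h, continuous (fun h : R => extension j' g (h *: e + x))}.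
  move=> eg; apply: (@continuous_comp _ _ _ (fun h : R => h *: e + x) (extension j' g)).
    exact: cl.
  exact: extension_continuous.
apply: is_derive_line.
have := @is_derive_extend R (fun h => extension j f (h *: e + x))
  (fun h => extension j.+1 (shift_op f) (h *: e + x)) 1 ltr01.
rewrite scale0r add0r; apply.
- by move=> t _; exact: ce.
- exact: ce.
- move=> t _ t0.
  have [dd E] := @extension_derive_nonzero j f (t *: e + x) (etrans (congr1 (fun u => u != 0) (x0E t)) t0) ef (strip_h t).
  by rewrite -E; exact: line_derive.
Qed.

(** The derivatives of an extension are extensions of other even functions, with
    weights of the same kind. *)
Lemma extension_smooth j f : even_smooth f -> smf strip (extension j f).
Proof.
move=> ef.
have H : forall a, (exists j' f', even_smooth f' /\ a = extension j' f') -> smf strip a.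
  apply: smf_coind; first exact: open_strip.
    by move=> _ [j' [f' [ef' ->]]] x xs; exact: extension_continuous.
  move=> _ [j' [f' [ef' ->]]] i; have [->|ii0] := eqVneq i i0.
    exists (extension j'.+1 (shift_op f')).
      by exists j'.+1, (shift_op f'); split => //; exact: shift_op_even.
    by move=> x xs; exact: extension_derive_at.
  exists (extension j' (pd i f')).
    by exists j', (pd i f'); split => //; exact: pd_even.
  by move=> x xs; exact: extension_derive_other.
by apply: H; exists j, f.
Qed.

End EvenExtension.

Section GermDivision.
Variables (R : realType) (n : nat) (i0 : 'I_n).
Implicit Types (x z : 'rV[R]_n) (f G : 'rV[R]_n -> R).

Lemma sma0_ball f : sma 0 f -> forall P : 'rV[R]_n -> Prop, (\forall x \near (0 : 'rV[R]_n), P x) ->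
  exists2 r, 0 < r & smf (cball (2 * r)) f /\ forall x, cball (2 * r) x -> P x.
Proof.
move=> [U [oU U0 sf]] P nP.
have [s s0 sP] : exists2 s : R, 0 < s & forall z : 'rV[R]_n, `|z - 0| < s -> U z /\ P z.
  by apply/nbhs_distP; apply: filterS2 (open_near oU U0) nP.
exists (s / 2); first by rewrite divr_gt0.
rewrite mulrC divfK //; split.
  by apply: smf_sub sf => x xs; apply: (sP x _).1; rewrite subr0.
by move=> x xs; apply: (sP x _).2; rewrite subr0.
Qed.

Lemma near0_cball (r : R) : 0 < r -> \forall x \near (0 : 'rV[R]_n), cball r x.
Proof. by move=> r0; apply/nbhs_distP; exists r => // x; rewrite subr0. Qed.

Theorem hadamard_germ G : sma 0 G -> exists H, [/\ sma 0 H,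
  (\forall x \near (0 : 'rV[R]_n), G x = G (setc i0 x 0) + x 0 i0 * H x) &
  (forall x, x 0 i0 = 0 -> H x = pd i0 G x)].
Proof.
move=> sG; have [r r0 [sGr _]] := sma0_ball sG (@near_all 'rV[R]_n (fun=> True) 0 (fun=> I)).
have r20 : 0 < 2 * r by rewrite mulr_gt0.
exists (segment_mean i0 0 (pd i0 G)); split.
- exists (cball (2 * r)); split; [exact: open_cball | by rewrite /cball /= normr0|].
  by apply: segment_mean_smooth; exact: smf_pd.
- apply: filterS (near0_cball r20) => x; exact: hadamard_identity.
- by move=> x x0; exact: segment_mean_hyperplane.
Qed.

(** The function [F] is the Seeley extension, to both signs of the coordinate [i0],
    of [f] read as a function of the square; [unclamp] undoes the compression that
    made the extension converge. *)
Theorem even_germ f : sma 0 f -> (\forall x \near (0 : 'rV[R]_n), f (negc i0 x) = f x) ->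
  exists F, sma 0 F /\ \forall x \near (0 : 'rV[R]_n), f x = F (setc i0 x (x 0 i0 ^+ 2)).
Proof.
move=> sf ef; have [r r0 [sfr efr]] := sma0_ball sf ef.
have e : even_smooth i0 r f by split.
have r2 : 0 < r ^+ 2 by rewrite exprn_gt0.
pose E := extension i0 r 0 f.
have sE : smf (strip i0 r) E by exact: extension_smooth.
have sE0 : sma 0 E.
  exists (strip i0 r); split => //; first exact: open_strip.
  by move=> i _; rewrite mxE normr0.
pose unclamp x := setc i0 x (x 0 i0 / (r ^+ 2 - x 0 i0)).
have u0 : unclamp 0 = 0.
  by apply/rowP => i; rewrite !mxE mul0r; case: ifP.
have su : smva 0 unclamp.
  move=> k; have [->|ki0] := eqVneq k i0.
    apply: (@sma_ext _ _ _ (fun x => x 0 i0 * (r ^+ 2 - x 0 i0)^-1)).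
      by apply: near_all => x; rewrite setc_at.
    apply: sma_mul; first exact: sma_coord.
    apply: sma_inv; first by rewrite mxE subr0 gt_eqF.
    by apply: sma_sub; [exact: sma_cst | exact: sma_coord].
  apply: (@sma_ext _ _ _ (fun x => x 0 k)); last exact: sma_coord.
  by apply: near_all => x; rewrite mxE (negbTE ki0).
exists (fun x => E (unclamp x)); split; first by apply: sma_comp => //; rewrite u0.
apply: filterS (near0_cball r0) => x xr.
have x0r : `|x 0 i0| < r by exact: le_lt_trans (rV_norm_coord x i0) xr.
have x2 : x 0 i0 ^+ 2 < r ^+ 2.
  by rewrite -(real_normK (num_real (x 0 i0))) ltrXn2r // ?nnegrE // ltW.
have d0 : 0 < r ^+ 2 - x 0 i0 ^+ 2 by rewrite subr_gt0.
rewrite /unclamp setc_at setc_setc /E /extension setc_at ifT; last first.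
  by rewrite divr_ge0 ?sqr_ge0 // ltW.
rewrite /sample setc_setc /root_clamp /clamp.
rewrite (_ : r ^+ 2 * _ = x 0 i0 ^+ 2); last first.
  by field; rewrite !gt_eqF //; lra.
rewrite sqrtr_sqr; have [xp|xn] := leP 0 (x 0 i0).
  by rewrite ger0_norm // setc_id.
have Bx : cball (2 * r) x by apply: lt_trans xr _; rewrite ltr_pMl // ltr1n.
by rewrite ltr0_norm // -(efr x Bx).
Qed.

End GermDivision.

(** * Second derivatives and Whitney's condition *)

Section SecondOrder.
Variable R : realType.

(** The derivative of the Jacobian in the direction [v]: then [k *m djac f x v] is
    the second derivative of [f] in the directions [k] and [v]. *)
Definition djac n d (f : 'rV[R]_n -> 'rV[R]_d) x v : 'M[R]_(n, d) :=
  \matrix_(i, j) grad_form (pd i (fun z => f z 0 j)) x v.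

Lemma grad_formE n (a : 'rV[R]_n -> R) x v d : sma x a -> is_derive x v a d ->
  grad_form a x v = d.
Proof. by move=> sa [_ <-]; case: (sma_derive_dir v sa). Qed.

Lemma grad_form_near n (a b : 'rV[R]_n -> R) x v : (\near x, a x = b x) ->
  grad_form a x v = grad_form b x v.
Proof. by move=> ab; apply: eq_bigr => i _; rewrite (pd_near i ab). Qed.

Lemma near_near n (x : 'rV[R]_n) (P : 'rV[R]_n -> Prop) : (\forall z \near x, P z) ->
  \forall z \near x, \forall w \near z, P w.
Proof.
move=> /nbhs_open_sub[U [oU Ux UP]].
by apply: filterS (open_near oU Ux) => z Uz; apply: filterS (open_near oU Uz) => w /UP.
Qed.

Lemma djac_near n d (f g : 'rV[R]_n -> 'rV[R]_d) x v : (\near x, f x = g x) ->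
  djac f x v = djac g x v.
Proof.
move=> /near_near fg; apply/matrixP => i j; rewrite [LHS]mxE [RHS]mxE.
have E : \forall z \near x, pd i (fun w => f w 0 j) z = pd i (fun w => g w 0 j) z.
  by apply: filterS fg => z fgz; apply: pd_near; apply: filterS fgz => w ->.
exact: grad_form_near v E.
Qed.

Lemma chain_dir n d (f : 'rV[R]_n -> 'rV[R]_d) (b : 'rV[R]_d -> R) x v :
  smva x f -> sma (f x) b ->
  is_derive x v (fun z => b (f z)) (grad_form b (f x) (v *m jac f x)).
Proof.
move=> sf sb; rewrite /grad_form.
exact: chain_rule (fun j => smva_derive_dir v j sf) (sma_is_diff sb).
Qed.

Lemma djac_comp n d e (f : 'rV[R]_n -> 'rV[R]_d) (g : 'rV[R]_d -> 'rV[R]_e) x v :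
  smva x f -> smva (f x) g ->
  djac (fun z => g (f z)) x v =
  djac f x v *m jac g (f x) + jac f x *m djac g (f x) (v *m jac f x).
Proof.
move=> sf sg; apply/matrixP => i j; rewrite !mxE.
have E : \forall z \near x, \sum_k pd i (fun w => f w 0 k) z * pd k (fun w => g w 0 j) (f z) =
    pd i (fun w => g (f w) 0 j) z.
  apply: filterS2 (smva_near sf) (smva_preim sf (smva_near sg)) => z sfz sgz.
  by rewrite (pd_comp i sfz (sgz j)); apply: eq_bigr => k _; rewrite mxE.
rewrite -(grad_form_near v E).
have s1 k : sma x (pd i (fun w => f w 0 k)) by exact/sma_pd/sf.
have s2 k : sma (f x) (pd k (fun w => g w 0 j)) by exact/sma_pd/sg.
have s3 k : sma x (fun z => pd k (fun w => g w 0 j) (f z)) by exact: (sma_comp sf (s2 k)).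
rewrite (grad_formE _ (is_derive_bigsum (fun k => is_derive_mul (sma_derive_dir v (s1 k)) (chain_dir v sf (s2 k))))).
  rewrite -big_split; apply: eq_bigr => k _ /=; rewrite !mxE addrC; congr (_ + _).
  exact: mulrC.
by apply: sma_sum => k; exact: sma_mul.
Qed.

(** Whitney's condition: the second derivative in a kernel direction [k] and any
    direction [v] of [S] is never tangent to the image. For maps from dimension m
    to dimension 2 m - 1 and [S] the whole space, it characterizes the cross-caps
    among the germs of corank one. *)
Definition whitney n d (g : 'rV[R]_n -> 'rV[R]_d) x m (S : 'M[R]_(m, n)) :=
  forall k v : 'rV[R]_n, k != 0 -> v != 0 -> k *m jac g x = 0 -> (v <= S)%MS ->
  ~~ (k *m djac g x v <= jac g x)%MS.

(** The second derivatives of the target change are multiplied by [k *m jac g' x],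
    which is 0. *)
Lemma whitney_target n d (g' : 'rV[R]_n -> 'rV[R]_d) (eta : 'rV[R]_d -> 'rV[R]_d) x m (S : 'M[R]_(m, n)) :
  smva x g' -> smva (g' x) eta -> jac eta (g' x) \in unitmx ->
  whitney (fun z => eta (g' z)) x S <-> whitney g' x S.
Proof.
move=> sg se ue; rewrite /whitney jac_comp //; set E := jac eta _ in ue *.
have fE : row_free E by rewrite row_free_unit.
have K k : (k *m (jac g' x *m E) = 0) <-> (k *m jac g' x = 0).
  rewrite mulmxA; split => [|->]; last by rewrite mul0mx.
  by move=> /(canRL (mulmxK ue)); rewrite mul0mx.
have D k v : k *m jac g' x = 0 ->
    (k *m djac (fun z => eta (g' z)) x v <= jac g' x *m E)%MS = (k *m djac g' x v <= jac g' x)%MS.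
  by move=> k0; rewrite djac_comp // mulmxDr !mulmxA k0 mul0mx addr0 submxMfree.
split => W k v k0 v0 kJ vS.
  by rewrite -D //; apply: W => //; apply/K.
by move/K in kJ; rewrite D //; exact: W.
Qed.

(** The second derivatives of the source change contribute vectors of the image. *)
Lemma whitney_source n d (g' : 'rV[R]_n -> 'rV[R]_d) (th : 'rV[R]_n -> 'rV[R]_n) x :
  smva x th -> smva (th x) g' -> jac th x \in unitmx ->
  whitney (fun z => g' (th z)) x 1%:M <-> whitney g' (th x) 1%:M.
Proof.
move=> st sg ut; rewrite /whitney jac_comp //; set T := jac th x in ut *.
set J := jac g' _.
have TJ : (T *m J :=: J)%MS by apply: eqmxMfull; rewrite row_full_unit.
have D k v : (k *m djac (fun z => g' (th z)) x v <= J)%MS =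
    (k *m T *m djac g' (th x) (v *m T) <= J)%MS.
  rewrite djac_comp // mulmxDr addrC !mulmxA -/T -/J.
  set A := _ *m djac g' _ _; set B := _ *m J.
  have BJ : (B <= J)%MS by exact: submxMl.
  apply/idP/idP => [H|H]; last exact: addmx_sub.
  by rewrite -(addrK B A) addmx_sub // -scaleN1r scalemx_sub.
have nz (k : 'rV[R]_n) : (k *m T != 0) = (k != 0).
  congr negb; apply/eqP/eqP => [|->]; last by rewrite mul0mx.
  by move=> /(canRL (mulmxK ut)); rewrite mul0mx.
split => W k v k0 v0 kJ _; last first.
  by rewrite TJ D; apply: W; rewrite ?nz ?submx1 // -mulmxA.
have kE : k = k *m invmx T *m T by rewrite mulmxKV.
have vE : v = v *m invmx T *m T by rewrite mulmxKV.
rewrite kE vE -D -TJ; apply: W; rewrite ?submx1 //.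
- by rewrite -nz mulmxKV.
- by rewrite -nz mulmxKV.
- by rewrite mulmxA mulmxKV.
Qed.

Lemma whitney_near n d (g g' : 'rV[R]_n -> 'rV[R]_d) x m (S : 'M[R]_(m, n)) : (\near x, g x = g' x) ->
  whitney g x S -> whitney g' x S.
Proof.
move=> gg W k v k0 v0; rewrite -(jac_near gg) -(djac_near v gg); exact: W.
Qed.

(** * Restriction to the zero set of a submersion *)

Lemma smva_row_mx n a b (h : 'rV[R]_n -> 'rV[R]_a) (f : 'rV[R]_n -> 'rV[R]_b) x :
  smva x h -> smva x f -> smva x (fun z => row_mx (h z) (f z)).
Proof.
move=> sh sf j; have [k jk|k jk] := splitP j.
  rewrite (_ : j = lshift b k); last exact: val_inj.
  by apply: sma_ext (sh k); apply: near_all => z; rewrite row_mxEl.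
rewrite (_ : j = rshift a k); last exact: val_inj.
by apply: sma_ext (sf k); apply: near_all => z; rewrite row_mxEr.
Qed.

Lemma jac_row_mx n a b (h : 'rV[R]_n -> 'rV[R]_a) (f : 'rV[R]_n -> 'rV[R]_b) x :
  jac (fun z => row_mx (h z) (f z)) x = row_mx (jac h x) (jac f x).
Proof.
apply/matrixP => i j; rewrite !mxE; case: splitP => k jk; rewrite mxE.
  by congr (pd i _ x); apply/funext => z; rewrite (_ : j = lshift b k) ?row_mxEl //; exact: val_inj.
by congr (pd i _ x); apply/funext => z; rewrite (_ : j = rshift a k) ?row_mxEr //; exact: val_inj.
Qed.

Lemma djac_row_mx n a b (h : 'rV[R]_n -> 'rV[R]_a) (f : 'rV[R]_n -> 'rV[R]_b) x v :
  djac (fun z => row_mx (h z) (f z)) x v = row_mx (djac h x v) (djac f x v).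
Proof.
apply/matrixP => i j; rewrite !mxE; case: splitP => k jk; rewrite mxE.
  congr (grad_form (pd i _) x v); apply/funext => z.
  by rewrite (_ : j = lshift b k) ?row_mxEl //; exact: val_inj.
congr (grad_form (pd i _) x v); apply/funext => z.
by rewrite (_ : j = rshift a k) ?row_mxEr //; exact: val_inj.
Qed.

Lemma pd_cst n (c : R) i (x : 'rV[R]_n) : pd i (fun=> c) x = 0.
Proof. by rewrite /pd; case: (is_derive_cst c x (delta_mx 0 i)). Qed.

Lemma jac_cst n d (c : 'rV[R]_d) (x : 'rV[R]_n) : jac (fun=> c) x = 0.
Proof. by apply/matrixP => i j; rewrite !mxE pd_cst. Qed.

Lemma djac_cst n d (c : 'rV[R]_d) (x : 'rV[R]_n) v : djac (fun=> c) x v = 0.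
Proof.
apply/matrixP => i j; rewrite !mxE /grad_form big1 // => k _.
rewrite (_ : pd i _ = fun=> 0) ?pd_cst ?mulr0 //.
by apply/funext => z; rewrite pd_cst.
Qed.

Section Chart.
Variables (m n a b : nat) (h : 'rV[R]_n -> 'rV[R]_a) (f : 'rV[R]_n -> 'rV[R]_b).
Variables (phi : 'rV[R]_m -> 'rV[R]_n) (p : 'rV[R]_n).
Hypotheses (sphi : smva 0 phi) (phi0 : phi 0 = p) (sh : smva p h) (sf : smva p f).
Hypothesis hphi : \forall u \near (0 : 'rV[R]_m), h (phi u) = 0.
Hypothesis phiT : (jac phi 0 :=: kermx (jac h p))%MS.
Hypothesis phi_free : row_free (jac phi 0).

Let F z := row_mx (h z) (f z).

Let sF : smva p F.
Proof.
exact: smva_row_mx.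
Qed.

Lemma chart_row_mx : \forall u \near (0 : 'rV[R]_m), F (phi u) = row_mx 0 (f (phi u)).
Proof. by apply: filterS hphi => u hu; rewrite /F hu. Qed.

Lemma chart_jac : jac phi 0 *m jac F p = row_mx 0 (jac (fun u => f (phi u)) 0).
Proof.
rewrite -phi0 -jac_comp ?phi0 //.
by rewrite (jac_near chart_row_mx) jac_row_mx jac_cst.
Qed.

Lemma chart_djac v : djac phi 0 v *m jac F p + jac phi 0 *m djac F p (v *m jac phi 0) =
  row_mx 0 (djac (fun u => f (phi u)) 0 v).
Proof.
rewrite -phi0 -djac_comp ?phi0 //.
by rewrite (djac_near v chart_row_mx) djac_row_mx djac_cst.
Qed.

Lemma tangentP (w : 'rV[R]_n) : w *m jac h p = 0 -> exists w', w = w' *m jac phi 0.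
Proof. by move=> wh; apply/submxP; rewrite phiT; exact/sub_kermxP. Qed.

(** Since [h] vanishes along [phi], the Jacobian of the pair (h, f) composed with
    [phi] is that of [f \o phi] preceded by zeros. The curvature of [phi] contributes
    vectors of the image, and a vector of the image with zero [h] part comes from a
    tangent vector. *)
Lemma whitney_chart : whitney (fun u => f (phi u)) 0 1%:M <-> whitney F p (kermx (jac h p)).
Proof.
set A := jac phi 0; set g := fun u => f (phi u); set JF := jac F p.
have JFE : JF = row_mx (jac h p) (jac f p) by exact: jac_row_mx.
have nzA (k : 'rV[R]_m) : (k *m A != 0) = (k != 0).
  congr negb; apply/eqP/eqP => [kA|->]; last by rewrite mul0mx.
  by apply: (row_free_inj phi_free); rewrite kA mul0mx.
have kerE (k : 'rV[R]_m) : (k *m A *m JF = 0) <-> (k *m jac g 0 = 0).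
  rewrite -mulmxA chart_jac mul_mx_row mulmx0 -/g; split=> [|->]; last by rewrite row_mx0.
  by rewrite -[RHS](@row_mx0 _ 1 a b) => /eq_row_mx[].
have memE (k v : 'rV[R]_m) : (k *m A *m djac F p (v *m A) <= JF)%MS = (k *m djac g 0 v <= jac g 0)%MS.
  have E : k *m djac phi 0 v *m JF + k *m A *m djac F p (v *m A) = row_mx 0 (k *m djac g 0 v).
    by rewrite -!mulmxA -mulmxDr chart_djac mul_mx_row mulmx0.
  apply/idP/idP => /submxP[w wE].
    have : row_mx 0 (k *m djac g 0 v) = (k *m djac phi 0 v + w) *m JF.
      by rewrite -E wE mulmxDl.
    rewrite JFE mul_mx_row => /eq_row_mx[/esym/tangentP[w' w'E] E2].
    rewrite E2 w'E -/A -mulmxA.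
    have : A *m JF = row_mx 0 (jac g 0) by exact: chart_jac.
    by rewrite JFE mul_mx_row => /eq_row_mx[_ ->]; exact: submxMl.
  have -> : k *m A *m djac F p (v *m A) = (w *m A - k *m djac phi 0 v) *m JF.
    rewrite mulmxBl -(mulmxA w) chart_jac mul_mx_row mulmx0 -wE -E.
    by rewrite [X in X - _]addrC addrK.
  exact: submxMl.
split=> W k v k0 v0 kJ vS.
  have kh : k *m jac h p = 0.
    by move: kJ; rewrite -/JF JFE mul_mx_row -[RHS](@row_mx0 _ 1 a b) => /eq_row_mx[].
  have [k' kE] := tangentP kh; have [v' vE] := tangentP (sub_kermxP vS).
  rewrite kE vE memE; apply: W; rewrite ?submx1 // -?nzA ?kE ?vE //.
  - by rewrite /A -kE.
  - by rewrite /A -vE.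
  - by apply/kerE; rewrite /A -kE.
rewrite -memE; apply: W; rewrite ?nzA //; first by apply/kerE.
by rewrite -phiT; exact: submxMl.
Qed.

Lemma chart_rank : \rank (jac (fun u => f (phi u)) 0) + \rank (jac h p) = \rank (jac F p).
Proof.
have E := mxrank_mul_ker (jac phi 0) (jac F p).
rewrite chart_jac rank_row_0mx in E.
have : \rank (jac phi 0 :&: kermx (jac F p))%MS = \rank (kermx (jac F p)).
  apply: eqmx_rank; apply/andP; rewrite capmxSr sub_capmx submx_refl andbT; split=> //.
  rewrite phiT; apply/rV_subP => w /sub_kermxP; rewrite /F jac_row_mx mul_mx_row.
  by rewrite -[RHS](@row_mx0 _ 1 a b) => /eq_row_mx[wh _]; exact/sub_kermxP.
move=> K; rewrite K mxrank_ker phiT mxrank_ker in E.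
have := rank_leq_row (jac F p); have := rank_leq_row (jac h p).
by lia.
Qed.

End Chart.

End SecondOrder.

(** * Maximal minors and regular zeros *)

Section Minors.
Variable R : realType.

(** The rows selected by a minor may come in any order when independent columns are
    extracted; listing them increasingly does not change the space they span. *)
Lemma minors_free n N (M : 'M[R]_(n, N)) :
  row_free M <-> exists k : 'I_#|row_choices N n|, \det (colsub (tnth (enum_val k)) M) != 0.
Proof.
split=> [Mfree|[k Dk]]; last first.
  have uM : colsub (tnth (enum_val k)) M \in unitmx by rewrite unitmxE unitfE.
  rewrite -row_leq_rank.
  have {1}-> : n = \rank (colsub (tnth (enum_val k)) M) by rewrite mxrank_unit.
  rewrite (_ : colsub _ M = M *m colsub (tnth (enum_val k)) 1%:M) ?mxrankM_maxl //.
  by rewrite mulmx_colsub mulmx1.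
have rkM : row_full M^T by rewrite /row_full mxrank_tr.
pose f := fullrankfun rkM.
pose A := [set f i | i in 'I_n]%SET.
have cA : #|A| = n by rewrite card_imset ?card_ord //; exact: fullrankfun_inj.
have sA : size (enum A) == n by rewrite -cardE cA.
pose t : n.-tuple 'I_N := Tuple sA.
have tC : t \in row_choices N n.
  rewrite inE /= {1}/enum_mem -enumT; apply: (subseq_sorted ltn_trans _ (iota_ltn_sorted 0 N)).
  by rewrite -val_enum_ord map_subseq // filter_subseq.
exists (enum_rank_in tC t); rewrite enum_rankK_in //.
rewrite -unitfE -unitmxE -unitmx_tr trmx_mxsub -row_full_unit -sub1mx.
have : row_full (rowsub f M^T) by exact: fullrowsub_full.
rewrite -sub1mx => H; apply: submx_trans H _.
apply/row_subP => i; rewrite row_rowsub.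
have : f i \in t by rewrite mem_enum; apply: imset_f.
case/tnthP => j ->; rewrite -(row_rowsub (tnth t) M^T j).
exact: row_sub.
Qed.

(** Cramer's rule with row [i] replaced by the combination [k] of all rows. *)
Lemma det_combine_rows n (B : 'M[R]_n) (k : 'rV[R]_n) i :
  k 0 i * \det B = \sum_b (k *m B) 0 b * cofactor B i b.
Proof.
pose P : 'M[R]_n := \matrix_(a, c) if a == i then k 0 c else (a == c)%:R.
have dP : \det P = k 0 i.
  rewrite (expand_det_col P i) (bigD1 i) //= big1 => [|a ai].
    rewrite addr0 mxE eqxx /cofactor.
    rewrite (_ : row' i _ = 1%:M) ?det1; last first.
      by apply/matrixP => a b; rewrite !mxE -[lift i a == i]eq_sym (negPf (neq_lift _ _)) (inj_eq lift_inj).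
    by rewrite -signr_odd oddD addbb mulr1 mulr1.
  by rewrite mxE (negPf ai) mul0r.
rewrite -dP -det_mulmx (expand_det_row _ i).
apply: eq_bigr => b _; congr (_ * _).
  by rewrite !mxE; apply: eq_bigr => c _; rewrite mxE eqxx.
rewrite /cofactor; congr (_ * \det _); apply/matrixP => a c; rewrite !mxE.
rewrite (bigD1 (lift i a)) //= big1 => [|e ea]; rewrite mxE eq_sym (negPf (neq_lift _ _)).
  by rewrite eqxx mul1r addr0.
by rewrite eq_sym (negPf ea) mul0r.
Qed.

(** Along a relation [k *m B x = 0], differentiating [k 0 i * \det B] only
    touches the row that the relation annihilates. *)
Lemma det_derive d n (B : 'rV[R]_d -> 'M[R]_n) x w (k : 'rV[R]_n) (u : 'rV[R]_n) i :
  (forall a b, sma x (fun z => B z a b)) -> k *m B x = 0 ->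
  (forall b, grad_form (fun z => (k *m B z) 0 b) x w = u 0 b) ->
  k 0 i * grad_form (fun z => \det (B z)) x w =
  \det (B x + delta_mx i 0 *m (u - row i (B x))).
Proof.
move=> sB kB du.
have sc b : sma x (fun z => cofactor (B z) i b).
  apply: sma_mul; first exact: sma_cst.
  by apply: sma_det => a c; apply: sma_ext (sB (lift i a) (lift b c)); apply: near_all => z; rewrite !mxE.
have sk b : sma x (fun z => (k *m B z) 0 b).
  have := @sma_sum R d x _ (index_enum 'I_n) predT (fun c z => k 0 c * B z c b).
  move=> /(_ _)/sma_ext; apply; last by move=> c; exact: sma_mul (sma_cst _ _) (sB c b).
  by apply: near_all => z; rewrite mxE.
have sdet : sma x (fun z => \det (B z)) by exact: sma_det.
have dl := is_derive_mul (is_derive_cst (k 0 i) x w) (sma_derive_dir w sdet).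
have dr := is_derive_bigsum (fun b => is_derive_mul (sma_derive_dir w (sk b)) (sma_derive_dir w (sc b))).
have E : \forall z \near x, cst (k 0 i) z * \det (B z) = \sum_b (k *m B z) 0 b * cofactor (B z) i b.
  by apply: near_all => z; exact: det_combine_rows.
case: dr => _ e1; case: (near_eq_is_derive E dl) => _ e2.
move: (etrans (esym e2) e1); rewrite mulr0 addr0 => ->.
rewrite (expand_det_row _ i); apply: eq_bigr => b _.
rewrite kB mxE mul0r add0r du mulrC; congr (_ * _).
  by rewrite !mxE big_ord1 !mxE !eqxx mul1r addrC subrK.
rewrite /cofactor; congr (_ * \det _); apply/matrixP => a c; rewrite !mxE big_ord1 !mxE.
by rewrite eq_sym (negPf (neq_lift _ _)) mul0r addr0.
Qed.

Lemma kernel_line n N (J : 'M[R]_(n, N)) (k : 'rV[R]_n) :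
  k != 0 -> k *m J = 0 -> (\rank J).+1 = n ->
  forall c, c *m J = 0 -> exists e, c = e *: k.
Proof.
move=> k0 kJ rJ c cJ; apply/sub_rVP.
have kk : (k <= kermx J)%MS by apply/sub_kermxP.
have ck : (c <= kermx J)%MS by apply/sub_kermxP.
have r1 : \rank (kermx J) = 1%N by rewrite mxrank_ker -{1}rJ subSnn.
apply: submx_trans ck _; rewrite -(geq_leqif (mxrank_leqif_sup kk)) r1.
by rewrite rank_rV k0.
Qed.

Lemma free_row_update n N (J : 'M[R]_(n, N)) (k : 'rV[R]_n) (u : 'rV[R]_N) i :
  k 0 i != 0 -> k *m J = 0 -> (\rank J).+1 = n ->
  row_free (J + delta_mx i 0 *m (u - row i J)) = ~~ (u <= J)%MS.
Proof.
move=> ki kJ rJ; apply/idP/idP.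
  apply: contraL => uJ; rewrite -row_leq_rank -ltnNge -[X in (_ < X)%N]rJ ltnS.
  apply: mxrankS; rewrite addmx_sub // (submx_trans (submxMl _ _)) // addmx_sub //.
  by rewrite -scaleN1r scalemx_sub // row_sub.
move=> uJ; apply/inj_row_free => c; rewrite mulmxDr mulmxA.
have -> : c *m delta_mx i 0 = (c 0 i)%:M :> 'M[R]_1.
  by rewrite -colE; apply/matrixP => a b; rewrite !mxE !ord1.
rewrite mul_scalar_mx => cE.
have [ci|ci] := eqVneq (c 0 i) 0; last first.
  case/negP: uJ.
  have -> : u = row i J - (c 0 i)^-1 *: c *m J.
    move/(congr1 (fun z => (c 0 i)^-1 *: z)): cE.
    rewrite scaler0 scalerDr scalerA mulVf // scale1r addrC => /eqP.
    by rewrite addr_eq0 subr_eq -scalemxAl addrC => /eqP.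
  by rewrite addmx_sub ?row_sub // -scaleN1r scalemx_sub // submxMl.
move: cE; rewrite ci scale0r addr0 => cJ.
have kn0 : k != 0 by apply: contraNneq ki => ->; rewrite mxE.
have [e eE] := kernel_line kn0 kJ rJ cJ; move: ci; rewrite eE mxE => /eqP.
by rewrite mulf_eq0 (negPf ki) orbF => /eqP ->; rewrite scale0r.
Qed.

Lemma smva_Jac_near n N (F : 'rV[R]_n -> 'rV[R]_N) p : smva p F ->
  \forall z \near p, Jac F z = (jac F z)^T.
Proof. by move=> /smva_near; apply: filterS => z /Jac_jac. Qed.

Lemma max_minors_near n N (F : 'rV[R]_n -> 'rV[R]_N) p k : smva p F ->
  \forall z \near p, max_minors F z 0 k = \det (colsub (tnth (enum_val k)) (jac F z)).
Proof.
move=> /smva_Jac_near; apply: filterS => z zE.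
by rewrite mxE zE -trmx_mxsub det_tr.
Qed.

Lemma smva_max_minors n N (F : 'rV[R]_n -> 'rV[R]_N) p : smva p F -> smva p (max_minors F).
Proof.
move=> sF k.
have H : sma p (fun z => \det (colsub (tnth (enum_val k)) (jac F z))).
  apply: sma_det => i j.
  apply: sma_ext (sma_pd i (sF (tnth (enum_val k) j))).
  by apply: near_all => z; rewrite !mxE.
by apply: sma_ext H; apply: filterS (max_minors_near k sF) => z.
Qed.

Lemma max_minors_eq0 n N (F : 'rV[R]_n -> 'rV[R]_N) p : smva p F ->
  max_minors F p = 0 <-> ~~ row_free (jac F p).
Proof.
move=> sF.
have E k : max_minors F p 0 k = \det (colsub (tnth (enum_val k)) (jac F p)).
  by have /nbhs_singleton := max_minors_near k sF.
split=> [m0|nf].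
  apply/negP => /minors_free[k]; rewrite -E m0 mxE eqxx //.
apply/rowP => k; rewrite E mxE; apply/eqP; apply: contraNT nf => Dk.
by apply/minors_free; exists k.
Qed.

(** Up to the factor [k 0 i], the derivatives of the minors in the direction [w] are
    the minors of the Jacobian whose row [i] is replaced by the second derivative
    in the directions [k] and [w]. *)
Lemma max_minors_derive n N (F : 'rV[R]_n -> 'rV[R]_N) p (k w : 'rV[R]_n) :
  smva p F -> k != 0 -> k *m jac F p = 0 -> (\rank (jac F p)).+1 = n ->
  (w *m jac (max_minors F) p != 0) = ~~ (k *m djac F p w <= jac F p)%MS.
Proof.
move=> sF k0 kJ rJ; have /rV0Pn[i ki] := k0.
set J := jac F p in kJ rJ *; set u := k *m djac F p w.
rewrite -(free_row_update u ki kJ rJ).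
set M := J + _.
have key (I : 'I_#|row_choices N n|) : k 0 i * (w *m jac (max_minors F) p) 0 I =
    \det (colsub (tnth (enum_val I)) M).
  rewrite -grad_form_jac (grad_form_near w (max_minors_near I sF)).
  set t := tnth (enum_val I).
  have sB a b : sma p (fun z => colsub t (jac F z) a b).
    by apply: sma_ext (sma_pd a (sF (t b))); apply: near_all => z; rewrite !mxE.
  rewrite (det_derive (k := k) (u := colsub t u) i sB).
  - congr (\det _); apply/matrixP => a b; rewrite !mxE; congr (_ + _).
    by apply: eq_bigr => c _; rewrite !mxE.
  - by rewrite mulmx_colsub kJ; apply/matrixP => a b; rewrite !mxE.
  move=> b; rewrite /u /djac !mxE.
  have E : \forall z \near p, \sum_c k 0 c * pd c (fun y => F y 0 (t b)) z = (k *m colsub t (jac F z)) 0 b.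
    by apply: near_all => z; rewrite mxE; apply: eq_bigr => c _; rewrite !mxE.
  rewrite -(grad_form_near w E).
  have sP c : sma p (pd c (fun y => F y 0 (t b))) by exact: sma_pd.
  rewrite (grad_formE _ (is_derive_bigsum (fun c => is_derive_mul (is_derive_cst (k 0 c) p w) (sma_derive_dir w (sP c))))).
    by apply: eq_bigr => c _; rewrite mulr0 addr0 mxE.
  by apply: sma_sum => c; exact: sma_mul (sma_cst _ _) (sP c).
apply/idP/idP => [w0|/minors_free[I]].
  apply/minors_free; have /rV0Pn[I wI] := w0.
  by exists I; rewrite -key mulf_neq0.
by rewrite -key mulf_eq0 (negPf ki) /= => H; apply: contraNneq H => ->; rewrite mxE.
Qed.

Lemma minors_whitney m n N (F : 'rV[R]_n -> 'rV[R]_N) p (A : 'M[R]_(m, n)) :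
  smva p F -> (\rank (jac F p)).+1 = n -> row_free A ->
  row_free (A *m jac (max_minors F) p) <-> whitney F p A.
Proof.
move=> sF rJ Af; split=> [Mf k v k0 v0 kJ /submxP[v' vE]|W].
  rewrite -(max_minors_derive v sF k0 kJ rJ) vE -mulmxA; apply: contra_neq v0.
  by move=> E; rewrite vE; rewrite (row_free_inj Mf (_ : v' *m _ = 0 *m _)) ?mul0mx.
apply/inj_row_free => v; rewrite mulmxA => vE; apply/eqP/negPn/negP => v0.
have : kermx (jac F p) != 0 by rewrite kermx_eq0 -row_leq_rank -ltnNge -[X in (_ < X)%N]rJ.
case/rowV0Pn => k /sub_kermxP kJ k0.
have vA0 : v *m A != 0.
  by apply: contra_neq v0 => E; apply: (row_free_inj Af); rewrite E mul0mx.
have := W _ _ k0 vA0 kJ (submxMl v A).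
by rewrite -(max_minors_derive _ sF k0 kJ rJ) vE eqxx.
Qed.

Lemma whitney_eqmx n d (g : 'rV[R]_n -> 'rV[R]_d) x m m' (S : 'M[R]_(m, n)) (S' : 'M[R]_(m', n)) :
  (S :=: S')%MS -> whitney g x S <-> whitney g x S'.
Proof. by move=> E; split=> W k v k0 v0 kJ vS; apply: W; rewrite // ?E // -E. Qed.

End Minors.

(** * Coordinate systems on the zero set *)

Section Coordinates.
Variable R : realType.

Lemma smf_local n (U : set 'rV[R]_n) (a : 'rV[R]_n -> R) : open U ->
  (forall x, U x -> sma x a) -> smf U a.
Proof.
move=> oU sa k; elim: k a sa => [|k IH] a sa.
  by split=> // x Ux; exact: sma_continuous (sa x Ux).
apply: (ckdS_intro oU) => [x Ux|i]; first exact: sma_continuous (sa x Ux).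
exists (pd i a); split => [x Ux|]; first exact: sma_derive (sa x Ux).
by apply: IH => x Ux; exact: sma_pd (sa x Ux).
Qed.

Lemma smooth_on_local n d (U : set 'rV[R]_n) (f : 'rV[R]_n -> 'rV[R]_d) : open U ->
  (forall x, U x -> smva x f) -> smooth_on U f.
Proof. by move=> oU sf; apply/smooth_onP => // j; apply: (smf_local oU) => x /sf. Qed.

Lemma smva_mulmx n d e x (f : 'rV[R]_n -> 'rV[R]_d) (A : 'M[R]_(d, e)) : smva x f ->
  smva x (fun z => f z *m A).
Proof.
move=> sf j; apply: (sma_ext (a := fun z => \sum_k f z 0 k * A k j)).
  by apply: near_all => z; rewrite mxE.
by apply: sma_sum => k; exact: sma_mul (sf k) (sma_cst _ _).
Qed.

Lemma smva_add n d x (f g : 'rV[R]_n -> 'rV[R]_d) : smva x f -> smva x g ->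
  smva x (fun z => f z + g z).
Proof.
move=> sf sg j; apply: sma_ext (sma_add (sf j) (sg j)).
by apply: near_all => z; rewrite mxE.
Qed.

Lemma smva_cst n d (x : 'rV[R]_n) (c : 'rV[R]_d) : smva x (fun=> c).
Proof. by move=> j; exact: sma_cst. Qed.

Lemma smva_id n (x : 'rV[R]_n) : smva x (fun z => z).
Proof. by move=> j; exact: sma_coord. Qed.

Lemma smva_affine n d x (p : 'rV[R]_n) (A : 'M[R]_(n, d)) : smva x (fun z => (z - p) *m A).
Proof. by apply: smva_mulmx; exact: smva_add (smva_id x) (smva_cst x (- p)). Qed.

Lemma jac_mulmx n d e x (f : 'rV[R]_n -> 'rV[R]_d) (A : 'M[R]_(d, e)) : smva x f ->
  jac (fun z => f z *m A) x = jac f x *m A.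
Proof.
move=> sf; apply/matrixP => i j; rewrite [LHS]mxE.
have dl := sma_derive i (smva_mulmx A sf j).
have dr := is_derive_bigsum (fun k => is_derive_mul (sma_derive i (sf k)) (is_derive_cst (A k j) x (delta_mx 0 i))).
have E : \forall z \near x, \sum_k f z 0 k * cst (A k j) z = (f z *m A) 0 j.
  by apply: near_all => z; rewrite mxE.
case: dl => _ <-; case: (near_eq_is_derive E dr) => _ ->.
by rewrite mxE; apply: eq_bigr => k _; rewrite mulr0 add0r mulrC mxE.
Qed.

Lemma jac_add n d x (f g : 'rV[R]_n -> 'rV[R]_d) : smva x f -> smva x g ->
  jac (fun z => f z + g z) x = jac f x + jac g x.
Proof.
move=> sf sg; apply/matrixP => i j; rewrite [LHS]mxE.
have E : \forall z \near x, f z 0 j + g z 0 j = (f z + g z) 0 j.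
  by apply: near_all => z; rewrite mxE.
have dr := is_derive_add (sma_derive i (sf j)) (sma_derive i (sg j)).
case: (near_eq_is_derive E dr) => _; rewrite /pd => ->.
by rewrite !mxE.
Qed.

Lemma jac_affine n d x (p : 'rV[R]_n) (A : 'M[R]_(n, d)) : jac (fun z => (z - p) *m A) x = A.
Proof.
rewrite jac_mulmx; last exact: smva_add (smva_id x) (smva_cst x (- p)).
by rewrite (jac_add (smva_id x) (smva_cst x (- p))) jac_cst addr0 jac_id mul1mx.
Qed.

Lemma complete_rows n a b (B : 'M[R]_(b, n)) : row_free B -> n = (a + b)%N ->
  exists A : 'M[R]_(a, n), row_full (B + A)%MS.
Proof.
move=> /eqP rB nE.
have rC : \rank (B^C)%MS = a by rewrite mxrank_compl rB nE addnK.
exists (castmx (rC, erefl) (row_base B^C)%MS).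
have E : (castmx (rC, erefl) (row_base B^C) :=: B^C)%MS.
  exact: eqmx_trans (eqmx_cast _ _) (eq_row_base _).
rewrite -sub1mx (adds_eqmx (eqmx_refl B) E) sub1mx; exact: addsmx_compl_full.
Qed.

Section ZeroSet.
Variables (m l : nat) (h : 'rV[R]_(m + l) -> 'rV[R]_l) (p : 'rV[R]_(m + l)).
Hypotheses (sh : smooth h) (hp : h p = 0) (rh : \rank (jac h p) = l).

Let Z := h @^-1` [set 0].

(** The tangent space is contained in the kernel of the differential of [h], and the
    dimensions agree. *)
Lemma coord_system_germ U phi : coord_system Z p U phi ->
  [/\ smva 0 phi, phi 0 = p, \forall u \near (0 : 'rV[R]_m), h (phi u) = 0,
      row_free (jac phi 0) & (jac phi 0 :=: kermx (jac h p))%MS].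
Proof.
case=> oU U0 phi0 sphi [W [psi [oW spsi img inv]]].
have sphi0 := smva_smooth_on oU sphi U0.
have hphi : \forall u \near (0 : 'rV[R]_m), h (phi u) = 0.
  apply: filterS (open_near oU U0) => u Uu.
  by have [] : (Z `&` W) (phi u) by rewrite -img; exists u.
have Wp : W p by have [] : (Z `&` W) p by rewrite -img -phi0; exists 0.
have J1 : jac phi 0 *m jac psi p = 1%:M.
  have sp : smva (phi 0) psi by rewrite phi0; exact: smva_smooth_on oW spsi Wp.
  rewrite -phi0 -jac_comp // -(jac_id (0 : 'rV[R]_m)); apply: jac_near.
  by apply: filterS (open_near oU U0) => u /inv.
have F : row_free (jac phi 0) by apply/row_freeP; exists (jac psi p).
split => //.
have J0 : jac phi 0 *m jac h p = 0.
  have sp : smva (phi 0) h by exact: smva_smooth.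
  by rewrite -phi0 -jac_comp // (jac_near hphi) jac_cst.
have sub : (jac phi 0 <= kermx (jac h p))%MS by apply/sub_kermxP.
apply/eqmxP; rewrite -(geq_leqif (mxrank_leqif_eq sub)) mxrank_ker rh (eqP F).
by rewrite addnK.
Qed.

(** Implicit function theorem: completing the differential of [h] by linear forms
    gives a local diffeomorphism [Phi] whose last coordinates are [h], and the zero
    set is parametrized by the other ones. *)
Lemma coord_system_exists : exists U phi, coord_system (m := m) Z p U phi.
Proof.
have fh : row_free (jac h p)^T by rewrite /row_free mxrank_tr rh.
have [A0 fA] := complete_rows fh (erefl (m + l)%N).
pose A := A0^T; pose Phi x := row_mx ((x - p) *m A) (h x).
have sPhi x : smva x Phi.
  by apply: smva_row_mx; [exact: smva_affine | exact: smva_smooth].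
have Phip : Phi p = 0 by rewrite /Phi subrr mul0mx hp row_mx0.
have uPhi : jac Phi p \in unitmx.
  rewrite jac_row_mx jac_affine -unitmx_tr tr_row_mx trmxK.
  by rewrite -row_full_unit -sub1mx -addsmxE addsmxC sub1mx.
have [Psi [sPsi Psip PsiK PhiK]] := inverse_germ (sPhi p) uPhi.
have [V [W [oV Vp oW [sV sW img inv]]]] := inverse_germs_open (sPhi p) sPsi Psip PsiK PhiK.
pose e (u : 'rV[R]_m) : 'rV[R]_(m + l) := row_mx u 0.
have se u : smva u e by apply: smva_row_mx; [exact: smva_id | exact: smva_cst].
have oU : open [set u | W (e u)].
  rewrite -[X in open X]setTI.
  exact: open_setI_preim openT oW (fun u _ => smva_continuous (se u)).
have e0 : e 0 = Phi p by rewrite Phip /e row_mx0.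
have eP x : V x -> h x = 0 -> Phi x = e ((x - p) *m A) by rewrite /Phi /e => _ ->.
have key u : W (e u) -> [/\ V (Psi (e u)), h (Psi (e u)) = 0 & (Psi (e u) - p) *m A = u].
  rewrite -{1}img => -[x Vx xE]; rewrite -xE inv //.
  by move: xE; rewrite /Phi /e => /eq_row_mx[].
exists [set u | W (e u)], (fun u => Psi (e u)); split => //.
- by rewrite /= e0 -img; exists p.
- by rewrite e0 inv.
- apply: smooth_on_local => // u Wu; apply: smva_comp => // j.
  by exists W.
exists V, (fun x => (x - p) *m A); split => //.
- by apply: smooth_on_local => // x _; exact: smva_affine.
- apply/seteqP; split => [x [u /key[Vu hu _] <-] //|x [hx Vx]].
  have E := eP x Vx hx.
  by exists ((x - p) *m A); rewrite /= -E -?img ?inv //; exists x.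
by move=> u /key[].
Qed.

End ZeroSet.

(** The new chart is restricted to the image of an open set on which [th] and its
    inverse germ are mutually inverse; its coordinates are [th \o psi]. *)
Lemma coord_system_change m n (M : set 'rV[R]_n) p (U : set 'rV[R]_m) phi (th : 'rV[R]_m -> 'rV[R]_m) :
  coord_system M p U phi -> smva 0 th -> th 0 = 0 -> jac th 0 \in unitmx ->
  exists U' rho, [/\ coord_system M p U' (fun u => phi (rho u)),
    smva 0 rho, rho 0 = 0 & \forall u \near (0 : 'rV[R]_m), th (rho u) = u].
Proof.
case=> oU U0 phi0 sphi [W [psi [oW spsi img inv]]] sth th0 uth.
have [rho [srho rho0 rhoK thK]] := inverse_germ sth uth.
have [U1 [W1 [oU1 U10 oW1 [sU1 sW1 img1 inv1]]]] := inverse_germs_open sth srho rho0 rhoK thK.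
rewrite th0 in srho rho0 thK.
have sv u : W1 u -> smva u rho by move=> Wu j; exists W1.
have st u : U1 u -> smva u th by move=> Uu j; exists U1.
have oU' : open (W1 `&` rho @^-1` U).
  by apply: open_setI_preim => // x /sv; exact: smva_continuous.
exists (W1 `&` rho @^-1` U), rho; split=> //.
have W10 : W1 0 by rewrite -img1 -th0; exists 0.
have sps x : W x -> smva x psi by exact: smva_smooth_on.
split => //.
- by split => //; rewrite /preimage /= rho0.
- by rewrite rho0.
- apply: smooth_on_local => // u [Wu Uu]; apply: smva_comp; first exact: sv.
  exact: smva_smooth_on oU sphi Uu.
have oW' : open (W `&` psi @^-1` U1).
  by apply: open_setI_preim => // x /sps; exact: smva_continuous.
exists (W `&` psi @^-1` U1), (fun x => th (psi x)).
have key u : W1 u -> U1 (rho u) /\ th (rho u) = u.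
  by rewrite -{1}img1 => -[x Ux <-]; rewrite inv1.
split => //.
- by apply: smooth_on_local => // x [Wx Ux]; apply: smva_comp; [exact: sps | exact: st].
- apply/seteqP; split => [x [u [/key[U1u _] Uu] <-]|x [Mx [Wx U1x]]].
    have [MU WU] : (M `&` W) (phi (rho u)) by rewrite -img; exists (rho u).
    by split => //; split => //; rewrite /preimage /= inv.
  have [v Uv vx] : (phi @` U) x by rewrite img.
  have pv : psi x = v by rewrite -vx inv.
  exists (th v); last by rewrite inv1 // -pv.
  split; first by rewrite -img1; exists v => //; rewrite -pv.
  by rewrite /preimage /= inv1 // -pv.
by move=> u [/key[_ thu] Uu]; rewrite inv.
Qed.

Lemma coord_system_of_diffeo n (c : 'rV[R]_n) (eta : 'rV[R]_n -> 'rV[R]_n) :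
  smva 0 eta -> eta 0 = c -> jac eta 0 \in unitmx ->
  exists V, coord_system setT c V eta.
Proof.
move=> se e0 ue; have [g [sg g0 gK egK]] := inverse_germ se ue.
have [V [W [oV V0 oW [sV sW img inv]]]] := inverse_germs_open se sg g0 gK egK.
exists V; split => //; first by apply/smooth_onP.
by exists W, g; split => //; [apply/smooth_onP | rewrite setTI].
Qed.

Lemma coord_system_jac n (c : 'rV[R]_n) V (eta : 'rV[R]_n -> 'rV[R]_n) :
  coord_system setT c V eta -> smva 0 eta /\ jac eta 0 \in unitmx.
Proof.
case=> oV V0 eta0 se [W [psi [oW spsi img inv]]].
have s0 := smva_smooth_on oV se V0; split => //.
have Wp : W c by have [] : (setT `&` W) c by rewrite -img -eta0; exists 0.
have sp : smva (eta 0) psi by rewrite eta0; exact: smva_smooth_on oW spsi Wp.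
rewrite -row_free_unit; apply/row_freeP; exists (jac psi (eta 0)).
rewrite -jac_comp // -(jac_id (0 : 'rV[R]_n)); apply: jac_near.
by apply: filterS (open_near oV V0) => u /inv.
Qed.

End Coordinates.

(** * Normal form of a germ satisfying Whitney's condition *)

Lemma near_and (T : topologicalType) (x : T) (P Q : T -> Prop) :
  (\forall z \near x, P z) -> (\forall z \near x, Q z) -> \forall z \near x, P z /\ Q z.
Proof. by move=> nP nQ; apply: filterS2 nP nQ. Qed.

Section Equivalence.
Variable R : realType.

(** Equality up to smooth changes of coordinates in the source and in the target. *)
Definition germ_equiv n N (g g' : 'rV[R]_n -> 'rV[R]_N) := exists th eta,
  [/\ [/\ smva 0 th, th 0 = 0 & jac th 0 \in unitmx],
      smva (g' 0) eta, jac eta (g' 0) \in unitmx &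
      \forall z \near (0 : 'rV[R]_n), g z = eta (g' (th z))].

Lemma germ_equiv_trans n N (g1 g2 g3 : 'rV[R]_n -> 'rV[R]_N) :
  germ_equiv g1 g2 -> germ_equiv g2 g3 -> germ_equiv g1 g3.
Proof.
case=> th [eta [[sth th0 uth] se ue E]] [th' [eta' [[sth' th0' uth'] se' ue' E']]].
have e0 : g2 0 = eta' (g3 0) by rewrite (nbhs_singleton E') th0'.
rewrite e0 in se ue.
have sth0 : smva (th 0) th' by rewrite th0.
exists (fun z => th' (th z)), (fun y => eta (eta' y)); split.
- split; first exact: smva_comp.
    by rewrite th0.
  by rewrite jac_comp // unitmx_mul uth th0.
- exact: smva_comp.
- by rewrite jac_comp // unitmx_mul ue'.
have H : \forall z \near (0 : 'rV[R]_n), g2 (th z) = eta' (g3 (th' (th z))).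
  by apply: (smva_preim (P := fun y => g2 y = eta' (g3 (th' y))) sth); rewrite th0.
by apply: filterS2 E H => z -> ->.
Qed.

Lemma germ_equiv_whitney n N (g g' : 'rV[R]_n -> 'rV[R]_N) : smva 0 g' -> germ_equiv g g' ->
  whitney g 0 1%:M <-> whitney g' 0 1%:M.
Proof.
move=> sg [th [eta [[sth th0 uth] se ue E]]].
have E' : \forall z \near (0 : 'rV[R]_n), eta (g' (th z)) = g z.
  by apply: filterS E => z ->.
have -> : whitney g 0 1%:M <-> whitney (fun z => eta (g' (th z))) 0 1%:M.
  by split; apply: whitney_near.
have sg0 : smva (th 0) g' by rewrite th0.
have := @whitney_target R n N (fun z => g' (th z)) eta 0 _ 1%:M (smva_comp sth sg0).
rewrite th0 => /(_ se ue) ->.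
by have := whitney_source sth sg0 uth; rewrite th0.
Qed.

Lemma germ_equiv_near n N (g g1 : 'rV[R]_n -> 'rV[R]_N) :
  (\forall z \near (0 : 'rV[R]_n), g z = g1 z) -> germ_equiv g g1.
Proof.
move=> gg; exists id, id; split; rewrite ?jac_id ?unitmx1 //.
- by split; rewrite ?jac_id ?unitmx1 //; exact: smva_id.
- exact: smva_id.
Qed.

End Equivalence.

Section OneCoordinate.
Variables (R : realType) (n : nat) (i0 : 'I_n).
Local Notation V := 'rV[R]_n.
Local Notation setc := (setc i0).

Lemma smva_setc d (x : 'rV[R]_d) (f : 'rV[R]_d -> V) a : smva x f -> sma x a ->
  smva x (fun z => setc (f z) (a z)).
Proof.
move=> sf sa j; have [->|ji] := eqVneq j i0.
  by apply: sma_ext sa; apply: near_all => z; rewrite setc_at.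
by apply: sma_ext (sf j); apply: near_all => z; rewrite mxE (negPf ji).
Qed.

Lemma setc_ne (x : V) s j : j != i0 -> setc x s 0 j = x 0 j.
Proof. by move=> ji; rewrite mxE (negPf ji). Qed.

Lemma pd_coord i j (x : V) : pd i (fun z => z 0 j) x = (i == j)%:R.
Proof.
by rewrite /pd; case: (is_derive_coord x (delta_mx 0 i) j) => _ ->; rewrite mxE eqxx eq_sym.
Qed.

Lemma jac_setc (X : V -> R) x i j :
  jac (fun z => setc z (X z)) x i j = if j == i0 then pd i X x else (i == j)%:R.
Proof.
rewrite mxE; case: ifPn => ji.
  by rewrite (eqP ji); congr (pd i _ x); apply/funext => z; rewrite setc_at.
rewrite -(pd_coord i j x); congr (pd i _ x); apply/funext => z; exact: setc_ne.
Qed.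

Lemma setc_diffeo X : sma 0 X -> X 0 = 0 -> pd i0 X 0 != 0 ->
  [/\ smva 0 (fun z => setc z (X z)), setc 0 (X 0) = 0,
      jac (fun z => setc z (X z)) 0 \in unitmx &
      exists rho, [/\ smva 0 rho, rho 0 = 0,
        \forall z \near (0 : V), rho (setc z (X z)) = z &
        \forall z \near (0 : V), setc (rho z) (X (rho z)) = z]].
Proof.
move=> sX X0 dX.
have sth : smva 0 (fun z => setc z (X z)) by apply: smva_setc => //; exact: smva_id.
have th0 : setc 0 (X 0) = 0 by rewrite X0; apply/rowP => j; rewrite !mxE; case: ifP.
have uth : jac (fun z => setc z (X z)) 0 \in unitmx.
  rewrite -row_free_unit; apply/inj_row_free => v vJ; apply/rowP => j; rewrite [RHS]mxE.
  have off k : k != i0 -> v 0 k = 0.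
    move=> ki; move/rowP/(_ k): vJ; rewrite [RHS]mxE mxE (bigD1 k) //= big1 => [|i ik].
      by rewrite jac_setc (negPf ki) eqxx mulr1 addr0.
    by rewrite jac_setc (negPf ki) (negPf ik) mulr0.
  have [->|/off //] := eqVneq j i0.
  move/rowP/(_ i0): vJ; rewrite [RHS]mxE mxE (bigD1 i0) //= big1 => [|i ik].
    by rewrite jac_setc eqxx addr0 => /eqP; rewrite mulf_eq0 (negPf dX) orbF => /eqP.
  by rewrite off ?mul0r.
split => //; have [rho [s r0 rK Kr]] := inverse_germ sth uth.
by exists rho; rewrite th0 in s r0 Kr.
Qed.

(** Germs that keep all coordinates but [i0] and thus have corank at most one: up to
    coordinate changes, every germ of corank one has this form. *)
Definition flat q (a : V -> R) (c : V -> 'rV[R]_q) z := row_mx (setc z (a z)) (c z).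

Lemma smva_flat q a (c : V -> 'rV[R]_q) x : sma x a -> smva x c -> smva x (flat a c).
Proof.
by move=> sa sc; apply: smva_row_mx => //; apply: smva_setc => //; exact: smva_id.
Qed.

Lemma flat_source q X a (c : V -> 'rV[R]_q) rho : sma 0 X -> X 0 = 0 -> pd i0 X 0 != 0 ->
  smva 0 rho -> rho 0 = 0 -> (\forall z \near (0 : V), rho (setc z (X z)) = z) ->
  germ_equiv (flat a c) (flat (fun z => a (rho z)) (fun z => c (rho z))).
Proof.
move=> sX X0 dX sr r0 rK; have [sth th0 uth _] := setc_diffeo sX X0 dX.
exists (fun z => setc z (X z)), id; split; rewrite ?jac_id ?unitmx1 //.
  exact: smva_id.
by apply: filterS rK => z zK; rewrite /flat zK setc_setc.
Qed.

Lemma pd_translate (S f : V -> R) z : (forall x s, S (setc x s) = S x) ->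
  pd i0 (fun x => f (setc x (x 0 i0 + S x))) z = pd i0 f (setc z (z 0 i0 + S z)).
Proof.
move=> Si; set g := fun x => f _.
have E : (fun h : R => h^-1 *: ((g \o shift z) (h *: delta_mx 0 i0) - g z)) =
    (fun h : R => h^-1 *: ((f \o shift (setc z (z 0 i0 + S z))) (h *: delta_mx 0 i0)
      - f (setc z (z 0 i0 + S z)))).
  apply/funext => h; congr (_ *: (_ - _)); rewrite /g /= /shift /=; congr f.
  have -> : h *: delta_mx 0 i0 + z = setc z (h + z 0 i0) by rewrite -shift_setc setc_id.
  by rewrite setc_setc setc_at Si shift_setc addrA.
by rewrite /pd /derive E.
Qed.

Lemma pd_indep (f : V -> R) z : (forall x s, f (setc x s) = f x) -> pd i0 f z = 0.
Proof.
move=> fi; have : is_derive z (delta_mx 0 i0) f 0; last by case.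
apply: is_derive_line; apply: near_eq_is_derive (is_derive_cst (f z) (0 : R) 1).
by apply: near_all => h; rewrite -[X in _ + X](setc_id i0) shift_setc fi.
Qed.

Lemma pd_mul (a b : V -> R) i x : sma x a -> sma x b ->
  pd i (fun z => a z * b z) x = a x * pd i b x + b x * pd i a x.
Proof. by move=> sa sb; case: (is_derive_mul (sma_derive i sa) (sma_derive i sb)). Qed.

Lemma pd_add (a b : V -> R) i x : sma x a -> sma x b ->
  pd i (fun z => a z + b z) x = pd i a x + pd i b x.
Proof. by move=> sa sb; case: (is_derive_add (sma_derive i sa) (sma_derive i sb)). Qed.

Lemma pd_sub (a b : V -> R) i x : sma x a -> sma x b ->
  pd i (fun z => a z - b z) x = pd i a x - pd i b x.
Proof.
by move=> sa sb; case: (is_derive_add (sma_derive i sa) (is_derive_opp (sma_derive i sb))).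
Qed.

Lemma sma_preim d (f : V -> 'rV[R]_d) (a : 'rV[R]_d -> R) : smva 0 f -> f 0 = 0 -> sma 0 a ->
  sma 0 (fun z => a (f z)).
Proof. by move=> sf f0 sa; apply: sma_comp => //; rewrite f0. Qed.

Lemma near_preim d (f : V -> 'rV[R]_d) P : smva 0 f -> f 0 = 0 ->
  (\forall y \near (0 : 'rV[R]_d), P y) -> \forall z \near (0 : V), P (f z).
Proof. by move=> sf f0 Py; apply: smva_preim => //; rewrite f0. Qed.

Lemma setc00 : setc 0 0 = 0 :> V.
Proof. by apply/rowP => j; rewrite !mxE; case: ifP. Qed.

Lemma smva_setc0 : smva 0 (fun z : V => setc z 0).
Proof. by apply: smva_setc; [exact: smva_id | exact: sma_cst]. Qed.

Local Opaque pd sma.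

Lemma pd2_factor G H : sma 0 G -> sma 0 H ->
  (\forall z \near (0 : V), G z = G (setc z 0) + z 0 i0 * H z) ->
  pd i0 (pd i0 G) 0 = 2 * pd i0 H 0.
Proof.
move=> sG sH GH.
have sH1 := sma_pd i0 sH.
have sx : sma 0 (fun z : V => z 0 i0) by exact: sma_coord.
have sG0 : sma 0 (fun z => G (setc z 0)) by exact: sma_preim smva_setc0 setc00 sG.
have E : \forall z \near (0 : V), pd i0 G z = H z + z 0 i0 * pd i0 H z.
  apply: filterS2 (near_near GH) (filterI (sma_near sH) (sma_near sG0)) => z zE [szH szG].
  have sxz : sma z (fun z : V => z 0 i0) by exact: sma_coord.
  rewrite (pd_near i0 zE) (pd_add i0 szG (sma_mul sxz szH)) (pd_mul i0 sxz szH).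
  rewrite pd_indep ?add0r; last by move=> x s; rewrite setc_setc.
  by rewrite pd_coord eqxx mulr1 addrC.
rewrite (pd_near i0 E) (pd_add i0 sH (sma_mul sx sH1)) (pd_mul i0 sx sH1) pd_coord eqxx.
by rewrite mxE mul0r add0r mulr1 mulr2n mulrDl mul1r.
Qed.

(** Morse's lemma with parameters. The critical points of [a] along the lines
    parallel to the axis [i0] form a graph, by the inverse function theorem; once
    they are moved to the hyperplane [z 0 i0 = 0], Hadamard's lemma applied twice
    divides by the square of the coordinate, and a square root gives [X]. *)
Lemma morse a : sma 0 a -> pd i0 a 0 = 0 -> 0 < pd i0 (pd i0 a) 0 ->
  exists X d, [/\ [/\ sma 0 X, X 0 = 0 & pd i0 X 0 != 0],
    sma 0 d, forall x s, d (setc x s) = d x &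
    \forall z \near (0 : V), a z = X z ^+ 2 + d z].
Proof.
move=> sa a1 a2.
have sa1 := sma_pd i0 sa.
have [_ _ _ [be [sb b0 _ bK]]] := setc_diffeo sa1 a1 (lt0r_neq0 a2).
pose S z := be (setc z 0) 0 i0.
have Si x s : S (setc x s) = S x by rewrite /S setc_setc.
have sS : sma 0 S.
  by apply: (sma_preim (a := fun y => be y 0 i0) smva_setc0 setc00); exact: sb.
have S0 : S 0 = 0 by rewrite /S setc00 b0 mxE.
(* the critical points are z with z_i0 = S z *)
have crit : \forall z \near (0 : V), pd i0 a (setc z (S z)) = 0.
  apply: filterS (near_preim (P := fun y => setc (be y) (pd i0 a (be y)) = y) smva_setc0 setc00 bK) => z zE.
  have -> : setc z (S z) = be (setc z 0).
    by rewrite -[RHS](setc_id i0) -/(S z); apply/rowP => j; move/rowP/(_ j): zE; rewrite !mxE; case: ifP.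
  by move/rowP/(_ i0): zE; rewrite !setc_at.
pose tau z := setc z (z 0 i0 + S z).
have stau : smva 0 tau.
  by apply: smva_setc; [exact: smva_id | apply: sma_add; [exact: sma_coord | ]].
have tau0 : tau 0 = 0 by rewrite /tau S0 mxE addr0 setc00.
pose G z := a (tau z).
have sG : sma 0 G by exact: sma_preim stau tau0 sa.
have G1 z : pd i0 G z = pd i0 a (tau z) by exact: pd_translate.
have G2 : pd i0 (pd i0 G) 0 = pd i0 (pd i0 a) 0.
  rewrite (_ : pd i0 G = fun z => pd i0 a (tau z)); last exact/funext.
  by rewrite (pd_translate (pd i0 a) 0 Si) -/(tau 0) tau0.
have Gcrit : \forall z \near (0 : V), pd i0 G (setc z 0) = 0.
  by apply: filterS crit => z zE; rewrite G1 /tau setc_setc setc_at add0r Si.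
have [H [sH GH H1]] := hadamard_germ i0 sG.
have [K [sK HK K1]] := hadamard_germ i0 sH.
have GK : \forall z \near (0 : V), G z = G (setc z 0) + z 0 i0 ^+ 2 * K z.
  apply: filterS2 Gcrit (filterI GH HK) => z z0 [-> ->].
  by rewrite (H1 (setc z 0) (setc_at _ _ _)) z0 add0r mulrA expr2.
have K0 : 2 * K 0 = pd i0 (pd i0 a) 0.
  by rewrite -G2 (K1 0 (mxE _ _ _ _)) (pd2_factor sG sH GH).
have Kpos : 0 < K 0 by rewrite -(pmulr_rgt0 _ (ltr0n R 2)) K0.
pose ze z := setc z (z 0 i0 - S z).
have sze : smva 0 ze.
  by apply: smva_setc; [exact: smva_id | apply: sma_sub; [exact: sma_coord | ]].
have ze0 : ze 0 = 0 by rewrite /ze S0 mxE subr0 setc00.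
have tauK z : tau (ze z) = z by rewrite /tau /ze setc_setc setc_at Si subrK setc_id.
pose r z := Num.sqrt (K (ze z)).
have sr : sma 0 r.
  apply: (sma_sqrt (a := fun z => K (ze z))); first by rewrite ze0.
  exact: sma_preim sze ze0 sK.
have s1 : sma 0 (fun z : V => z 0 i0 - S z) by exact: sma_sub (sma_coord 0 i0) sS.
exists (fun z : V => (z 0 i0 - S z) * r z), (fun z => G (setc z 0)); split.
- split; first exact: sma_mul s1 sr.
    by rewrite S0 mxE subr0 mul0r.
  rewrite (pd_mul i0 s1 sr) S0 mxE subr0 mul0r add0r.
  rewrite (pd_sub i0 (sma_coord 0 i0) sS) (pd_indep 0 Si) subr0 pd_coord eqxx mulr1.
  by apply: lt0r_neq0; rewrite /r ze0 sqrtr_gt0.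
- exact: (sma_preim smva_setc0 setc00 sG).
- by move=> x s; rewrite setc_setc.
have Kp := near_preim (P := fun y => 0 < K y) sze ze0 (sma_gt0_near Kpos sK).
apply: filterS2 (near_preim (P := fun y => G y = G (setc y 0) + y 0 i0 ^+ 2 * K y) sze ze0 GK) Kp.
move=> z zE Kz.
have -> : a z = G (ze z) by rewrite /G tauK.
have e1 : setc (ze z) 0 = setc z 0 by rewrite /ze setc_setc.
have e2 : ze z 0 i0 = z 0 i0 - S z by exact: setc_at.
rewrite zE e1 e2 exprMn; have -> : r z ^+ 2 = K (ze z) by apply: sqr_sqrtr; exact: ltW.
exact: addrC.
Qed.

Lemma flat_morse q a (c : V -> 'rV[R]_q) : sma 0 a -> smva 0 c ->
  pd i0 a 0 = 0 -> 0 < pd i0 (pd i0 a) 0 -> jac c 0 = 0 ->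
  exists d c', [/\ germ_equiv (flat a c) (flat (fun z => z 0 i0 ^+ 2 + d z) c'),
    sma 0 d, smva 0 c', forall x s, d (setc x s) = d x & jac c' 0 = 0].
Proof.
move=> sa sc a1 a2 c1; have [X [d [[sX X0 X1] sd di aE]]] := morse sa a1 a2.
have [_ _ _ [rho [sr r0 rK Kr]]] := setc_diffeo sX X0 X1.
have sc0 : smva (rho 0) c by rewrite r0.
exists d, (fun z => c (rho z)); split => //.
- apply: germ_equiv_trans (flat_source a c sX X0 X1 sr r0 rK) _.
  apply: germ_equiv_near.
  apply: filterS2 Kr (near_preim (P := fun y => a y = X y ^+ 2 + d y) sr r0 aE) => z zK zE.
  rewrite /flat zE -[d (rho z)](di _ (X (rho z))) zK.
  by have -> : X (rho z) = z 0 i0 by rewrite -[in RHS]zK setc_at.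
- exact: smva_comp sr sc0.
- by rewrite (jac_comp sr sc0) r0 c1 mulmx0.
Qed.

(** The folding map: functions of [sqc z] are the even functions of [z]. *)
Definition sqc (z : V) : V := setc z (z 0 i0 ^+ 2).

Lemma smva_sqc x : smva x sqc.
Proof.
apply: smva_setc; first exact: smva_id.
by apply: (sma_ext (a := fun z => z 0 i0 * z 0 i0)); [exact: near_all | exact: sma_mul (sma_coord x i0) (sma_coord x i0)].
Qed.

Lemma sqc0 : sqc 0 = 0.
Proof. by rewrite /sqc mxE expr0n setc00. Qed.

Lemma pd_sqr i x : pd i (fun z : V => z 0 i0 ^+ 2) x = 2 * x 0 i0 * (i == i0)%:R.
Proof.
rewrite (@pd_mul (fun z => z 0 i0) (fun z => z 0 i0) i x (sma_coord x i0) (sma_coord x i0)).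
by rewrite pd_coord mulr2n mulrDl mul1r mulrDl.
Qed.

Lemma mul_jac_sqc v : v *m jac sqc 0 = setc v 0.
Proof.
apply/rowP => j; rewrite mxE [RHS]mxE; case: ifPn => ji.
  by rewrite big1 // => i _; rewrite jac_setc ji pd_sqr mxE mulr0 mul0r mulr0.
rewrite (bigD1 j) //= big1 => [|i ij]; rewrite jac_setc (negPf ji).
  by rewrite eqxx mulr1 addr0.
by rewrite (negPf ij) mulr0.
Qed.

Lemma pd_sqc A z : sma (sqc z) A -> pd i0 (fun x => A (sqc x)) z = 2 * z 0 i0 * pd i0 A (sqc z).
Proof.
move=> sA; rewrite (pd_comp i0 (smva_sqc z) sA) (bigD1 i0) //= big1 => [|k ki].
  by rewrite jac_setc eqxx pd_sqr eqxx mulr1 addr0.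
by rewrite jac_setc (negPf ki) eq_sym (negPf ki) mul0r.
Qed.

(** On the hyperplane [z 0 i0 = 0], the derivative of [c] in the direction [i0] is
    the odd coefficient [B]. *)
Lemma fold_derive A B c : sma 0 A -> sma 0 B ->
  (\forall z \near (0 : V), c z = A (sqc z) + z 0 i0 * B (sqc z)) ->
  pd i0 c 0 = B 0 /\ forall v : V, v 0 i0 = 0 -> grad_form (pd i0 c) 0 v = grad_form B 0 v.
Proof.
move=> sA sB cE.
have sA' : sma 0 (fun z => A (sqc z)) by exact: sma_preim (smva_sqc 0) sqc0 sA.
have sB' : sma 0 (fun z => B (sqc z)) by exact: sma_preim (smva_sqc 0) sqc0 sB.
pose P (z : V) := 2 * pd i0 A (sqc z) + 2 * (z 0 i0 * pd i0 B (sqc z)).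
have sP : sma 0 P.
  have sA1 := sma_preim (smva_sqc 0) sqc0 (sma_pd i0 sA).
  have sB1 := sma_preim (smva_sqc 0) sqc0 (sma_pd i0 sB).
  exact: sma_add (sma_mul (sma_cst 0 2) sA1) (sma_mul (sma_cst 0 2) (sma_mul (sma_coord 0 i0) sB1)).
have E : \forall z \near (0 : V), B (sqc z) + z 0 i0 * P z = pd i0 c z.
  have N1 := near_preim (smva_sqc 0) sqc0 (sma_near sA).
  have N2 := near_preim (smva_sqc 0) sqc0 (sma_near sB).
  have N := near_and (near_and (sma_near sA') (sma_near sB')) (near_and N1 N2).
  apply: filterS2 (near_near cE) N => z zE [[sAz sBz] [sAs sBs]].
  rewrite (pd_near i0 zE) (pd_add i0 sAz (sma_mul (sma_coord z i0) sBz)).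
  rewrite (pd_mul i0 (sma_coord z i0) sBz) (pd_sqc sAs) (pd_sqc sBs) pd_coord eqxx /P mulr1.
  move: (z 0 i0 : R) (pd i0 A _ : R) (pd i0 B _ : R) (B _ : R) => t u v w.
  by ring.
split.
  by rewrite -(nbhs_singleton E) mxE mul0r addr0 sqc0.
move=> v v0; rewrite -(grad_form_near v E).
have sB0 : sma (sqc 0) B by rewrite sqc0.
have dB := chain_dir v (smva_sqc 0) sB0.
have dP := is_derive_mul (is_derive_coord 0 v i0) (sma_derive_dir v sP).
have sE := sma_add sB' (sma_mul (sma_coord 0 i0) sP).
rewrite (grad_formE sE (is_derive_add dB dP)) mxE mul0r v0 mulr0 !addr0 mul_jac_sqc sqc0.
by rewrite -v0 setc_id.
Qed.

Lemma smva_negc (x : V) : smva x (negc i0).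
Proof. by apply: smva_setc; [exact: smva_id | exact: sma_opp (sma_coord x i0)]. Qed.

Lemma negcK (z : V) : negc i0 (negc i0 z) = z.
Proof. by rewrite /negc setc_at setc_setc opprK setc_id. Qed.

Lemma negc0 : negc i0 0 = 0 :> V.
Proof. by rewrite /negc mxE oppr0 setc00. Qed.

(** The odd part is the coordinate times an even function, by Hadamard's lemma. *)
Lemma parity_split f : sma 0 f -> exists A B, [/\ sma 0 A, sma 0 B &
  \forall z \near (0 : V), f z = A (sqc z) + z 0 i0 * B (sqc z)].
Proof.
move=> sf; have sfn : sma 0 (fun z => f (negc i0 z)) by exact: sma_preim (smva_negc 0) negc0 sf.
pose fe z := 2^-1 * (f z + f (negc i0 z)); pose fo z := 2^-1 * (f z - f (negc i0 z)).
have sfe : sma 0 fe by exact: sma_mul (sma_cst 0 _) (sma_add sf sfn).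
have sfo : sma 0 fo by exact: sma_mul (sma_cst 0 _) (sma_sub sf sfn).
have [A [sA AE]] : exists A, sma 0 A /\ \forall z \near (0 : V), fe z = A (sqc z).
  by apply: even_germ sfe _; apply: near_all => z; rewrite /fe negcK addrC.
have [H [sH HE _]] := hadamard_germ i0 sfo.
have fo0 z : fo (setc z 0) = 0 by rewrite /fo /negc setc_at oppr0 setc_setc subrr mulr0.
have [B [sB BE]] : exists B, sma 0 B /\ \forall z \near (0 : V), H z = B (sqc z).
  apply: even_germ sH _.
  apply: filterS2 HE (near_preim (P := fun y => fo y = fo (setc y 0) + y 0 i0 * H y) (smva_negc 0) negc0 HE) => z.
  rewrite !fo0 !add0r => e1 e2.
  have [z0|z0] := eqVneq (z 0 i0) 0.
    by rewrite /negc z0 oppr0 -z0 setc_id.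
  have e3 : fo (negc i0 z) = - fo z by rewrite /fo negcK; ring.
  apply: (mulfI z0); rewrite -e1 -[RHS]opprK -e3 e2.
  by rewrite setc_at mulNr opprK.
exists A, B; split => //; apply: filterS2 (filterI AE BE) HE => z [<- <-].
rewrite fo0 add0r => <-; rewrite /fe /fo.
by field.
Qed.

Lemma parity_split_row q (c : V -> 'rV[R]_q) : smva 0 c -> exists A B, [/\ smva 0 A, smva 0 B &
  \forall z \near (0 : V), c z = A (sqc z) + z 0 i0 *: B (sqc z)].
Proof.
move=> sc.
have [AB ABP] := choice (fun j => parity_split (sc j)).
have [BB BP] := choice ABP.
exists (fun z => \row_j AB j z), (fun z => \row_j BB j z); split.
- move=> j; have [sA _ _] := BP j; apply: sma_ext sA.
  by apply: near_all => z; rewrite mxE.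
- move=> j; have [_ sB _] := BP j; apply: sma_ext sB.
  by apply: near_all => z; rewrite mxE.
have N j : \forall z \near (0 : V), c z 0 j = AB j (sqc z) + z 0 i0 * BB j (sqc z).
  by case: (BP j).
by apply: filterS (near_forall N) => z zE; apply/rowP => j; rewrite !mxE zE.
Qed.

End OneCoordinate.

(** * The cross-cap *)

Section CrossCapGerm.
Variables (R : realType) (q : nat).
Local Notation V := 'rV[R]_(1 + q).
Local Notation i0 := (lshift q (0 : 'I_1)).
Local Notation setc := (setc i0).
Local Notation sqc := (sqc i0).
Local Notation flat := (flat i0).
Local Opaque pd sma.

Definition ccap : V -> 'rV[R]_((1 + q) + q) :=
  flat (fun z => z 0 i0 ^+ 2) (fun z => z 0 i0 *: rsubmx z).

Lemma ord_split_ind a b (P : 'I_(a + b) -> Prop) :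
  (forall k, P (lshift b k)) -> (forall k, P (rshift a k)) -> forall j, P j.
Proof.
move=> Pl Pr j; have [k jk|k jk] := splitP j.
  by rewrite (_ : j = lshift b k) //; exact: val_inj.
by rewrite (_ : j = rshift a k) //; exact: val_inj.
Qed.

Lemma grad_form_double (x v : V) i : grad_form (fun z => 2 * z 0 i) x v = 2 * v 0 i.
Proof.
rewrite (grad_formE (sma_mul (sma_cst x (2 : R)) (sma_coord x i)) (is_derive_mul (is_derive_cst (2 : R) x v) (is_derive_coord x v i))).
by rewrite mulr0 addr0.
Qed.

Lemma smva_lsubmx n a b (x : 'rV[R]_n) (f : 'rV[R]_n -> 'rV[R]_(a + b)) : smva x f ->
  smva x (fun z => lsubmx (f z)).
Proof. by move=> sf j; apply: sma_ext (sf (lshift b j)); apply: near_all => z; rewrite mxE. Qed.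

Lemma smva_rsubmx n a b (x : 'rV[R]_n) (f : 'rV[R]_n -> 'rV[R]_(a + b)) : smva x f ->
  smva x (fun z => rsubmx (f z)).
Proof. by move=> sf j; apply: sma_ext (sf (rshift a j)); apply: near_all => z; rewrite mxE. Qed.

Lemma smva_scale n d (x : 'rV[R]_n) a (f : 'rV[R]_n -> 'rV[R]_d) : sma x a -> smva x f ->
  smva x (fun z => a z *: f z).
Proof.
by move=> sa sf j; apply: sma_ext (sma_mul sa (sf j)); apply: near_all => z; rewrite mxE.
Qed.

Lemma sma_sqr (x : V) : sma x (fun z => z 0 i0 ^+ 2).
Proof.
apply: (sma_ext (a := fun z : V => z 0 i0 * z 0 i0)); first exact: near_all.
exact: sma_mul (sma_coord x i0) (sma_coord x i0).
Qed.

Lemma smva_ccap x : smva x ccap.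
Proof.
apply: smva_flat; first exact: sma_sqr.
exact: smva_scale (sma_coord x i0) (smva_rsubmx (smva_id x)).
Qed.

Lemma ccap0 : ccap 0 = 0.
Proof. by rewrite /ccap /flat mxE scale0r expr0n /= setc00 row_mx0. Qed.

Lemma setcE (z : V) s : setc z s = row_mx s%:M (rsubmx z).
Proof.
apply/rowP; elim/ord_split_ind => k.
  by rewrite ord1 row_mxEl !mxE eqxx.
by rewrite row_mxEr !mxE eq_rlshift.
Qed.

Definition head_row (B : V -> 'rV[R]_q) (z : V) : V := row_mx (z 0 i0)%:M (B z).

Lemma head_row_at B z : head_row B z 0 i0 = z 0 i0.
Proof. by rewrite row_mxEl mxE eqxx. Qed.

Lemma smva_head_row B x : smva x B -> smva x (head_row B).
Proof.
move=> sB; apply: smva_row_mx => // j; apply: sma_ext (sma_coord x i0).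
by apply: near_all => z; rewrite ord1 mxE eqxx.
Qed.

Lemma mul_jac_coord_row i (B : V -> 'rV[R]_q) x v :
  v *m jac (fun z => row_mx (z 0 i)%:M (B z) : V) x = row_mx (v 0 i)%:M (v *m jac B x).
Proof.
rewrite jac_row_mx mul_mx_row; congr row_mx; apply/rowP => j.
rewrite ord1 [RHS]mxE eqxx mulr1n mxE (bigD1 i) //= big1 => [|k ki].
  rewrite mxE addr0 (_ : (fun z : V => _) = fun z => z 0 i) ?pd_coord ?eqxx ?mulr1 //.
  by apply/funext => z; rewrite mxE eqxx.
rewrite mxE (_ : (fun z : V => _) = fun z => z 0 i) ?pd_coord ?(negPf ki) ?mulr0 //.
by apply/funext => z; rewrite mxE eqxx.
Qed.

Lemma mul_jac_head_row B x v : v *m jac (head_row B) x = row_mx (v 0 i0)%:M (v *m jac B x).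
Proof. exact: mul_jac_coord_row. Qed.

Section Fold.
Variables (d : V -> R) (A B c : V -> 'rV[R]_q).
Hypotheses (sd : sma 0 d) (di : forall x s, d (setc x s) = d x) (sc : smva 0 c).
Hypotheses (sA : smva 0 A) (sB : smva 0 B) (c1 : jac c 0 = 0).
Hypothesis cE : \forall z \near (0 : V), c z = A (sqc z) + z 0 i0 *: B (sqc z).

Let g := flat (fun z => z 0 i0 ^+ 2 + d z) c.

Let cjE j : \forall z \near (0 : V), c z 0 j = A (sqc z) 0 j + z 0 i0 * B (sqc z) 0 j.
Proof. by apply: filterS cE => z ->; rewrite !mxE. Qed.

Lemma fold_value : B 0 = 0.
Proof.
apply/rowP => j; have [<- _] := fold_derive (sA j) (sB j) (cjE j).
by move/matrixP/(_ i0 j): c1; rewrite !mxE.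
Qed.

Let pd_head z : sma z d -> pd i0 (fun x => x 0 i0 ^+ 2 + d x) z = 2 * z 0 i0.
Proof.
by move=> sdz; rewrite (pd_add i0 (sma_sqr z) sdz) (pd_indep z di) addr0 pd_sqr eqxx mulr1.
Qed.

(** If [v] is in the kernel of the differential of [head_row B], its first coordinate
    is 0 and the second derivative of the germ in the kernel direction and [v] is 0,
    against Whitney's condition. *)
Lemma fold_jac_unit : whitney g 0 1%:M -> jac (head_row B) 0 \in unitmx.
Proof.
move=> W; rewrite -row_free_unit; apply/inj_row_free => v vJ.
apply/eqP/negPn/negP => v0.
move: vJ; rewrite mul_jac_head_row -[RHS](@row_mx0 _ 1 1 q) => /eq_row_mx[/matrixP/(_ 0 0)].
rewrite !mxE eqxx => /= vi vB.
have e0 : delta_mx 0 i0 != 0 :> V.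
  by apply/eqP => /rowP/(_ i0)/eqP; rewrite !mxE !eqxx oner_eq0.
have e0J : (delta_mx 0 i0 : V) *m jac g 0 = 0.
  rewrite -rowE /g jac_row_mx c1; apply/rowP => j; rewrite [RHS]mxE mxE.
  have [k jk|k jk] := splitP j.
    rewrite (_ : j = lshift q k); last exact: val_inj.
    rewrite row_mxEl jac_setc; case: ifPn => [_|ki]; last by rewrite eq_sym (negPf ki).
    by rewrite pd_head // mxE mulr0.
  by rewrite (_ : j = rshift (1 + q) k) ?row_mxEr ?mxE //; exact: val_inj.
case/negP: (W _ _ e0 v0 e0J (submx1 v)).
rewrite -rowE /g djac_row_mx (_ : row i0 _ = 0) ?sub0mx //.
apply/rowP => j; rewrite [RHS]mxE mxE.
have [k jk|k jk] := splitP j; last first.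
  rewrite (_ : j = rshift (1 + q) k) ?row_mxEr ?mxE; last exact: val_inj.
  have [_ ->//] := fold_derive (sA k) (sB k) (cjE k).
  by rewrite grad_form_jac vB mxE.
rewrite (_ : j = lshift q k) ?row_mxEl ?mxE; last exact: val_inj.
have [ki|ki] := eqVneq k i0.
  have E : \forall z \near (0 : V), 2 * (z : V) 0 i0 = pd i0 (fun x => setc x (x 0 i0 ^+ 2 + d x) 0 k) z.
    apply: filterS (sma_near sd) => z /pd_head <-; congr (pd i0 _ z).
    by apply/funext => x; rewrite ki setc_at.
  rewrite -(grad_form_near v E).
  by rewrite grad_form_double -[v 0 _]mulr1n vi mulr0.
rewrite /grad_form big1 // => i _.
rewrite (_ : pd i0 _ = fun=> 0) ?pd_cst ?mulr0 //; apply/funext => z.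
rewrite (_ : (fun x => _) = fun x : V => x 0 k); last by apply/funext => x; exact: setc_ne.
by rewrite pd_coord eq_sym (negPf ki).
Qed.

(** The source change sends z = (z_0, y) to (z_0, B (z_0^2, y)). The target change
    undoes [d] and [A]; it recovers the folded point (z_0^2, y) because (z_0, B) is a
    local diffeomorphism. *)
Lemma fold_cross_cap : jac (head_row B) 0 \in unitmx -> germ_equiv g ccap.
Proof.
move=> uk; have B0 := fold_value; set ka := head_row B in uk.
have ska : smva 0 ka by exact: smva_head_row.
have ka0 : ka 0 = 0 by rewrite /ka /head_row B0 mxE; apply/rowP => j; rewrite !mxE; case: splitP => k; rewrite !mxE ?mul0rn.
(* [la] is the inverse of [ka = (z_0, B)] *)
have [la [sla la0 laK kal]] := inverse_germ ska uk; rewrite ka0 in sla la0 kal.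
have sBs : smva 0 (fun z => B (sqc z)) by apply: smva_comp; [exact: smva_sqc | rewrite sqc0].
pose th := head_row (fun z => B (sqc z)).
have sth : smva 0 th by exact: smva_head_row.
have th0 : th 0 = 0 by rewrite /th /head_row sqc0; exact: ka0.
have uth : jac th 0 \in unitmx.
  rewrite -row_free_unit; apply/inj_row_free => w.
  have sB0 : smva (sqc 0) B by rewrite sqc0.
  rewrite mul_jac_head_row (jac_comp (smva_sqc i0 0) sB0) sqc0 mulmxA mul_jac_sqc.
  move=> wJ; have wi : w 0 i0 = 0.
    by move/rowP/(_ i0): wJ; rewrite row_mxEl !mxE eqxx.
  move: uk; rewrite -row_free_unit => /row_free_inj; apply.
  have ws : setc w 0 = w by rewrite -[RHS](setc_id i0) wi.
  by rewrite mul0mx /ka mul_jac_head_row -[RHS]wJ ws.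
pose et (y : 'rV[R]_((1 + q) + q)) :=
  let v := la (lsubmx y) in row_mx (setc v (v 0 i0 + d v)) (A v + rsubmx y).
have sl : smva 0 (fun y : 'rV[R]_((1 + q) + q) => la (lsubmx y)).
  by apply: smva_comp; [exact: smva_lsubmx (smva_id 0) | rewrite linear0].
have l0 : la (lsubmx (0 : 'rV[R]_((1 + q) + q))) = 0 by rewrite linear0.
have set_ : smva 0 et.
  apply: smva_row_mx; last first.
    apply: smva_add; last exact: smva_rsubmx (smva_id 0).
    by apply: (smva_comp sl); rewrite l0.
  apply: (smva_setc i0 sl); apply: sma_add; first exact: sl.
  by apply: (sma_comp sl); rewrite l0.
have et0 : et 0 = row_mx (setc 0 (d 0)) (A 0).
  by rewrite /et l0 linear0 addr0 mxE add0r.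
(* [pi_] is a left inverse of [et], so that the differential of [et] is invertible *)
pose un (s : V) := setc s (s 0 i0 - d s).
pose pi_ (y : 'rV[R]_((1 + q) + q)) := row_mx (ka (un (lsubmx y))) (rsubmx y - A (un (lsubmx y))).
have unK v : un (setc v (v 0 i0 + d v)) = v.
  by rewrite /un setc_setc setc_at di addrK setc_id.
have sdi x : setc x 0 = 0 -> sma x d.
  move=> x0; apply: (sma_ext (a := fun z => d (setc z 0))).
    by apply: near_all => z; rewrite di.
  apply: (sma_comp (f := fun z => setc z 0) (b := d)); last by rewrite x0.
  by apply: smva_setc; [exact: smva_id | exact: sma_cst].
have sun : smva (setc 0 (d 0)) un.
  apply: smva_setc; first exact: smva_id.
  by apply: sma_sub; [exact: sma_coord | apply: sdi; rewrite setc_setc setc00].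
have un0 : un (setc 0 (d 0)) = 0.
  by have := unK 0; rewrite mxE add0r.
have spi : smva (et 0) pi_.
  have s1 : smva (et 0) (fun y => un (lsubmx y)).
    by apply: smva_comp; [exact: smva_lsubmx (smva_id _) | rewrite et0 row_mxKl].
  have e1 : un (lsubmx (et 0)) = 0 by rewrite et0 row_mxKl.
  apply: smva_row_mx; first by apply: (smva_comp s1); rewrite e1.
  move=> j; have sAj : sma (et 0) (fun y => A (un (lsubmx y)) 0 j).
    by apply: (sma_comp (b := fun v => A v 0 j) s1); rewrite e1; exact: sA.
  apply: sma_ext (sma_sub (smva_rsubmx (smva_id (et 0)) j) sAj).
  by apply: near_all => z; rewrite !mxE.
have piK : \forall y \near (0 : 'rV[R]_((1 + q) + q)), pi_ (et y) = y.
  have := smva_preim (P := fun w => ka (la w) = w) (smva_lsubmx (smva_id (0 : 'rV[R]_((1 + q) + q)))).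
  rewrite linear0 => /(_ kal); apply: filterS => y yE.
  by rewrite /pi_ /et row_mxKl row_mxKr unK yE addrC addKr hsubmxK.
have uet : jac et 0 \in unitmx.
  rewrite -row_free_unit; apply/row_freeP; exists (jac pi_ (et 0)).
  by rewrite -(jac_comp set_ spi) (jac_near piK) jac_id.
exists th, et; rewrite ccap0; split => //.
have N1 := near_preim (P := fun z => la (ka z) = z) (smva_sqc i0 0) (sqc0 R i0) laK.
apply: filterS2 cE N1 => z zE zK.
have tE : setc (th z) (th z 0 i0 ^+ 2) = ka (sqc z).
  by rewrite setcE head_row_at row_mxKr /ka /head_row setc_at.
rewrite /et /ccap /flat row_mxKl row_mxKr tE zK head_row_at row_mxKr -zE.
by rewrite setc_setc setc_at di.
Qed.

End Fold.

Lemma ccap_jac k : k *m jac ccap 0 = row_mx (setc k 0) 0.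
Proof.
rewrite jac_row_mx mul_mx_row -(mul_jac_sqc i0); congr row_mx.
rewrite (_ : jac _ 0 = 0) ?mulmx0 //; apply/matrixP => i j; rewrite !mxE.
rewrite (_ : (fun z => _) = fun z : V => z 0 i0 * z 0 (rshift 1 j)); last first.
  by apply/funext => z; rewrite !mxE.
by rewrite (pd_mul i (sma_coord 0 i0) (sma_coord 0 _)) !mxE !mul0r addr0.
Qed.

Lemma ccap_whitney : whitney ccap 0 1%:M.
Proof.
move=> k v k0 v0; rewrite ccap_jac -[X in _ = X]row_mx0 => /eq_row_mx[kE _] _.
have koff j : j != i0 -> k 0 j = 0.
  by move=> ji; move/rowP/(_ j): kE; rewrite setc_ne // mxE.
have ki : k 0 i0 != 0.
  apply: contra_neq k0 => ki; apply/rowP => j; rewrite mxE.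
  by have [->|/koff] := eqVneq j i0.
apply/negP => /submxP[w]; rewrite ccap_jac => wE.
have row_at (b : V -> R) j : (fun z => ccap z 0 j) = b ->
    k 0 i0 * grad_form (pd i0 b) 0 v = (row_mx (setc w 0) 0 : 'rV[R]_((1 + q) + q)) 0 j.
  move=> <-; rewrite -wE mxE (bigD1 i0) //= big1 => [|i ii]; first by rewrite addr0 mxE.
  by rewrite koff ?mul0r.
have s0 := sma_coord (0 : V) i0.
have hd := row_at (fun z => z 0 i0 ^+ 2) (lshift q i0).
rewrite row_mxEl setc_at in hd.
have vi : v 0 i0 = 0.
  have /hd/eqP : (fun z => ccap z 0 (lshift q i0)) = (fun z => z 0 i0 ^+ 2).
    by apply/funext => z; rewrite row_mxEl setc_at.
  rewrite mulf_eq0 (negPf ki) /=.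
  have E : \forall z \near (0 : V), 2 * (z : V) 0 i0 = pd i0 (fun z : V => z 0 i0 ^+ 2) z.
    by apply: near_all => z; rewrite pd_sqr eqxx mulr1.
  rewrite -(grad_form_near v E).
  by rewrite grad_form_double mulf_eq0 (negPf (lt0r_neq0 (ltr0n R 2))) => /eqP.
case/eqP: v0; apply/rowP; elim/ord_split_ind => y; rewrite [RHS]mxE; first by rewrite ord1.
have s1 := sma_coord (0 : V) (rshift 1 y).
have tl := row_at (fun z => z 0 i0 * z 0 (rshift 1 y)) (rshift (1 + q) y).
rewrite row_mxEr mxE in tl.
have /tl/eqP : (fun z => ccap z 0 (rshift (1 + q) y)) = (fun z => z 0 i0 * z 0 (rshift 1 y)).
  by apply/funext => z; rewrite row_mxEr !mxE.
rewrite mulf_eq0 (negPf ki) /=.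
have E : \forall z \near (0 : V), (z : V) 0 (rshift 1 y) = pd i0 (fun z : V => z 0 i0 * z 0 (rshift 1 y)) z.
  apply: near_all => z; rewrite (pd_mul i0 (sma_coord z i0) (sma_coord z _)) !pd_coord eqxx.
  by rewrite eq_lrshift mulr0 add0r mulr1.
by rewrite -(grad_form_near v E) (grad_formE s1 (is_derive_coord 0 v _)) => /eqP.
Qed.

Lemma jac_lsubmx n a b (f : 'rV[R]_n -> 'rV[R]_(a + b)) x :
  jac (fun z => lsubmx (f z)) x = lsubmx (jac f x).
Proof.
by apply/matrixP => i j; rewrite !mxE; congr (pd i _ x); apply/funext => z; rewrite mxE.
Qed.

Lemma jac_rsubmx n a b (f : 'rV[R]_n -> 'rV[R]_(a + b)) x :
  jac (fun z => rsubmx (f z)) x = rsubmx (jac f x).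
Proof.
by apply/matrixP => i j; rewrite !mxE; congr (pd i _ x); apply/funext => z; rewrite mxE.
Qed.

Lemma djac_affine n e x v (p : 'rV[R]_n) (A : 'M[R]_(n, e)) :
  djac (fun z => (z - p) *m A) x v = 0.
Proof.
apply/matrixP => i j; rewrite !mxE /grad_form big1 // => k _.
rewrite (_ : pd i _ = fun=> A i j) ?pd_cst ?mulr0 //; apply/funext => z.
by have /matrixP/(_ i j) := jac_affine z p A; rewrite mxE.
Qed.

Lemma djac_scale n e (f : 'rV[R]_n -> 'rV[R]_e) x s v : djac f x (s *: v) = s *: djac f x v.
Proof.
apply/matrixP => i j; rewrite !mxE /grad_form big_distrr /=.
by apply: eq_bigr => k _; rewrite mxE mulrA.
Qed.

(** In the target, the second derivative [u] in the kernel direction and a basis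
    [Jb] of the image are completed to a basis [Q]. The [Jb] components, with one
    source coordinate that does not vanish on the kernel, are source coordinates.
    The [u] component then has a positive second derivative along the kernel. *)
Lemma flat_reduction (g : V -> 'rV[R]_((1 + q) + q)) :
  smva 0 g -> \rank (jac g 0) = q -> whitney g 0 1%:M ->
  exists a c, [/\ germ_equiv g (flat a c), sma 0 a, smva 0 c &
    [/\ pd i0 a 0 = 0, 0 < pd i0 (pd i0 a) 0 & jac c 0 = 0]].
Proof.
move=> sg rJ W; set J := jac g 0 in rJ.
have rJn : (\rank J).+1 = (1 + q)%N by rewrite rJ.
have [k kJ k0] : exists2 k : V, k *m J = 0 & k != 0.
  have : kermx J != 0 by rewrite kermx_eq0 -row_leq_rank -ltnNge rJ.
  by case/rowV0Pn => k /sub_kermxP kJ k0; exists k.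
have kl := kernel_line k0 kJ rJn.
set u := k *m djac g 0 k.
have uJ : ~~ (u <= J)%MS by apply: W; rewrite ?submx1.
have [Jb JbE] : exists Jb : 'M[R]_(q, (1 + q) + q), (Jb :=: J)%MS.
  exists (castmx (rJ, erefl) (row_base J)).
  exact: eqmx_trans (eqmx_cast _ _) (eq_row_base _).
have fJb : row_free Jb by rewrite /row_free JbE rJ.
have fB : row_free (col_mx u Jb).
  apply/inj_row_free => c; rewrite -[c]hsubmxK mul_row_col.
  set c0 := lsubmx c; set c1 := rsubmx c => cE.
  have c00 : c0 = 0.
    apply/eqP/negPn/negP => n0; case/negP: uJ.
    have n00 : c0 0 0 != 0.
      by apply: contra_neq n0 => e; apply/rowP => j; rewrite ord1 e mxE.
    have -> : u = - (c0 0 0)^-1 *: (c1 *m Jb).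
      move/eqP: cE; rewrite addr_eq0 => /eqP cE.
      have cE' : c0 0 0 *: u = - (c1 *m Jb) by rewrite -mul_scalar_mx -mx11_scalar.
      by rewrite scaleNr -scalerN -cE' scalerA mulVf // scale1r.
    by rewrite scalemx_sub // -JbE submxMl.
  move: cE; rewrite c00 mul0mx add0r => c1E.
  by rewrite (row_free_inj fJb (_ : c1 *m _ = 0 *m _)) ?mul0mx // row_mx0.
have [A fA] := complete_rows fB (addnC (1 + q)%N q).
pose Q := col_mx (col_mx u Jb) A.
have uQ : Q \in unitmx by rewrite -row_full_unit -sub1mx -addsmxE sub1mx.
have [T JT] : exists T, J = T *m Jb by apply/submxP; rewrite JbE.
have JQ : J *m invmx Q = row_mx (row_mx 0 T) 0.
  apply: (canLR (mulmxK uQ)).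
  by rewrite /Q !mul_row_col !mul0mx add0r addr0.
have uE : u *m invmx Q = row_mx (row_mx 1%:M 0) 0.
  apply: (canLR (mulmxK uQ)).
  by rewrite /Q !mul_row_col !mul0mx mul1mx !addr0.
pose l1 (y : 'rV[R]_((1 + q) + q)) := (y - g 0) *m invmx Q.
have sl1 y : smva y l1 by exact: smva_affine.
pose g1 z := l1 (g z).
have sg1 : smva 0 g1 by exact: smva_comp sg (sl1 _).
have J1 : jac g1 0 = row_mx (row_mx 0 T) 0.
  by rewrite (jac_comp sg (sl1 _)) jac_affine JQ.
have D1 : k *m djac g1 0 k = row_mx (row_mx 1%:M 0) 0.
  by rewrite (djac_comp k sg (sl1 _)) djac_affine mulmx0 addr0 jac_affine mulmxA uE.
have g10 : g1 0 = 0 by rewrite /g1 /l1 subrr mul0mx.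
have /rV0Pn[i ki] := k0.
pose b z := rsubmx (lsubmx (g1 z)).
have sb : smva 0 b by exact: smva_rsubmx (smva_lsubmx sg1).
have Jb1 : jac b 0 = T by rewrite jac_rsubmx jac_lsubmx J1 row_mxKl row_mxKr.
have TJ (w : V) : w *m T = 0 -> w *m J = 0 by move=> wT; rewrite JT mulmxA wT mul0mx.
pose th (z : V) : V := row_mx (z 0 i)%:M (b z).
have sth : smva 0 th.
  apply: smva_row_mx => // j; apply: sma_ext (sma_coord 0 i).
  by apply: near_all => z; rewrite ord1 mxE eqxx.
have th0 : th 0 = 0 by rewrite /th /b g10 !linear0 mxE raddf0 row_mx0.
have uth : jac th 0 \in unitmx.
  rewrite -row_free_unit; apply/inj_row_free => v.
  rewrite mul_jac_coord_row Jb1 -[RHS](@row_mx0 _ 1 1 q) => /eq_row_mx[/matrixP/(_ 0 0)].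
  rewrite !mxE eqxx mulr1n => vi /TJ/kl[s vE]; move/eqP: vi.
  by rewrite vE mxE mulf_eq0 (negPf ki) orbF => /eqP ->; rewrite scale0r.
have [rho [sr r0 rK Kr]] := inverse_germ sth uth; rewrite th0 in sr r0 Kr.
have sg1r : smva (rho 0) g1 by rewrite r0.
have sthr : smva (rho 0) th by rewrite r0.
pose g2 z := g1 (rho z).
have sg2 : smva 0 g2 by exact: smva_comp sr sg1r.
pose a z := lsubmx (lsubmx (g2 z)) 0 0; pose c z := rsubmx (g2 z).
have sa : sma 0 a by exact: smva_lsubmx (smva_lsubmx sg2) 0.
have sc : smva 0 c by exact: smva_rsubmx sg2.
have J2 : jac g2 0 = row_mx (row_mx 0 (jac rho 0 *m T)) 0.
  by rewrite (jac_comp sr sg1r) r0 J1 !mul_mx_row !mulmx0.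
have pdaE z : pd i0 a z = jac g2 z i0 (lshift q (lshift q 0)).
  by rewrite mxE; congr (pd i0 _ z); apply/funext => y; rewrite /a !mxE.
have pda : pd i0 a 0 = 0 by rewrite pdaE J2 !row_mxEl mxE.
have pdda : 0 < pd i0 (pd i0 a) 0.
  pose e0 : V := delta_mx 0 i0; set w := e0 *m jac rho 0.
  have wT : w *m T = 0.
    have sbr : smva (rho 0) b by rewrite r0.
    have := jac_comp sr sbr; rewrite r0 Jb1 /w -mulmxA => <-.
    have bE : \forall z \near (0 : V), b (rho z) = rsubmx z.
      by apply: filterS Kr => z zE; rewrite -[in RHS]zE row_mxKr.
    rewrite (jac_near bE) jac_rsubmx jac_id -rowE; apply/rowP => j; rewrite !mxE.
    by rewrite eq_lrshift.
  have [s wE] := kl _ (TJ _ wT).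
  have s0 : s != 0.
    apply/eqP => s0.
    have w0 : e0 *m jac rho 0 = 0 by rewrite -/w wE s0 scale0r.
    have := jac_comp sr sthr; rewrite (jac_near Kr) jac_id => /(congr1 (mulmx e0)).
    rewrite mulmx1 mulmxA w0 mul0mx => /rowP/(_ i0)/eqP.
    by rewrite !mxE !eqxx oner_eq0.
  have -> : pd i0 (pd i0 a) 0 = (e0 *m djac g2 0 e0) 0 (lshift q (lshift q 0)).
    rewrite -rowE [RHS]mxE [RHS]mxE /e0 -[delta_mx 0 i0]scale1r grad_form_axis mul1r; congr (pd i0 _ 0); apply/funext => z.
    by rewrite pdaE mxE.
  rewrite (djac_comp e0 sr sg1r) r0 -/w wE djac_scale J1 mulmxDr mulmxA -!scalemxAr.
  rewrite [e0 *m (jac rho 0 *m _)]mulmxA -/w wE -scalemxAl D1 scalerA !mul_mx_row !mulmx0.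
  by rewrite mxE row_mxEl row_mxEl [X in X + _]mxE add0r mxE !row_mxEl mxE mulr1 -expr2 exprn_even_gt0.
exists a, c; split => //; last first.
  by split => //; rewrite jac_rsubmx J2 row_mxKr.
have gE : \forall z \near (0 : V), g2 z = flat a c z.
  apply: filterS Kr => z zE; rewrite /flat setcE -[LHS]hsubmxK; congr row_mx.
  rewrite -[LHS]hsubmxK; congr row_mx; first exact: mx11_scalar.
  by rewrite -[in RHS]zE row_mxKr.
exists th, (fun y => y *m Q + g 0).
have sq : smva (flat a c 0) (fun y => y *m Q) by apply: smva_mulmx; exact: smva_id.
split => //.
- exact: smva_add sq (smva_cst _ _).
- rewrite (jac_add sq (smva_cst _ _)) jac_cst addr0 jac_mulmx ?jac_id ?mul1mx //.
  exact: smva_id.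
apply: filterS2 rK (near_preim (P := fun y => g2 y = flat a c y) sth th0 gE) => z zE <-.
by rewrite /g2 zE /g1 /l1 mulmxKV // subrK.
Qed.

(** Whitney's normal form, by composing the coordinate changes found above. The
    second-order condition survives the first two and makes the third one possible. *)
Theorem whitney_cross_cap (g : V -> 'rV[R]_((1 + q) + q)) :
  smva 0 g -> \rank (jac g 0) = q -> whitney g 0 1%:M -> germ_equiv g ccap.
Proof.
move=> sg rJ W; have [a [c [E1 sa sc [a1 a2 c1]]]] := flat_reduction sg rJ W.
have [d [c' [E2 sd sc' di c1']]] := flat_morse sa sc a1 a2 c1.
have [A [B [sA sB cE]]] := parity_split_row i0 sc'.
have E := germ_equiv_trans E1 E2; apply: germ_equiv_trans E _.
have E := germ_equiv_trans E1 E2.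
apply: (fold_cross_cap sd di sA sB c1' cE).
apply: (fold_jac_unit sd di sA sB c1' cE).
apply/(germ_equiv_whitney _ E) => //.
exact: smva_flat (sma_add (sma_sqr 0) sd) sc'.
Qed.

End CrossCapGerm.

(** * Rank, minors and normal forms on the zero set *)

Section Restriction.
Variables (R : realType) (m l d : nat).
Variables (h : 'rV[R]_(m + l) -> 'rV[R]_l) (f : 'rV[R]_(m + l) -> 'rV[R]_d).
Variable p : 'rV[R]_(m + l).
Hypotheses (sh : smooth h) (sf : smooth f) (hp : h p = 0) (rh : \rank (jac h p) = l).

Let Z := h @^-1` [set 0].
Let F := pair_map h f.

Lemma smva_pair_map : smva p F.
Proof. by apply: smva_row_mx; exact: smva_smooth. Qed.

Lemma rank_chart U phi : coord_system Z p U phi ->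
  (\rank (jac (fun u : 'rV[R]_m => f (phi u)) 0%R) + l)%N = \rank (jac F p).
Proof.
move=> /(coord_system_germ sh rh)[sphi phi0 hphi fphi phiT].
by have := chart_rank sphi phi0 (smva_smooth p sh) (smva_smooth p sf) hphi phiT fphi; rewrite rh.
Qed.

Lemma smva_chart d' (g : 'rV[R]_(m + l) -> 'rV[R]_d') U phi : coord_system Z p U phi -> smva p g ->
  smva (0 : 'rV[R]_m) (fun u => g (phi u)).
Proof.
move=> /(coord_system_germ sh rh)[sphi phi0 _ _ _] sg.
by apply: smva_comp => //; rewrite phi0.
Qed.

Lemma restr_rankP r : restr_rank m Z f p r <-> \rank (Jac F p) = (r + l)%N.
Proof.
rewrite (Jac_jac smva_pair_map) mxrank_tr; split.
  case=> U [phi [C]]; rewrite (Jac_jac (smva_chart C (smva_smooth p sf))) mxrank_tr => <-.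
  by rewrite (rank_chart C).
move=> rE; have [U [phi C]] := coord_system_exists sh hp rh.
exists U, phi; split => //.
rewrite (Jac_jac (smva_chart C (smva_smooth p sf))) mxrank_tr.
by apply: (@addIn l); rewrite -rE (rank_chart C).
Qed.

Hypothesis m_gt0 : (0 < m)%N.
Hypothesis rF : \rank (jac F p) = (m - 1 + l)%N.

Let rFS : (\rank (jac F p)).+1 = (m + l)%N.
Proof. by rewrite rF -addSn subn1 prednK. Qed.

Lemma regular_zero_whitney U phi : coord_system Z p U phi ->
  \rank (Jac (max_minors F \o phi) (0 : 'rV[R]_m)) = m <-> whitney (fun u => f (phi u)) 0 1%:M.
Proof.
move=> C; have [sphi phi0 hphi fphi phiT] := coord_system_germ sh rh C.
have sF := smva_pair_map; have smu := smva_max_minors sF.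
rewrite (Jac_jac (smva_chart C smu)) mxrank_tr.
have smu0 : smva (phi 0) (max_minors F) by rewrite phi0.
rewrite (whitney_chart sphi phi0 (smva_smooth p sh) (smva_smooth p sf) hphi phiT fphi).
rewrite -(whitney_eqmx _ _ phiT) -(minors_whitney sF rFS fphi).
have -> : jac (max_minors F \o phi) 0 = jac phi 0 *m jac (max_minors F) p.
  by rewrite -[in RHS]phi0; exact: jac_comp.
by rewrite /row_free; split=> [->|/eqP].
Qed.

Lemma max_minors_vanish : max_minors F p = 0.
Proof. by apply/(max_minors_eq0 smva_pair_map); rewrite -row_leq_rank -ltnNge rFS. Qed.

End Restriction.

Section Casts.
Variables (R : realType) (q N : nat) (eN : ((1 + q) + q)%N = N).

(** The target dimension of the cross-cap appears as [2 * q.+1 - 1] in the theorem and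
    as [(1 + q) + q] in the normal form. *)
Definition cast_ccap (z : 'rV[R]_(1 + q)) : 'rV[R]_N := castmx (erefl 1%N, eN) (ccap z).

Lemma cast_ccap0 : cast_ccap 0 = 0.
Proof. by rewrite /cast_ccap; case: N / eN; rewrite castmx_id ccap0. Qed.

Lemma whitney_cast_ccap (g : 'rV[R]_(1 + q) -> 'rV[R]_N) : smva 0 g -> \rank (jac g 0) = q ->
  whitney g 0 1%:M <-> germ_equiv g cast_ccap.
Proof.
rewrite /cast_ccap; case: N / eN g => g sg rg.
rewrite (_ : (fun z => _) = @ccap R q); last by apply/funext => z; rewrite castmx_id.
split; first exact: whitney_cross_cap.
by move/(germ_equiv_whitney (smva_ccap 0)) => ->; exact: ccap_whitney.
Qed.

Lemma cast_ccapE z (j : 'I_N) : cast_ccap z 0 j =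
  if j == 0%N :> nat then entry z 0%N ^+ 2
  else if (j < q.+1)%N then entry z j
  else entry z 0%N * entry z (j - q.+1).+1%N.
Proof.
have entryE k (lt : (k < 1 + q)%N) : entry z k = z 0 (Ordinal lt).
  by rewrite /entry insubT.
rewrite /cast_ccap; case: N / eN j => j; rewrite castmx_id.
elim/ord_split_ind: j => k; last first.
  rewrite row_mxEr !mxE (entryE _ (ltn0Sn _)) /= addKn.
  rewrite (_ : (1 + q + k < q.+1)%N = false); last by apply/negbTE; rewrite -leqNgt leq_addr.
  have lk : (k.+1 < 1 + q)%N by rewrite add1n ltnS.
  by rewrite (entryE _ lk); congr (z 0 _ * z 0 _); exact: val_inj.
rewrite row_mxEl /= (ltn_ord k).
have [k0|k0] := eqVneq (k : nat) 0%N.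
  rewrite (_ : k = lshift q 0); last exact: val_inj.
  by rewrite setc_at (entryE _ (ltn0Sn _)); congr (z 0 _ ^+ 2); exact: val_inj.
rewrite setc_ne; last by apply: contra_neq k0 => ->.
by rewrite (entryE _ (ltn_ord k)); congr (z 0 _); exact: val_inj.
Qed.

End Casts.

Theorem proposition6p5 (R : realType) (m l : nat)
    (h : 'rV[R]_(m + l) -> 'rV[R]_l)
    (f : 'rV[R]_(m + l) -> 'rV[R]_(2 * m - 1))
    (p : 'rV[R]_(m + l)) :
  let Z := h @^-1` [set 0] in
  let mu := max_minors (pair_map h f) in
  (2 <= m)%N ->
  smooth h ->
  Z !=set0 ->
  (forall x, Z x -> \rank (Jac h x) = l) ->
  smooth f ->
  Z p ->
  (restr_rank m Z f p (m - 1) <->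
   \rank (Jac (pair_map h f) p) = (m - 1 + l)%N) /\
  (restr_rank m Z f p (m - 1) ->
   (cross_cap Z f p <-> regular_zero m Z mu p)).
Proof.
case: m h f p => [//|q] h f p Z mu _ sh _ rk sf Zp.
have rh : \rank (jac h p) = l by rewrite -mxrank_tr -Jac_jac ?rk //; exact: smva_smooth.
have R1 := restr_rankP sh sf Zp rh; split; first exact: R1.
move=> /R1; rewrite (Jac_jac (smva_pair_map p sh sf)) mxrank_tr => rF.
have rz U phi := @regular_zero_whitney R q.+1 l _ h f p sh sf rh (ltn0Sn q) rF U phi.
have eN : ((1 + q) + q = 2 * q.+1 - 1)%N by lia.
have rg U phi : coord_system Z p U phi -> \rank (jac (fun u : 'rV[R]_(1 + q) => f (phi u)) 0%R) = q.
  by move=> C; apply: (@addIn l); rewrite (rank_chart sh sf rh C) rF subn1.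
have normal U phi (C : coord_system Z p U phi) :=
  whitney_cast_ccap eN (smva_chart sh rh C (smva_smooth p sf)) (rg U phi C).
have formE : @cross_cap_form R q.+1 = cast_ccap eN.
  by apply/funext => z; apply/rowP => j; rewrite [LHS]mxE cast_ccapE.
split.
  case=> U [phi [V [eta [C Ceta fE]]]].
  split; first exact: max_minors_vanish.
  exists U, phi; split => //; apply/(rz U phi C)/(normal U phi C).
  have [se ue] := coord_system_jac Ceta.
  exists id, eta; rewrite cast_ccap0; split => //.
    by split; rewrite ?jac_id ?unitmx1 //; exact: smva_id.
  by rewrite -formE.
case=> _ [U [phi [C /(rz U phi C)/(normal U phi C)]]].
case=> th [eta [[sth th0 uth] se ue E]]; rewrite cast_ccap0 in se ue.
have [U' [rho [C' sr r0 rK]]] := coord_system_change C sth th0 uth.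
have [_ phi0 _ _ _] := coord_system_germ sh rh C.
have eta0 : eta 0 = f p by rewrite -phi0 (nbhs_singleton E) th0 cast_ccap0.
have [V Ceta] := coord_system_of_diffeo se eta0 ue.
exists U', (fun u => phi (rho u)), V, eta; split => //.
rewrite formE.
by apply: filterS2 rK (near_preim (P := fun z => f (phi z) = eta (cast_ccap eN (th z))) sr r0 E) => u uE ->; rewrite uE.
Qed.
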